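(* Let $Z_\infty=(X_\infty,Y_\infty)$ with $X_\infty(x,y)=(1,2\sin(2\pi x))$ for $y\ge0$, $Y_\infty(x,y)=(-1,2\sin(2\pi x))$ for $y\le0$, and $\Lambda_\infty=\{(x,\pm P_\infty(x)):x\in\mathbb{R}\}$ with $P_\infty(x)=\frac{1-\cos(2\pi x)}{\pi}$. Let $\widetilde Z$ be any planar PSVF presenting an $\infty$-homoclinic loop, and let $\widetilde\Lambda$ be the set formed by this loop. Then $Z_\infty$ restricted to $\Lambda_\infty$ and $\widetilde Z$ restricted to $\widetilde\Lambda$ are $\Sigma$-equivalent.
   Context: A planar PSVF $Z=(X,Y)$ with switching manifold $\Sigma=f^{-1}(0)$ ($f$ smooth, $0$ a regular value) equals the smooth field $X$ on $\Sigma^+=\{f\ge0\}$ and $Y$ on $\Sigma^-=\{f\le0\}$ (for $Z_\infty$, $f(x,y)=y$). With $Wf=\langle\nabla f,W\rangle$, $W^2f=\langle\nabla(Wf),W\rangle$: crossing points are $p\in\Sigma$ with $Xf(p)Yf(p)>0$; sliding region $\{Xf<0<Yf\}$, escaping $\{Yf<0<Xf\}$, with sliding field $Z^T=(Yf\,X-Xf\,Y)/(Yf-Xf)$. A point $p\in\Sigma$ is a fold of $X$ if $Xf(p)=0\neq X^2f(p)$, visible if $X^2f(p)>0$; a fold of $Y$ is visible if $Y^2f(p)<0$; a visible-visible two-fold is a visible fold of both. Trajectories follow the Filippov convention (off $\Sigma$ follow $X$ or $Y$; cross at crossing points; use $Z^T$ on sliding/escaping regions as usual; at a regular tangency choose any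 of $X,Y,Z^T$ backward and forward); a global trajectory is a bi-infinite orientation-preserving concatenation of local trajectories defined for all $t\in\mathbb{R}$. An $\infty$-homoclinic loop is a global trajectory presenting infinitely many visible-visible two-folds $p_1,p_2,\dots$ such that, after passing through $p_i$, the trajectory reaches $\Sigma$ either at $p_{i-1}$ or at $p_{i+1}$. $Z|_\Lambda$ and $\widetilde Z|_{\widetilde\Lambda}$ are $\Sigma$-equivalent if there is an orientation-preserving homeomorphism $h:\Lambda\to\widetilde\Lambda$ sending $\Lambda\cap\Sigma$ onto $\widetilde\Lambda\cap\widetilde\Sigma$, orbits of $X$ in $\Lambda\cap\Sigma^+$ onto orbits of $\widetilde X$ in $\widetilde\Lambda\cap\widetilde\Sigma^+$, orbits of $Y$ in $\Lambda\cap\Sigma^-$ onto orbits of $\widetilde Y$ in $\widetilde\Lambda\cap\widetilde\Sigma^-$, and orbits of $Z^T$ onto orbits of $\widetilde Z^T$.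
   Formalization: The two-folds are distinct and indexed by all integers; from each p_i the X-orbit is required to return to Σ first at p_{i+1} and the Y-orbit at p_{i-1}; the set formed by the loop is the union of all these arcs, as the literal image of one trajectory can be just a line. *)

(* Defs.v *)
From Stdlib Require Import Reals Lra ZArith List.
From Coquelicot Require Import Coquelicot.
Open Scope R_scope.

Definition pt := (R * R)%type.
Definition vfield := pt -> pt.

Definition dx (g : pt -> R) : pt -> R :=
  fun p => Derive (fun x => g (x, snd p)) (fst p).
Definition dy (g : pt -> R) : pt -> R :=
  fun p => Derive (fun y => g (fst p, y)) (snd p).

Fixpoint ipart (w : list bool) (g : pt -> R) : pt -> R :=
  match w with
  | nil => g
  | b :: w' => (if b then dx else dy) (ipart w' g)
  end.

Definition smooth_fun (g : pt -> R) : Prop :=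
  forall (w : list bool) (p : pt),
    ex_derive (fun x => ipart w g (x, snd p)) (fst p) /\
    ex_derive (fun y => ipart w g (fst p, y)) (snd p) /\
    continuous (ipart w g) p.

Definition smooth_vf (W : vfield) : Prop :=
  smooth_fun (fun p => fst (W p)) /\ smooth_fun (fun p => snd (W p)).

Definition lie (W : vfield) (f : pt -> R) : pt -> R :=
  fun p => dx f p * fst (W p) + dy f p * snd (W p).
Definition lie2 (W : vfield) (f : pt -> R) : pt -> R := lie W (lie W f).

(** A planar piecewise smooth vector field Z = (X, Y) with switching
    manifold Sigma = f^{-1}(0). *)
Record PSVF := mkPSVF { psX : vfield; psY : vfield; psf : pt -> R }.

Definition wf_psvf (Z : PSVF) : Prop :=
  smooth_vf (psX Z) /\ smooth_vf (psY Z) /\ smooth_fun (psf Z) /\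
  forall p, psf Z p = 0 -> (dx (psf Z) p, dy (psf Z) p) <> (0, 0).

Definition in_Sigma (Z : PSVF) (p : pt) : Prop := psf Z p = 0.
Definition in_Sigma_plus (Z : PSVF) (p : pt) : Prop := psf Z p >= 0.
Definition in_Sigma_minus (Z : PSVF) (p : pt) : Prop := psf Z p <= 0.

Definition Xf (Z : PSVF) := lie (psX Z) (psf Z).
Definition Yf (Z : PSVF) := lie (psY Z) (psf Z).

Definition sliding (Z : PSVF) (p : pt) : Prop :=
  in_Sigma Z p /\ Xf Z p < 0 < Yf Z p.
Definition escaping (Z : PSVF) (p : pt) : Prop :=
  in_Sigma Z p /\ Yf Z p < 0 < Xf Z p.

Definition slide_field (Z : PSVF) : vfield :=
  fun p =>
    ((Yf Z p * fst (psX Z p) - Xf Z p * fst (psY Z p)) / (Yf Z p - Xf Z p),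
     (Yf Z p * snd (psX Z p) - Xf Z p * snd (psY Z p)) / (Yf Z p - Xf Z p)).

(** phi solves the ODE  phi' = W(phi)  on [a, b] (integral form; phi is
    assumed continuous separately). *)
Definition solves (W : vfield) (a b : R) (phi : R -> pt) : Prop :=
  a <= b /\
  forall s, a <= s <= b ->
    fst (phi s) = fst (phi a) + RInt (fun u => fst (W (phi u))) a s /\
    snd (phi s) = snd (phi a) + RInt (fun u => snd (W (phi u))) a s.

Definition local_piece (Z : PSVF) (a b : R) (g : R -> pt) : Prop :=
  (solves (psX Z) a b g /\ forall s, a <= s <= b -> in_Sigma_plus Z (g s)) \/
  (solves (psY Z) a b g /\ forall s, a <= s <= b -> in_Sigma_minus Z (g s)) \/
  (solves (slide_field Z) a b g /\
   forall s, a <= s <= b ->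
     in_Sigma Z (g s) /\ Xf Z (g s) * Yf Z (g s) <= 0 /\
     Yf Z (g s) - Xf Z (g s) <> 0).

(** A global trajectory: a continuous curve defined for all t which, near
    every time t, is backward and forward a local Filippov trajectory
    (i.e. a locally finite concatenation of local trajectories). *)
Definition global_traj (Z : PSVF) (g : R -> pt) : Prop :=
  (forall t, continuous g t) /\
  forall t, exists eps, eps > 0 /\
    local_piece Z (t - eps) t g /\ local_piece Z t (t + eps) g.

Definition vv_twofold (Z : PSVF) (p : pt) : Prop :=
  in_Sigma Z p /\
  Xf Z p = 0 /\ lie2 (psX Z) (psf Z) p > 0 /\
  Yf Z p = 0 /\ lie2 (psY Z) (psf Z) p < 0.

Definition first_return_arc (Z : PSVF) (W : vfield) (side : R -> Prop)
  (p q : pt) (T : R) (phi : R -> pt) : Prop :=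
  T > 0 /\ (forall s, continuous phi s) /\ solves W 0 T phi /\
  phi 0 = p /\ phi T = q /\
  (forall s, 0 < s < T -> side (psf Z (phi s))).

Definition Xarc (Z : PSVF) (p q : pt) T phi :=
  first_return_arc Z (psX Z) (fun v => v > 0) p q T phi.
Definition Yarc (Z : PSVF) (p q : pt) T phi :=
  first_return_arc Z (psY Z) (fun v => v < 0) p q T phi.

Definition infty_homoclinic_loop (Z : PSVF) (g : R -> pt) (p : BinNums.Z -> pt)
  : Prop :=
  global_traj Z g /\
  (forall i j, p i = p j -> i = j) /\
  (forall i, vv_twofold Z (p i)) /\
  (forall i, exists t, g t = p i) /\
  (forall i t, g t = p i ->
     exists t', t' > t /\ (g t' = p (i - 1)%Z \/ g t' = p (i + 1)%Z) /\
       forall s, t < s < t' -> ~ in_Sigma Z (g s)) /\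
  (forall i, exists T phi, Xarc Z (p i) (p (i + 1)%Z) T phi) /\
  (forall i, exists T phi, Yarc Z (p i) (p (i - 1)%Z) T phi).

Definition loop_set (Z : PSVF) (p : BinNums.Z -> pt) (z : pt) : Prop :=
  exists i T phi s, 0 <= s <= T /\ z = phi s /\
    (Xarc Z (p i) (p (i + 1)%Z) T phi \/ Yarc Z (p i) (p (i - 1)%Z) T phi).

Definition orb (W : vfield) (A : pt -> Prop) (a b : pt) : Prop :=
  exists T phi, T >= 0 /\ (forall s, continuous phi s) /\ solves W 0 T phi /\
    phi 0 = a /\ phi T = b /\ forall s, 0 <= s <= T -> A (phi s).

Definition dist (a b : pt) : R :=
  sqrt ((fst a - fst b) ^ 2 + (snd a - snd b) ^ 2).

Definition cont_on (L : pt -> Prop) (h : pt -> pt) : Prop :=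
  forall z, L z -> forall eps, eps > 0 -> exists del, del > 0 /\
    forall w, L w -> dist w z < del -> dist (h w) (h z) < eps.

Definition sigma_equiv (Z : PSVF) (L : pt -> Prop) (Z' : PSVF) (L' : pt -> Prop)
  : Prop :=
  exists (h k : pt -> pt),
    (forall z, L z -> L' (h z)) /\ (forall z, L' z -> L (k z)) /\
    (forall z, L z -> k (h z) = z) /\ (forall z, L' z -> h (k z) = z) /\
    cont_on L h /\ cont_on L' k /\
    (forall z, L z -> (in_Sigma Z z <-> in_Sigma Z' (h z))) /\
    (forall a b, L a -> L b ->
       (orb (psX Z) (fun z => L z /\ in_Sigma_plus Z z) a b <->
        orb (psX Z') (fun z => L' z /\ in_Sigma_plus Z' z) (h a) (h b))) /\
    (forall a b, L a -> L b ->
       (orb (psY Z) (fun z => L z /\ in_Sigma_minus Z z) a b <->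
        orb (psY Z') (fun z => L' z /\ in_Sigma_minus Z' z) (h a) (h b))) /\
    (forall a b, L a -> L b ->
       (orb (slide_field Z) (fun z => L z /\ (sliding Z z \/ escaping Z z)) a b <->
        orb (slide_field Z') (fun z => L' z /\ (sliding Z' z \/ escaping Z' z))
            (h a) (h b))).

Definition Z_inf : PSVF :=
  mkPSVF (fun p => (1, 2 * sin (2 * PI * fst p)))
         (fun p => (-1, 2 * sin (2 * PI * fst p)))
         (fun p => snd p).

Definition P_inf (x : R) : R := (1 - cos (2 * PI * x)) / PI.

Definition Lambda_inf (z : pt) : Prop :=
  exists x, z = (x, P_inf x) \/ z = (x, - P_inf x).

(* Main.v *)
(** The [X]-arcs from [p i] to [p (i+1)] concatenate to one orbit [Phi] of [X], and the [Y]-arcs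
    to one orbit [Psi] of [Y]; uniqueness of solutions makes both injective. Matching parameters
    then gives a bijection with the corresponding two orbits of [Z_inf] that respects [Sigma] and
    the order of points along orbits, while no point of either set is sliding or escaping.
    The issue is the continuity of the inverse: the orbits must not accumulate on themselves.
    As in the Poincare-Bendixson theorem, consider the loop formed by the orbit up to its first
    return to a small transversal and by the chord joining the two crossings. The angle of
    this loop, as seen from a point moving with the orbit, is constant as long as the chord is not
    crossed, but differs by [2 * PI] between the two sides of the chord; so the orbit never gets
    back to the transversal between the two crossings. That the orbit leaves every small
    neighbourhood infinitely often follows from the isolation of nondegenerate folds in [Sigma]. *)

Require Import Defs.
From Stdlib Require Import Reals Lra Lia ZArith Classical ClassicalEpsilon IndefiniteDescription.
From Coquelicot Require Import Coquelicot.
Open Scope R_scope.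

(** * The angle swept by a plane curve *)

(** Continuity of the inverse serves three ends: the equivalence, its inverse, and the comparison of
    time order with parameter order along an arbitrary solution. The angle, an integral depending on
    its viewpoint, takes the place of the Jordan curve theorem. A crude form of the jump suffices: a
    variation below 2 on the orbit arc contradicts one above [PI] on the chord. The transversal is a
    straight segment orthogonal to the field at the base point, and in a small box the field stays
    in a cone around its normal, so no flow box is constructed. To make the concatenated orbit a
    single [C1] curve on the whole line, each arc is reparametrised over a unit interval with the
    folds at the integers; this also gives the loop and the model a common parameter. The price is a
    speed that vanishes at the folds, so strict monotonicity comes from injectivity instead of from
    derivatives. *)

Definition C1 (f df : R -> R) : Prop :=
  forall t, is_derive f t (df t) /\ continuous df t.

Lemma ex_derive_continuity_pt (f : R -> R) t : ex_derive f t -> continuity_pt f t.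
Proof.
  intros H. apply continuity_pt_filterlim.
  apply (ex_derive_continuous (V := R_NormedModule) f t H).
Qed.

Lemma ex_derive_continuous_R (f : R -> R) (t : R) : ex_derive f t -> continuous f t.
Proof. intros H. apply (ex_derive_continuous (V := R_NormedModule) f t H). Qed.

Lemma C1_continuous f df t : C1 f df -> continuous f t.
Proof.
  intros H. apply ex_derive_continuous_R. exists (df t). apply H.
Qed.

Lemma continuity_2d_pt_fst (f : R -> R) x y :
  continuous f x -> continuity_2d_pt (fun u _ => f u) x y.
Proof.
  intros H. apply (continuity_1d_2d_pt_comp f (fun u _ => u)).
  - apply continuity_pt_filterlim. exact H.
  - apply continuity_2d_pt_id1.
Qed.

Lemma continuity_2d_pt_snd (f : R -> R) x y :
  continuous f y -> continuity_2d_pt (fun _ v => f v) x y.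
Proof.
  intros H. apply (continuity_1d_2d_pt_comp f (fun _ v => v)).
  - apply continuity_pt_filterlim. exact H.
  - apply continuity_2d_pt_id2.
Qed.

Lemma continuous_pos (f : R -> R) t :
  continuous f t -> 0 < f t -> exists d : posreal, forall s, Rabs (s - t) < d -> 0 < f s.
Proof.
  intros H Hp.
  assert (Hl : locally (f t) (fun y => 0 < y)).
  { exists (mkposreal _ Hp). intros y Hy. apply Rabs_def2 in Hy. simpl in Hy.
    unfold minus, plus, opp in Hy; simpl in Hy. lra. }
  destruct (H _ Hl) as [d Hd]. exists d. intros s Hs. apply Hd. exact Hs.
Qed.

Lemma sum_sq_pos a b : a <> 0 \/ b <> 0 -> 0 < a ^ 2 + b ^ 2.
Proof. intros [H|H]; nra. Qed.

Section Angle.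

Variables (cx cy dcx dcy : R -> R).

(** Pull-back to the curve of [(x dy - y dx) / (x^2 + y^2)], the differential of the polar angle
    about [(qx, qy)]. *)
Definition angle_integrand (qx qy t : R) : R :=
  ((cx t - qx) * dcy t - (cy t - qy) * dcx t) / ((cx t - qx) ^ 2 + (cy t - qy) ^ 2).

(** The angle swept, as seen from [(qx, qy)], by the curve [(cx, cy)] on [[a, b]]. *)
Definition angle (a b qx qy : R) : R := RInt (angle_integrand qx qy) a b.

Hypotheses (Hcx : C1 cx dcx) (Hcy : C1 cy dcy).

Lemma angle_integrand_continuous qx qy t :
  cx t <> qx \/ cy t <> qy -> continuous (angle_integrand qx qy) t.
Proof.
  intros H. unfold angle_integrand.
  assert (H0 : 0 < (cx t - qx) ^ 2 + (cy t - qy) ^ 2).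
  { apply sum_sq_pos. destruct H; [left|right]; lra. }
  assert (Kx := C1_continuous _ _ t Hcx). assert (Ky := C1_continuous _ _ t Hcy).
  destruct (Hcx t) as [_ Kdx]. destruct (Hcy t) as [_ Kdy].
  apply continuity_pt_filterlim in Kx. apply continuity_pt_filterlim in Ky.
  apply continuity_pt_filterlim in Kdx. apply continuity_pt_filterlim in Kdy.
  apply continuity_pt_filterlim. simpl.
  assert (A : continuity_pt (fun t => cx t - qx) t)
    by (apply (continuity_pt_minus cx (fun _ => qx)); [exact Kx | apply continuity_pt_const; intros u v; reflexivity]).
  assert (B : continuity_pt (fun t => cy t - qy) t)
    by (apply (continuity_pt_minus cy (fun _ => qy)); [exact Ky | apply continuity_pt_const; intros u v; reflexivity]).
  assert (O : continuity_pt (fun _ => 1) t) by (apply continuity_pt_const; intros u v; reflexivity).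
  apply (continuity_pt_div (fun t => (cx t - qx) * dcy t - (cy t - qy) * dcx t)
           (fun t => (cx t - qx) * ((cx t - qx) * 1) + (cy t - qy) * ((cy t - qy) * 1))).
  - apply (continuity_pt_minus (fun t => (cx t - qx) * dcy t) (fun t => (cy t - qy) * dcx t)).
    + apply (continuity_pt_mult (fun t => cx t - qx)); assumption.
    + apply (continuity_pt_mult (fun t => cy t - qy)); assumption.
  - apply (continuity_pt_plus (fun t => (cx t - qx) * ((cx t - qx) * 1)) (fun t => (cy t - qy) * ((cy t - qy) * 1))).
    + apply (continuity_pt_mult (fun t => cx t - qx)); try assumption.
      apply (continuity_pt_mult (fun t => cx t - qx)); assumption.
    + apply (continuity_pt_mult (fun t => cy t - qy)); try assumption.
      apply (continuity_pt_mult (fun t => cy t - qy)); assumption.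
  - simpl in H0. lra.
Qed.

Variables (q1 q2 dq1 dq2 : R -> R).
Hypotheses (Hq1 : C1 q1 dq1) (Hq2 : C1 q2 dq2).

(** On a compact interval the curve has positive distance from the viewpoint, and a viewpoint moved
    by less than that is still avoided. Differentiation under the integral sign asks for this
    uniformity in [t]. *)
Lemma avoid_nearby a b r :
  a <= b -> (forall t, a <= t <= b -> cx t <> q1 r \/ cy t <> q2 r) ->
  exists d : posreal, forall s, Rabs (s - r) < d ->
    forall t, a <= t <= b -> cx t <> q1 s \/ cy t <> q2 s.
Proof.
  intros Hab Hav.
  destruct (continuity_ab_min (fun t => (cx t - q1 r) ^ 2 + (cy t - q2 r) ^ 2) a b Hab)
    as [m [Hm Hmab]].
  { intros t _. apply ex_derive_continuity_pt.
    destruct (Hcx t) as [Dx _]. destruct (Hcy t) as [Dy _].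
    auto_derive. split; [eexists; exact Dx | split; [eexists; exact Dy | exact I]]. }
  set (mu := (cx m - q1 r) ^ 2 + (cy m - q2 r) ^ 2) in *.
  assert (Hmu : 0 < mu).
  { apply sum_sq_pos. destruct (Hav m Hmab); [left|right]; lra. }
  destruct (continuous_pos (fun s => mu - ((q1 s - q1 r) ^ 2 + (q2 s - q2 r) ^ 2)) r) as [d Hd].
  { apply ex_derive_continuous_R.
    destruct (Hq1 r) as [Dx _]. destruct (Hq2 r) as [Dy _].
    auto_derive. split; [eexists; exact Dx | split; [eexists; exact Dy | exact I]]. }
  { simpl. replace (q1 r - q1 r) with 0 by ring. replace (q2 r - q2 r) with 0 by ring. lra. }
  exists d. intros s Hs t Ht. specialize (Hd s Hs). specialize (Hm t Ht). simpl in Hm.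
  destruct (Req_dec (cx t) (q1 s)) as [E1|]; [|left; assumption].
  destruct (Req_dec (cy t) (q2 s)) as [E2|]; [|right; assumption].
  rewrite E1, E2 in Hm. simpl in Hd. lra.
Qed.

(** Rate, as [r] varies, at which the direction of the fixed point [c t] turns when seen from the
    moving point [q r]. *)
Definition angle_rate (r t : R) : R :=
  ((cy t - q2 r) * dq1 r - (cx t - q1 r) * dq2 r) / ((cx t - q1 r) ^ 2 + (cy t - q2 r) ^ 2).

(** The mixed second derivative of the direction of [c t] seen from [q r]. It is reached both from
    [angle_integrand] by differentiating in [r] and from [angle_rate] by differentiating in [t],
    which is why the angle form becomes exact. *)
Let mixed (r t : R) : R :=
  ((dq2 r * dcx t - dq1 r * dcy t) * ((cx t - q1 r) ^ 2 + (cy t - q2 r) ^ 2)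
   + 2 * ((cx t - q1 r) * dcy t - (cy t - q2 r) * dcx t)
       * ((cx t - q1 r) * dq1 r + (cy t - q2 r) * dq2 r))
  * / ((cx t - q1 r) ^ 2 + (cy t - q2 r) ^ 2) * / ((cx t - q1 r) ^ 2 + (cy t - q2 r) ^ 2).

Lemma angle_integrand_derive r t :
  cx t <> q1 r \/ cy t <> q2 r ->
  is_derive (fun s => angle_integrand (q1 s) (q2 s) t) r (mixed r t).
Proof.
  intros H. unfold angle_integrand.
  assert (H0 : 0 < (cx t - q1 r) ^ 2 + (cy t - q2 r) ^ 2).
  { apply sum_sq_pos. destruct H; [left|right]; lra. }
  destruct (Hq1 r) as [D1 _]. destruct (Hq2 r) as [D2 _].
  auto_derive.
  - repeat split; try (eexists; eassumption). simpl in H0. lra.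
  - rewrite (is_derive_unique (fun x : R => q1 x) _ _ D1), (is_derive_unique (fun x : R => q2 x) _ _ D2).
    unfold mixed. field. simpl in H0. lra.
Qed.

Lemma angle_rate_derive r t :
  cx t <> q1 r \/ cy t <> q2 r -> is_derive (angle_rate r) t (mixed r t).
Proof.
  intros H. unfold angle_rate.
  assert (H0 : 0 < (cx t - q1 r) ^ 2 + (cy t - q2 r) ^ 2).
  { apply sum_sq_pos. destruct H; [left|right]; lra. }
  destruct (Hcx t) as [D1 _]. destruct (Hcy t) as [D2 _].
  auto_derive.
  - repeat split; try (eexists; eassumption). simpl in H0. lra.
  - rewrite (is_derive_unique (fun x : R => cx x) _ _ D1), (is_derive_unique (fun x : R => cy x) _ _ D2).
    unfold mixed. field. simpl in H0. lra.
Qed.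

Lemma mixed_continuous r t :
  cx t <> q1 r \/ cy t <> q2 r -> continuity_2d_pt mixed r t.
Proof.
  intros H. unfold mixed.
  assert (H0 : 0 < (cx t - q1 r) ^ 2 + (cy t - q2 r) ^ 2).
  { apply sum_sq_pos. destruct H; [left|right]; lra. }
  assert (Kx := continuity_2d_pt_snd cx r t (C1_continuous _ _ t Hcx)).
  assert (Ky := continuity_2d_pt_snd cy r t (C1_continuous _ _ t Hcy)).
  assert (Kdx := continuity_2d_pt_snd dcx r t (proj2 (Hcx t))).
  assert (Kdy := continuity_2d_pt_snd dcy r t (proj2 (Hcy t))).
  assert (K1 := continuity_2d_pt_fst q1 r t (C1_continuous _ _ r Hq1)).
  assert (K2 := continuity_2d_pt_fst q2 r t (C1_continuous _ _ r Hq2)).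
  assert (Kd1 := continuity_2d_pt_fst dq1 r t (proj2 (Hq1 r))).
  assert (Kd2 := continuity_2d_pt_fst dq2 r t (proj2 (Hq2 r))).
  assert (Ko := continuity_2d_pt_const r t 1).
  assert (Kt := continuity_2d_pt_const r t 2).
  assert (A := continuity_2d_pt_minus _ _ _ _ Kx K1).
  assert (B := continuity_2d_pt_minus _ _ _ _ Ky K2).
  assert (A2 : continuity_2d_pt (fun u v => (cx v - q1 u) ^ 2) r t)
    by exact (continuity_2d_pt_mult _ _ _ _ A (continuity_2d_pt_mult _ _ _ _ A Ko)).
  assert (B2 : continuity_2d_pt (fun u v => (cy v - q2 u) ^ 2) r t)
    by exact (continuity_2d_pt_mult _ _ _ _ B (continuity_2d_pt_mult _ _ _ _ B Ko)).
  assert (D := continuity_2d_pt_plus _ _ _ _ A2 B2).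
  assert (Di : continuity_2d_pt (fun u v => / ((cx v - q1 u) ^ 2 + (cy v - q2 u) ^ 2)) r t).
  { apply continuity_2d_pt_inv; [exact D | lra]. }
  apply continuity_2d_pt_mult; [apply continuity_2d_pt_mult|]; try exact Di.
  apply continuity_2d_pt_plus.
  - apply continuity_2d_pt_mult; [|exact D].
    apply continuity_2d_pt_minus; apply continuity_2d_pt_mult; assumption.
  - apply continuity_2d_pt_mult; [apply continuity_2d_pt_mult|].
    + exact Kt.
    + apply continuity_2d_pt_minus; apply continuity_2d_pt_mult; assumption.
    + apply continuity_2d_pt_plus; apply continuity_2d_pt_mult; assumption.
Qed.

Lemma mixed_continuous_1d r t :
  cx t <> q1 r \/ cy t <> q2 r -> continuous (mixed r) t.
Proof.
  intros H. assert (K := mixed_continuous r t H).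
  apply continuity_pt_filterlim. intros eps He.
  destruct (K (mkposreal eps He)) as [d Hd]. exists d. split; [apply cond_pos|].
  intros s [_ Hs]. apply (Hd r s); [rewrite Rminus_diag, Rabs_R0; apply cond_pos | exact Hs].
Qed.

(* Differentiating the angle form in the viewpoint gives an exact form along the curve,
   so only its endpoints contribute. *)
Lemma angle_derive a b r :
  a <= b -> (forall t, a <= t <= b -> cx t <> q1 r \/ cy t <> q2 r) ->
  is_derive (fun s => angle a b (q1 s) (q2 s)) r (angle_rate r b - angle_rate r a).
Proof.
  intros Hab Hav.
  destruct (avoid_nearby a b r Hab Hav) as [d Hd].
  assert (Hm : Rmin a b = a) by (apply Rmin_left; exact Hab).
  assert (HM : Rmax a b = b) by (apply Rmax_right; exact Hab).
  replace (angle_rate r b - angle_rate r a)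
    with (RInt (fun t => Derive (fun s => angle_integrand (q1 s) (q2 s) t) r) a b).
  - unfold angle. apply (is_derive_RInt_param (fun s t => angle_integrand (q1 s) (q2 s) t)).
    + exists d. intros s Hs t Ht. rewrite Hm, HM in Ht.
      eexists. apply angle_integrand_derive. apply (Hd s Hs t Ht).
    + intros t Ht. rewrite Hm, HM in Ht.
      apply (continuity_2d_pt_ext_loc mixed); [|apply mixed_continuous, Hav, Ht].
      (* The derivative equals [mixed] only where curve and viewpoint differ, so they must be kept
         apart in a neighbourhood in both variables. *)
      assert (K : continuity_2d_pt (fun u v => (cx v - q1 u) ^ 2 + (cy v - q2 u) ^ 2) r t).
      { assert (Kx := continuity_2d_pt_snd cx r t (C1_continuous _ _ t Hcx)).
        assert (Ky := continuity_2d_pt_snd cy r t (C1_continuous _ _ t Hcy)).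
        assert (K1 := continuity_2d_pt_fst q1 r t (C1_continuous _ _ r Hq1)).
        assert (K2 := continuity_2d_pt_fst q2 r t (C1_continuous _ _ r Hq2)).
        assert (Ko := continuity_2d_pt_const r t 1).
        assert (A := continuity_2d_pt_minus _ _ _ _ Kx K1).
        assert (B := continuity_2d_pt_minus _ _ _ _ Ky K2).
        exact (continuity_2d_pt_plus _ _ _ _
          (continuity_2d_pt_mult _ _ _ _ A (continuity_2d_pt_mult _ _ _ _ A Ko))
          (continuity_2d_pt_mult _ _ _ _ B (continuity_2d_pt_mult _ _ _ _ B Ko))). }
      destruct (continuity_2d_pt_neq_0 _ _ _ K) as [e He].
      { assert (0 < (cx t - q1 r) ^ 2 + (cy t - q2 r) ^ 2); [|lra].
        apply sum_sq_pos. destruct (Hav t Ht); [left|right]; lra. }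
      exists e. intros u v Hu Hv. symmetry. apply is_derive_unique, angle_integrand_derive.
      specialize (He u v Hu Hv).
      destruct (Req_dec (cx v) (q1 u)) as [E1|]; [|left; assumption].
      destruct (Req_dec (cy v) (q2 u)) as [E2|]; [|right; assumption].
      exfalso. apply He. rewrite E1, E2. ring.
    + exists d. intros s Hs. apply (ex_RInt_continuous (V := R_CompleteNormedModule)).
      intros t Ht. rewrite Hm, HM in Ht. apply angle_integrand_continuous. apply (Hd s Hs t Ht).
  - apply is_RInt_unique.
    apply (is_RInt_ext (mixed r)).
    { intros t Ht. rewrite Hm, HM in Ht. symmetry. apply is_derive_unique, angle_integrand_derive.
      apply Hav. lra. }
    apply (is_RInt_derive (V := R_CompleteNormedModule) (angle_rate r) (mixed r)).
    + intros t Ht. rewrite Hm, HM in Ht. apply angle_rate_derive, Hav, Ht.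
    + intros t Ht. rewrite Hm, HM in Ht. apply mixed_continuous_1d, Hav, Ht.
Qed.

End Angle.

(** * Non-recurrence of plane orbits *)

Lemma continuous_eps (f : R -> R) t eps :
  continuous f t -> 0 < eps ->
  exists d, 0 < d /\ forall s, Rabs (s - t) < d -> Rabs (f s - f t) < eps.
Proof.
  intros H He.
  assert (Hl : locally (f t) (fun y => Rabs (y - f t) < eps)).
  { exists (mkposreal _ He). intros y Hy. exact Hy. }
  destruct (H _ Hl) as [d Hd]. exists d. split; [apply cond_pos|].
  intros s Hs. apply Hd. exact Hs.
Qed.

Lemma first_nonpos (d : R -> R) a b :
  (forall t, continuous d t) -> a <= b -> 0 < d a -> d b <= 0 ->
  exists c, a < c <= b /\ d c <= 0 /\ forall t, a <= t < c -> 0 < d t.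
Proof.
  intros Hc Hab Ha Hb.
  destruct (completeness (fun t => a <= t <= b /\ forall s, a <= s <= t -> 0 < d s)) as [m [Hm1 Hm2]].
  { exists b. intros t [Ht _]. lra. }
  { exists a. split; [lra|]. intros s Hs. replace s with a by lra. exact Ha. }
  assert (Ham : a <= m).
  { apply Hm1. split; [lra|]. intros s Hs. replace s with a by lra. exact Ha. }
  assert (Hmb : m <= b) by (apply Hm2; intros t [Ht _]; lra).
  assert (Hlt : forall t, a <= t < m -> 0 < d t).
  { intros t Ht. destruct (Rlt_le_dec 0 (d t)) as [|Hn]; [assumption|].
    exfalso. assert (m <= t); [|lra]. apply Hm2. intros u [Hu Hu'].
    destruct (Rle_dec u t); [assumption|]. specialize (Hu' t). lra. }
  destruct (Rlt_le_dec 0 (d m)) as [Hp|Hn].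
  - exfalso. destruct (continuous_pos d m (Hc m) Hp) as [e He].
    assert (Hmb' : m < b) by (destruct (Req_dec m b); [subst; lra | lra]).
    assert (Hep := cond_pos e).
    set (u := Rmin b (m + e / 2)).
    assert (Hu : m < u <= b /\ u <= m + e / 2).
    { unfold u, Rmin. destruct (Rle_dec b (m + e / 2)); lra. }
    assert (u <= m); [|lra]. apply Hm1. split; [lra|].
    intros s Hs. destruct (Rlt_le_dec s m); [apply Hlt; lra|].
    apply He. rewrite Rabs_pos_eq; lra.
  - exists m. split; [|split; assumption]. split; [|assumption].
    destruct (Req_dec m a); [subst; lra | lra].
Qed.

(** A continuous function that is zero on the vertical segment from [(0, lo)] to [(0, hi)] and
    positive elsewhere; it turns the first hit of a chord into the first zero of a scalar
    function. *)
Definition seg_gap (lo hi x y : R) : R := Rabs x + (Rabs (y - lo) + Rabs (y - hi) - (hi - lo)).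

Lemma seg_gap_nonpos lo hi x y : lo <= hi -> seg_gap lo hi x y <= 0 -> x = 0 /\ lo <= y <= hi.
Proof. unfold seg_gap, Rabs. intros H. destruct (Rcase_abs x), (Rcase_abs (y - lo)), (Rcase_abs (y - hi)); lra. Qed.

Lemma seg_gap_zero lo hi y : lo <= y <= hi -> seg_gap lo hi 0 y = 0.
Proof. unfold seg_gap, Rabs. intros H. destruct (Rcase_abs 0), (Rcase_abs (y - lo)), (Rcase_abs (y - hi)); lra. Qed.

Lemma seg_gap_pos lo hi x y : lo <= hi -> ~ (x = 0 /\ lo <= y <= hi) -> 0 < seg_gap lo hi x y.
Proof.
  intros H Hn. destruct (Rlt_le_dec 0 (seg_gap lo hi x y)) as [|Hl]; [assumption|].
  exfalso. apply Hn, (seg_gap_nonpos lo hi x y H Hl).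
Qed.

Lemma seg_gap_small lo hi x y e :
  lo <= hi -> 0 <= e -> Rabs x <= e -> lo - e <= y <= hi + e -> seg_gap lo hi x y <= 3 * e.
Proof. unfold seg_gap, Rabs. intros H He Hx Hy. destruct (Rcase_abs x), (Rcase_abs (y - lo)), (Rcase_abs (y - hi)); lra. Qed.

Lemma seg_gap_continuous lo hi (x y : R -> R) t :
  continuous x t -> continuous y t -> continuous (fun s => seg_gap lo hi (x s) (y s)) t.
Proof.
  intros Hx Hy. unfold seg_gap.
  assert (K : forall c, continuous (fun s => Rabs (y s - c)) t).
  { intros c. apply (continuous_comp (fun s => y s - c) Rabs); [|apply continuous_Rabs].
    apply (continuous_minus (V := R_NormedModule) y (fun _ => c)); [exact Hy | apply continuous_const]. }
  apply (continuous_plus (V := R_NormedModule) (fun s => Rabs (x s))).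
  - apply (continuous_comp x Rabs); [exact Hx | apply continuous_Rabs].
  - apply (continuous_minus (V := R_NormedModule) (fun s => Rabs (y s - lo) + Rabs (y s - hi)) (fun _ => hi - lo)).
    + apply (continuous_plus (V := R_NormedModule) (fun s => Rabs (y s - lo))); apply K.
    + apply continuous_const.
Qed.

(** * The angle of a first-return loop closed by a vertical chord *)

Section Curve.

Variables (x y dx dy : R -> R) (rho : R).
Hypotheses (Hx : C1 x dx) (Hy : C1 y dy).
Hypothesis (Hinj : forall s t, x s = x t -> y s = y t -> s = t).
Hypothesis (Hbox : forall t, Rabs (x t) < rho -> Rabs (y t) < rho -> Rabs (dy t) <= dx t).

(** For [-1 <= c <= 1] the function [x + c * y] has nonnegative derivative in the box, and [c = 1],
    [c = -1] give the cone. As [dx] may vanish, strictness comes from injectivity: [x a = x b] would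
    force [y a = y b]. *)
Lemma box_cone a b :
  a < b -> (forall t, a <= t <= b -> Rabs (x t) < rho /\ Rabs (y t) < rho) ->
  Rabs (y b - y a) <= x b - x a /\ x a < x b.
Proof.
  intros Hab Hin.
  assert (E : forall c, -1 <= c <= 1 -> 0 <= (x b - x a) + c * (y b - y a)).
  { intros c Hc.
    destruct (MVT_gen (fun t => x t + c * y t) a b (fun t => dx t + c * dy t)) as [u [Hu Eu]].
    - intros t _. apply (is_derive_plus (V := R_NormedModule) x (fun t => c * y t)); [apply Hx|].
      apply is_derive_scal. apply Hy.
    - intros t _. apply ex_derive_continuity_pt. eexists.
      apply (is_derive_plus (V := R_NormedModule) x (fun t => c * y t)); [apply Hx|].
      apply is_derive_scal. apply Hy.
    - rewrite Rmin_left, Rmax_right in Hu by lra.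
      destruct (Hin u Hu) as [H1 H2]. specialize (Hbox u H1 H2).
      apply Rabs_le_between in Hbox.
      assert (0 <= dx u + c * dy u) by nra. nra. }
  assert (E1 := E 1). assert (E2 := E (-1)).
  assert (A : Rabs (y b - y a) <= x b - x a) by (apply Rabs_le; lra).
  split; [exact A|].
  destruct (Rlt_le_dec (x a) (x b)) as [|Hn]; [assumption|].
  exfalso. assert (a = b); [|lra]. apply Hinj; lra.
Qed.

Lemma box_nearby t0 :
  Rabs (x t0) < rho -> Rabs (y t0) < rho ->
  exists e, 0 < e /\ forall t, Rabs (t - t0) <= e -> Rabs (x t) < rho /\ Rabs (y t) < rho.
Proof.
  intros H1 H2.
  destruct (continuous_eps x t0 (rho - Rabs (x t0)) (C1_continuous _ _ _ Hx)) as [d1 [P1 K1]]; [lra|].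
  destruct (continuous_eps y t0 (rho - Rabs (y t0)) (C1_continuous _ _ _ Hy)) as [d2 [P2 K2]]; [lra|].
  exists (Rmin d1 d2 / 2). assert (0 < Rmin d1 d2) by (apply Rmin_pos; assumption).
  assert (Rmin d1 d2 <= d1) by apply Rmin_l. assert (Rmin d1 d2 <= d2) by apply Rmin_r.
  split; [lra|]. intros t Ht. specialize (K1 t). specialize (K2 t).
  split.
  - replace (x t) with ((x t - x t0) + x t0) by ring.
    eapply Rle_lt_trans; [apply Rabs_triang|]. lra.
  - replace (y t) with ((y t - y t0) + y t0) by ring.
    eapply Rle_lt_trans; [apply Rabs_triang|]. lra.
Qed.

Lemma local_cone t0 :
  Rabs (x t0) < rho -> Rabs (y t0) < rho ->
  exists e, 0 < e /\ forall s t, Rabs (s - t0) <= e -> Rabs (t - t0) <= e -> s < t ->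
    Rabs (y t - y s) <= x t - x s /\ x s < x t.
Proof.
  intros H1 H2. destruct (box_nearby t0 H1 H2) as [e [He K]].
  exists e. split; [exact He|]. intros s t Hs Ht Hst.
  apply box_cone; [exact Hst|]. intros u Hu. apply K.
  apply Rabs_le_between in Hs. apply Rabs_le_between in Ht. apply Rabs_le. lra.
Qed.

Variables (s0 r1 : R).
Hypotheses (Hx0 : x s0 = 0) (Hy0 : y s0 = 0) (Hr1 : s0 < r1) (Hx1 : x r1 = 0)
  (Hy1 : 0 < y r1 < rho)
  (Hfirst : forall t, s0 < t < r1 -> ~ (x t = 0 /\ - y r1 <= y t <= y r1)).

(** The chord is run from [(0, y r1)] down to the origin, so that it closes the arc from [s0] to
    [r1] into a loop. *)
Let loop_angle (qx qy : R) : R :=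
  angle x y dx dy s0 r1 qx qy
  + angle (fun _ => 0) (fun t => y r1 * (1 - t)) (fun _ => 0) (fun _ => - y r1) 0 1 qx qy.

Let off_loop (qx qy : R) : Prop :=
  (forall t, s0 <= t <= r1 -> x t <> qx \/ y t <> qy) /\ (qx <> 0 \/ ~ 0 <= qy <= y r1).

(** By [angle_derive] the arc and the chord each contribute a difference of endpoint rates. They
    have the same endpoints in opposite order, so the two differences cancel. *)
Lemma loop_angle_constant (q1 q2 dq1 dq2 : R -> R) a b :
  C1 q1 dq1 -> C1 q2 dq2 -> a <= b -> (forall r, a <= r <= b -> off_loop (q1 r) (q2 r)) ->
  loop_angle (q1 a) (q2 a) = loop_angle (q1 b) (q2 b).
Proof.
  intros H1 H2 Hab Hoff.
  assert (D : forall r, a <= r <= b -> is_derive (fun r => loop_angle (q1 r) (q2 r)) r 0).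
  { intros r Hr. destruct (Hoff r Hr) as [A B].
    assert (Da := angle_derive x y dx dy Hx Hy q1 q2 dq1 dq2 H1 H2 s0 r1 r (Rlt_le _ _ Hr1) A).
    assert (Cc : C1 (fun _ => 0) (fun _ => 0)).
    { intros t. split; [apply (is_derive_const (V := R_NormedModule)) | apply continuous_const]. }
    assert (Cs : C1 (fun t => y r1 * (1 - t)) (fun _ => - y r1)).
    { intros t. split; [auto_derive; [exact I|ring] | apply continuous_const]. }
    assert (Db : is_derive (fun s => angle (fun _ => 0) (fun t => y r1 * (1 - t)) (fun _ => 0) (fun _ => - y r1) 0 1 (q1 s) (q2 s)) r
      (angle_rate (fun _ => 0) (fun t => y r1 * (1 - t)) q1 q2 dq1 dq2 r 1
       - angle_rate (fun _ => 0) (fun t => y r1 * (1 - t)) q1 q2 dq1 dq2 r 0)).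
    { apply (angle_derive _ _ _ _ Cc Cs q1 q2 dq1 dq2 H1 H2); [lra|].
      intros t Ht. destruct B as [B|B]; [left; lra | right; intros E; apply B; rewrite <- E; nra]. }
    assert (DD := is_derive_plus (V := R_NormedModule) _ _ _ _ _ Da Db).
    unfold loop_angle. evar_last; [exact DD|].
    unfold plus; simpl. unfold angle_rate. rewrite Hx0, Hy0, Hx1.
    replace (y r1 * (1 - 1)) with 0 by ring. replace (y r1 * (1 - 0)) with (y r1) by ring. ring. }
  destruct (MVT_gen (fun r => loop_angle (q1 r) (q2 r)) a b (fun _ => 0)) as [c [_ E]].
  - intros r Hr. rewrite Rmin_left, Rmax_right in Hr by lra. apply D. lra.
  - intros r Hr. rewrite Rmin_left, Rmax_right in Hr by lra.
    apply ex_derive_continuity_pt. eexists. apply D. lra.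
  - simpl in E. lra.
Qed.

Lemma loop_angle_line a b a' b' :
  (forall r, 0 <= r <= 1 -> off_loop (a + r * (a' - a)) (b + r * (b' - b))) ->
  loop_angle a b = loop_angle a' b'.
Proof.
  intros H.
  assert (C : forall u v, C1 (fun r => u + r * (v - u)) (fun _ => v - u)).
  { intros u v t. split; [auto_derive; [exact I|ring] | apply continuous_const]. }
  assert (K := loop_angle_constant _ _ _ _ 0 1 (C a a') (C b b') Rle_0_1 H).
  simpl in K. replace (a + 0 * (a' - a)) with a in K by ring.
  replace (b + 0 * (b' - b)) with b in K by ring.
  replace (a + 1 * (a' - a)) with a' in K by ring.
  replace (b + 1 * (b' - b)) with b' in K by ring. exact K.
Qed.

(** From the height of the chord's midpoint an explicit primitive exists. The value tends to [PI] or
    [- PI] as [a] tends to 0 from the right or from the left: this is the jump. *)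
Lemma chord_angle a : a <> 0 ->
  angle (fun _ => 0) (fun t => y r1 * (1 - t)) (fun _ => 0) (fun _ => - y r1) 0 1 a (y r1 / 2)
  = 2 * atan (y r1 / (2 * a)).
Proof.
  intros Ha. unfold angle. apply is_RInt_unique.
  assert (Q : forall t, 0 < a * a + (y r1 * (1 / 2 - t)) * (y r1 * (1 / 2 - t))).
  { intros t. assert (0 < a * a) by nra. assert (K := Rle_0_sqr (y r1 * (1 / 2 - t))). unfold Rsqr in K. lra. }
  assert (P : forall t, (0 - a) ^ 2 + (y r1 * (1 - t) - y r1 / 2) ^ 2 <> 0).
  { intros t. specialize (Q t). replace (y r1 * (1 - t) - y r1 / 2) with (y r1 * (1 / 2 - t)) by field. nra. }
  evar_last.
  - apply (is_RInt_derive (V := R_CompleteNormedModule)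
      (fun t => - atan (y r1 * (1 / 2 - t) / a))
      (angle_integrand (fun _ => 0) (fun t => y r1 * (1 - t)) (fun _ => 0) (fun _ => - y r1) a (y r1 / 2))).
    + intros t _. unfold angle_integrand.
      evar_last.
      * apply (is_derive_opp (V := R_NormedModule)).
        apply (is_derive_comp (V := R_NormedModule) atan (fun t => y r1 * (1 / 2 - t) / a)).
        -- apply is_derive_atan.
        -- auto_derive; [exact I | reflexivity].
      * unfold opp, scal; simpl. unfold mult; simpl. specialize (P t). simpl in P. specialize (Q t).
        unfold Rsqr. match goal with |- @eq _ ?u ?v => change (@eq R u v) end.
        field. repeat split; try assumption; try nra.
    + intros t _. apply angle_integrand_continuous.
      * intros u. split; [apply (is_derive_const (V := R_NormedModule)) | apply continuous_const].
      * intros u. split; [auto_derive; [exact I|ring] | apply continuous_const].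
      * left. lra.
  - unfold minus, plus, opp; simpl.
    replace (y r1 * (1 / 2 - 1) / a) with (- (y r1 / (2 * a))) by (field; exact Ha).
    replace (y r1 * (1 / 2 - 0) / a) with (y r1 / (2 * a)) by (field; exact Ha).
    rewrite atan_opp. ring.
Qed.

(** Near the chord the arc shows up only at its ends, leaving the origin to the right and reaching
    [(0, y r1)] from the left, each time inside a cone; in between it keeps a positive gap by
    compactness and [Hfirst]. So a viewpoint may move freely to the right of the chord above the
    first cone, and to the left of it below the second. The strip extends below the origin because
    the next hit of the transversal may lie there. *)
Lemma thin_box : exists e, 0 < e <= y r1 / 8 /\
  forall t, s0 <= t <= r1 -> Rabs (x t) <= e -> - (y r1 / 2) - e <= y t <= y r1 + e ->
    (0 <= x t /\ Rabs (y t) <= x t) \/ (x t <= 0 /\ Rabs (y t - y r1) <= - x t).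
Proof.
  destruct (local_cone s0) as [e1 [P1 K1]]; [rewrite Hx0, Rabs_R0; lra | rewrite Hy0, Rabs_R0; lra|].
  destruct (local_cone r1) as [e2 [P2 K2]]; [rewrite Hx1, Rabs_R0; lra | rewrite Rabs_pos_eq; lra|].
  set (h := Rmin (Rmin e1 e2) ((r1 - s0) / 3)).
  assert (Hh : 0 < h /\ h <= e1 /\ h <= e2 /\ h <= (r1 - s0) / 3).
  { unfold h, Rmin. destruct (Rle_dec e1 e2); destruct (Rle_dec _ ((r1 - s0) / 3)); lra. }
  destruct Hh as [Hh [Hh1 [Hh2 Hh3]]].
  set (d := fun t => seg_gap (- (y r1 / 2)) (y r1) (x t) (y t)).
  destruct (continuity_ab_min d (s0 + h) (r1 - h)) as [m [Hm Hmi]].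
  { lra. }
  { intros c _. apply continuity_pt_filterlim. apply seg_gap_continuous; eapply C1_continuous; eassumption. }
  assert (Hdm : 0 < d m).
  { apply seg_gap_pos; [lra|]. intros [E1 E2]. apply (Hfirst m); [lra|]. split; [exact E1|lra]. }
  (* [seg_gap_small] bounds the gap by [3 * e], which is then less than the minimum [d m];
     [y r1 / 8] keeps the height [y r1 / 2] clear of both cones. *)
  exists (Rmin (d m / 4) (y r1 / 8)). set (e := Rmin (d m / 4) (y r1 / 8)).
  assert (He : 0 < e /\ e <= d m / 4 /\ e <= y r1 / 8).
  { unfold e, Rmin. destruct (Rle_dec _ _); lra. }
  split; [lra|]. intros t Ht Hxt Hyt.
  destruct (Rle_dec t (s0 + h)) as [Ha|Ha]; [|destruct (Rle_dec (r1 - h) t) as [Hb|Hb]].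
  - left. destruct (Req_dec t s0) as [->|Hn].
    + rewrite Hx0, Hy0, Rabs_R0. lra.
    + destruct (K1 s0 t) as [A B]; [rewrite Rminus_diag, Rabs_R0; lra | rewrite Rabs_pos_eq; lra | lra |].
      rewrite Hx0, Hy0, !Rminus_0_r in A. lra.
  - right. destruct (Req_dec t r1) as [->|Hn].
    + rewrite Hx1, Rminus_diag, Rabs_R0. lra.
    + destruct (K2 t r1) as [A B]; [rewrite Rabs_left; lra | rewrite Rminus_diag, Rabs_R0; lra | lra |].
      rewrite Rabs_minus_sym in A. lra.
  - exfalso. assert (K := seg_gap_small (- (y r1 / 2)) (y r1) (x t) (y t) e).
    specialize (Hm t). fold (d t) in K. lra.
Qed.

(* The angle of the loop is constant along the orbit between [r1] and [r2], yet it jumps by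
   [2 * PI] across the chord that closes the loop. *)
Lemma no_second_return r2 :
  r1 < r2 -> x r2 = 0 -> - (y r1 / 2) <= y r2 <= y r1 ->
  (forall t, r1 < t < r2 -> ~ (x t = 0 /\ - (y r1 / 2) <= y t <= y r1)) -> False.
Proof.
  intros Hr2 Hx2 Hy2 Hnext.
  assert (Hy2' : y r2 < y r1).
  { destruct (Req_dec (y r2) (y r1)) as [E|E]; [|lra]. assert (r2 = r1) by (apply Hinj; lra). lra. }
  destruct thin_box as [e [He Hthin]].
  destruct (local_cone r1) as [e1 [P1 K1]]; [rewrite Hx1, Rabs_R0; lra | rewrite Rabs_pos_eq; lra|].
  destruct (local_cone r2) as [e2 [P2 K2]]; [rewrite Hx2, Rabs_R0; lra | apply Rabs_def1; lra |].
  (* Shortly before [r2] one has [y - x < y r2 + 2 * g < y r1], so the orbit is then below the cone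
     that arrives at [(0, y r1)]. *)
  set (g := Rmin e ((y r1 - y r2) / 4)).
  assert (Hg : 0 < g /\ g <= e /\ g <= (y r1 - y r2) / 4).
  { unfold g, Rmin. destruct (Rle_dec _ _); lra. }
  destruct (continuous_eps x r1 g (C1_continuous _ _ _ Hx)) as [f1 [Q1 L1]]; [lra|].
  destruct (continuous_eps x r2 g (C1_continuous _ _ _ Hx)) as [f2 [Q2 L2]]; [lra|].
  set (h := Rmin (Rmin (Rmin e1 e2) (Rmin f1 f2)) (r2 - r1) / 3).
  assert (Hh : 0 < h /\ h < e1 /\ h < e2 /\ h < f1 /\ h < f2 /\ h <= (r2 - r1) / 3).
  { unfold h. assert (0 < Rmin (Rmin (Rmin e1 e2) (Rmin f1 f2)) (r2 - r1)) by (repeat apply Rmin_pos; lra).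
    assert (M1 := Rmin_l (Rmin (Rmin e1 e2) (Rmin f1 f2)) (r2 - r1)).
    assert (M2 := Rmin_r (Rmin (Rmin e1 e2) (Rmin f1 f2)) (r2 - r1)).
    assert (M3 := Rmin_l (Rmin e1 e2) (Rmin f1 f2)). assert (M4 := Rmin_r (Rmin e1 e2) (Rmin f1 f2)).
    assert (M5 := Rmin_l e1 e2). assert (M6 := Rmin_r e1 e2).
    assert (M7 := Rmin_l f1 f2). assert (M8 := Rmin_r f1 f2). lra. }
  set (t1 := r1 + h). set (t2 := r2 - h).
  assert (A1 : 0 < x t1 < g /\ Rabs (y t1 - y r1) <= x t1).
  { destruct (K1 r1 t1) as [A B]; [rewrite Rminus_diag, Rabs_R0; lra | unfold t1; rewrite Rabs_pos_eq; lra | unfold t1; lra|].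
    assert (L := L1 t1). rewrite Hx1, Rminus_0_r in *.
    assert (Rabs (x t1) < g) by (apply L; unfold t1; rewrite Rabs_pos_eq; lra).
    rewrite Rabs_pos_eq in H by lra. lra. }
  assert (A2 : 0 < - x t2 < g /\ Rabs (y t2 - y r2) <= - x t2).
  { destruct (K2 t2 r2) as [A B]; [unfold t2; rewrite Rabs_left; lra | rewrite Rminus_diag, Rabs_R0; lra | unfold t2; lra|].
    assert (L := L2 t2). rewrite Hx2, Rminus_0_r in *.
    assert (Rabs (x t2) < g) by (apply L; unfold t2; rewrite Rabs_left; lra).
    rewrite Rabs_left in H by lra. rewrite Rabs_minus_sym in A. lra. }
  (* The viewpoint travels with the orbit from the right side of the chord to its left side:
     injectivity keeps it off the arc and [Hnext] off the chord. *)
  assert (E0 : loop_angle (x t1) (y t1) = loop_angle (x t2) (y t2)).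
  { apply (loop_angle_constant x y dx dy t1 t2 Hx Hy); [unfold t1, t2; lra|].
    intros r Hr. unfold t1, t2 in Hr. split.
    - intros t Ht. destruct (Req_dec (x t) (x r)) as [Ex|]; [|left; assumption].
      destruct (Req_dec (y t) (y r)) as [Ey|]; [|right; assumption].
      assert (t = r) by (apply Hinj; assumption). lra.
    - destruct (Req_dec (x r) 0) as [Ex|]; [|left; assumption]. right. intros Hn.
      apply (Hnext r); [lra|]. split; [exact Ex|lra]. }
  destruct A1 as [A1 B1]. apply Rabs_le_between in B1.
  destruct A2 as [A2 B2]. apply Rabs_le_between in B2.
  (* On either side a straight move brings the viewpoint to the height of the midpoint, at distance
     [a] from the chord. *)
  assert (E1 : forall a, 0 < a <= e -> loop_angle (x t1) (y t1) = loop_angle a (y r1 / 2)).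
  { intros a Ha. apply loop_angle_line. intros r Hr.
    set (qx := x t1 + r * (a - x t1)). set (qy := y t1 + r * (y r1 / 2 - y t1)).
    assert (Hqx : 0 < qx <= e) by (unfold qx; split; nra).
    assert (Hqy : qy <= y r1 + e) by (unfold qy; nra).
    assert (Hqy' : e < qy) by (unfold qy; nra).
    split; [|left; lra].
    intros t Ht. destruct (Req_dec (x t) qx) as [Ex|]; [|left; assumption].
    destruct (Req_dec (y t) qy) as [Ey|]; [|right; assumption]. exfalso.
    destruct (Hthin t Ht) as [[C1 C2]|[C1 C2]]; [rewrite Rabs_pos_eq; lra | lra | apply Rabs_le_between in C2; lra | lra]. }
  assert (E2 : forall a, 0 < a <= e -> loop_angle (x t2) (y t2) = loop_angle (- a) (y r1 / 2)).
  { intros a Ha. apply loop_angle_line. intros r Hr.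
    set (qx := x t2 + r * (- a - x t2)). set (qy := y t2 + r * (y r1 / 2 - y t2)).
    assert (Hqx : 0 < - qx <= e) by (unfold qx; split; nra).
    assert (Hqy : - (y r1 / 2) - e <= qy) by (unfold qy; nra).
    assert (Hqy' : qy - qx < y r1) by (unfold qy, qx; nra).
    split; [|left; lra].
    intros t Ht. destruct (Req_dec (x t) qx) as [Ex|]; [|left; assumption].
    destruct (Req_dec (y t) qy) as [Ey|]; [|right; assumption]. exfalso.
    destruct (Hthin t Ht) as [[C1 C2]|[C1 C2]]; [rewrite Rabs_left; lra | lra | lra | apply Rabs_le_between in C2; lra]. }
  assert (Cc : C1 (fun r => r) (fun _ => 1)).
  { intros t. split; [apply (is_derive_id (K := R_AbsRing)) | apply continuous_const]. }
  assert (Ch : C1 (fun _ => y r1 / 2) (fun _ => 0)).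
  { intros t. split; [apply (is_derive_const (V := R_NormedModule)) | apply continuous_const]. }
  (* The arc misses the midpoint of the chord, so its own angle does not jump there. *)
  assert (Cont : continuous (fun r => angle x y dx dy s0 r1 r (y r1 / 2)) 0).
  { apply ex_derive_continuous_R. eexists.
    apply (angle_derive x y dx dy Hx Hy _ _ _ _ Cc Ch); [lra|].
    intros t Ht. destruct (Req_dec (x t) 0) as [Ex|]; [|left; assumption].
    right. intros Ey. destruct (Req_dec t s0) as [->|]; [lra|].
    destruct (Req_dec t r1) as [->|]; [lra|]. apply (Hfirst t); [lra|]. split; [exact Ex|lra]. }
  destruct (continuous_eps _ _ 1 Cont Rlt_0_1) as [d [Hd Kd]].
  set (a := Rmin e (d / 2)).
  assert (Ha : 0 < a /\ a <= e /\ a <= d / 2) by (unfold a, Rmin; destruct (Rle_dec _ _); lra).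
  assert (F1 := Kd a). assert (F2 := Kd (- a)).
  rewrite Rminus_0_r in F1, F2. rewrite Rabs_pos_eq in F1 by lra. rewrite Rabs_left in F2 by lra.
  assert (G1 := F1 ltac:(lra)). assert (G2 := F2 ltac:(lra)).
  apply Rabs_def2 in G1. apply Rabs_def2 in G2.
  assert (EE : loop_angle a (y r1 / 2) = loop_angle (- a) (y r1 / 2)).
  { rewrite <- E1, <- E2 by lra. exact E0. }
  unfold loop_angle in EE. rewrite !chord_angle in EE by lra.
  replace (y r1 / (2 * - a)) with (- (y r1 / (2 * a))) in EE by (field; lra).
  rewrite atan_opp in EE.
  (* The two arc angles are each within 1 of the value at the midpoint and so differ by less than 2,
     whereas the chord angles differ by [4 * atan (y r1 / (2 * a))]. The argument exceeds 1 since
     [a <= y r1 / 8]. *)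
  assert (Hat : PI / 4 < atan (y r1 / (2 * a))).
  { rewrite <- atan_1. apply atan_increasing. apply (Rmult_lt_reg_r (2 * a)); [lra|]. field_simplify; lra. }
  assert (HPI := PI2_1). unfold PI2 in HPI. lra.
Qed.

End Curve.

(** * Repeated crossings of the transversal *)

Lemma first_zero (d : R -> R) a b :
  (forall t, continuous d t) -> a <= b -> 0 < d a -> d b <= 0 ->
  exists c, a < c <= b /\ d c = 0 /\ forall t, a <= t < c -> 0 < d t.
Proof.
  intros Hc Hab Ha Hb.
  destruct (first_nonpos d a b Hc Hab Ha Hb) as [c [Hc1 [Hc2 Hc3]]].
  exists c. split; [exact Hc1|]. split; [|exact Hc3].
  destruct (Req_dec (d c) 0) as [|Hn]; [assumption|]. exfalso.
  destruct (continuous_eps d c (- d c) (Hc c)) as [e [He K]]; [lra|].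
  set (t := Rmax a (c - e / 2)).
  assert (Ht : a <= t < c /\ c - t < e) by (unfold t, Rmax; destruct (Rle_dec _ _); lra).
  assert (K1 := K t). assert (P := Hc3 t).
  rewrite Rabs_left in K1 by lra. assert (K2 := K1 ltac:(lra)). apply Rabs_def2 in K2. lra.
Qed.

Lemma continuous_Rmin (f g : R -> R) t :
  continuous f t -> continuous g t -> continuous (fun s => Rmin (f s) (g s)) t.
Proof.
  intros Hf Hg.
  apply (continuous_ext (fun s => scal (/ 2) (minus (plus (f s) (g s)) (Rabs (minus (f s) (g s)))))).
  { intros s. unfold scal, minus, plus, opp; simpl. unfold mult; simpl. unfold Rmin, Rabs.
    destruct (Rle_dec _ _); destruct (Rcase_abs _); lra. }
  apply (continuous_scal_r (V := R_NormedModule) (/ 2)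
           (fun s => minus (plus (f s) (g s)) (Rabs (minus (f s) (g s))))).
  apply (continuous_minus (V := R_NormedModule) (fun s => plus (f s) (g s)) (fun s => Rabs (minus (f s) (g s)))).
  - apply (continuous_plus (V := R_NormedModule) f g); assumption.
  - apply (continuous_comp (fun s => minus (f s) (g s)) Rabs); [|apply continuous_Rabs].
    apply (continuous_minus (V := R_NormedModule) f g); assumption.
Qed.

Lemma continuous_sub_Rabs (f : R -> R) c t : continuous f t -> continuous (fun s => c - Rabs (f s)) t.
Proof.
  intros Hf. apply (continuous_minus (V := R_NormedModule) (fun _ => c) (fun s => Rabs (f s))).
  - apply continuous_const.
  - apply (continuous_comp f Rabs); [exact Hf | apply continuous_Rabs].
Qed.

Lemma Rmin_zero3 a b c : Rmin a (Rmin b c) = 0 -> 0 <= a /\ 0 <= b /\ 0 <= c /\ (a = 0 \/ b = 0 \/ c = 0).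
Proof. unfold Rmin. destruct (Rle_dec b c); destruct (Rle_dec _ _); lra. Qed.

Lemma Rmin_nonpos3 a b c : b <= 0 \/ c <= 0 -> Rmin a (Rmin b c) <= 0.
Proof. unfold Rmin. destruct (Rle_dec b c); destruct (Rle_dec _ _); lra. Qed.

(** The orbit has to leave the region where [x < 0] and both coordinates are below [e] in absolute
    value. While [x <= 0], the cone bounds the drift of [y] by the gain of [x], which is at most
    [e / 4]; so the exit can only be through [x = 0]. *)
Lemma hit_forward (x y dx dy : R -> R) rho e t u :
  C1 x dx -> C1 y dy ->
  (forall s t, x s = x t -> y s = y t -> s = t) ->
  (forall t, Rabs (x t) < rho -> Rabs (y t) < rho -> Rabs (dy t) <= dx t) ->
  0 < e <= rho / 2 -> x t < 0 -> Rabs (x t) < e / 4 -> Rabs (y t) < e / 4 ->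
  t < u -> rho <= Rabs (x u) \/ rho <= Rabs (y u) ->
  exists c, t < c <= u /\ x c = 0 /\ Rabs (y c) <= e.
Proof.
  intros Hx Hy Hinj Hbox He Hxt Hxe Hye Htu Hout.
  destruct (first_zero (fun s => Rmin (- x s) (Rmin (e - Rabs (x s)) (e - Rabs (y s)))) t u)
    as [c [Hc [E Hpos]]].
  - intros s. assert (Kx := C1_continuous _ _ s Hx). assert (Ky := C1_continuous _ _ s Hy).
    apply (continuous_Rmin (fun s => - x s) (fun s => Rmin (e - Rabs (x s)) (e - Rabs (y s)))).
    + apply (continuous_opp (V := R_NormedModule) x s Kx).
    + apply (continuous_Rmin (fun s => e - Rabs (x s)) (fun s => e - Rabs (y s)));
        apply continuous_sub_Rabs; assumption.
  - lra.
  - repeat apply Rmin_pos; lra.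
  - apply Rmin_nonpos3. lra.
  - exists c. split; [exact Hc|]. apply Rmin_zero3 in E. destruct E as [E1 [E2 [E3 E4]]].
    destruct (box_cone x y dx dy rho Hx Hy Hinj Hbox t c) as [A B]; [lra| |].
    + intros s Hs. destruct (Req_dec s c) as [->|Hn]; [lra|].
      assert (P := Hpos s ltac:(lra)).
      assert (P1 := Rmin_r (- x s) (Rmin (e - Rabs (x s)) (e - Rabs (y s)))).
      assert (P2 := Rmin_l (e - Rabs (x s)) (e - Rabs (y s))).
      assert (P3 := Rmin_r (e - Rabs (x s)) (e - Rabs (y s))). lra.
    + split; [|lra]. rewrite Rabs_left in Hxe by lra.
      assert (Hxc : Rabs (x c) <= e / 4) by (apply Rabs_le; lra).
      assert (Hyc : Rabs (y c) <= e / 2).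
      { replace (y c) with ((y c - y t) + y t) by ring.
        eapply Rle_trans; [apply Rabs_triang|]. lra. }
      destruct E4 as [E4|[E4|E4]]; lra.
Qed.

Lemma C1_opp f df : C1 f df -> C1 (fun t => - f t) (fun t => - df t).
Proof.
  intros H t. destruct (H t) as [A B]. split.
  - apply (is_derive_opp (V := R_NormedModule)), A.
  - apply (continuous_opp (V := R_NormedModule)), B.
Qed.

Lemma C1_rev f df : C1 f df -> C1 (fun t => f (- t)) (fun t => - df (- t)).
Proof.
  intros H t. destruct (H (- t)) as [A B]. split.
  - evar_last.
    + apply (is_derive_comp (V := R_NormedModule) f (fun t => - t)); [exact A|].
      apply (is_derive_opp (V := R_NormedModule) (fun t => t)). apply (is_derive_id (K := R_AbsRing)).
    + unfold scal, opp, one; simpl. unfold mult; simpl. ring.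
  - apply (continuous_opp (V := R_NormedModule) (fun t => df (- t))).
    apply (continuous_comp (fun t => - t) df); [|exact B].
    apply (continuous_opp (V := R_NormedModule) (fun t => t)), continuous_id.
Qed.

Lemma C1_ext f g df dg : (forall t, f t = g t) -> (forall t, df t = dg t) -> C1 f df -> C1 g dg.
Proof.
  intros E1 E2 H t. destruct (H t) as [A B]. split.
  - rewrite <- E2. apply (is_derive_ext f); assumption.
  - apply (continuous_ext df); assumption.
Qed.

Section Recurrence.

Variables (x y dx dy : R -> R) (rho s0 : R).
Hypotheses (Hx : C1 x dx) (Hy : C1 y dy).
Hypothesis (Hinj : forall s t, x s = x t -> y s = y t -> s = t).
Hypothesis (Hbox : forall t, Rabs (x t) < rho -> Rabs (y t) < rho -> Rabs (dy t) <= dx t).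
Hypotheses (Hrho : 0 < rho) (Hx0 : x s0 = 0) (Hy0 : y s0 = 0).

(** Crossings arbitrarily close to the base point would give a next hit [r2], which
    [no_second_return] forbids. The search starts at [r1 + e] because the gap vanishes at [r1]
    itself; up to [r1 + e] the orbit is strictly to the right of the chord. *)
Lemma no_repeated_crossing r1 :
  (forall T e, 0 < e -> exists t, T < t /\ x t = 0 /\ Rabs (y t) <= e) ->
  s0 < r1 -> x r1 = 0 -> 0 < y r1 < rho ->
  (forall t, s0 < t < r1 -> ~ (x t = 0 /\ - y r1 <= y t <= y r1)) -> False.
Proof.
  intros Hcross Hr1 Hx1 Hy1 Hfirst.
  destruct (local_cone x y dx dy rho Hx Hy Hinj Hbox r1) as [e [He K]];
    [rewrite Hx1, Rabs_R0; lra | rewrite Rabs_pos_eq; lra |].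
  destruct (Hcross (r1 + e) (y r1 / 2)) as [t [Ht [Hxt Hyt]]]; [lra|].
  apply Rabs_le_between in Hyt.
  assert (Hpos : forall s, r1 < s <= r1 + e -> 0 < x s).
  { intros s Hs. destruct (K r1 s) as [_ B]; [rewrite Rminus_diag, Rabs_R0; lra | rewrite Rabs_pos_eq; lra | lra | lra]. }
  destruct (first_zero (fun s => seg_gap (- (y r1 / 2)) (y r1) (x s) (y s)) (r1 + e) t) as [r2 [Hr2 [E Hlt]]].
  - intros s. apply seg_gap_continuous; eapply C1_continuous; eassumption.
  - lra.
  - apply seg_gap_pos; [lra|]. intros [E _]. specialize (Hpos (r1 + e)). lra.
  - rewrite Hxt, seg_gap_zero; lra.
  - destruct (seg_gap_nonpos (- (y r1 / 2)) (y r1) (x r2) (y r2)) as [E1 E2]; [lra|lra|].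
    apply (no_second_return x y dx dy rho Hx Hy Hinj Hbox s0 r1 Hx0 Hy0 Hr1 Hx1 Hy1 Hfirst r2);
      [lra | exact E1 | exact E2 |].
    intros s Hs [F1 F2]. destruct (Rle_dec s (r1 + e)) as [Hl|Hl].
    + specialize (Hpos s). lra.
    + specialize (Hlt s). rewrite F1, seg_gap_zero in Hlt; lra.
Qed.

End Recurrence.

(* Poincare-Bendixson: an injective planar orbit does not accumulate on itself. *)
Lemma no_recurrence (x y dx dy : R -> R) (rho s0 : R) :
  C1 x dx -> C1 y dy ->
  (forall s t, x s = x t -> y s = y t -> s = t) ->
  (forall t, Rabs (x t) < rho -> Rabs (y t) < rho -> Rabs (dy t) <= dx t) ->
  0 < rho -> x s0 = 0 -> y s0 = 0 ->
  (forall T, exists u, T < u /\ (rho <= Rabs (x u) \/ rho <= Rabs (y u))) ->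
  exists T e, 0 < e /\ forall t, T < t -> e <= Rabs (x t) \/ e <= Rabs (y t).
Proof.
  intros Hx Hy Hinj Hbox Hrho Hx0 Hy0 Hout.
  apply NNPP. intros Hn.
  assert (Hacc : forall T e, 0 < e -> exists t, T < t /\ Rabs (x t) < e /\ Rabs (y t) < e).
  { intros T e He. apply NNPP. intros Hn'. apply Hn. exists T, e. split; [exact He|].
    intros t Ht. destruct (Rle_lt_dec e (Rabs (x t))); [left; assumption|].
    destruct (Rle_lt_dec e (Rabs (y t))); [right; assumption|].
    exfalso. apply Hn'. exists t. lra. }
  assert (Hcross : forall T e, 0 < e -> exists t, T < t /\ x t = 0 /\ Rabs (y t) <= e).
  { intros T e0 He0. set (e := Rmin e0 (rho / 2)).
    assert (He : 0 < e <= rho / 2 /\ e <= e0) by (unfold e, Rmin; destruct (Rle_dec _ _); lra).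
    destruct (Hout T) as [u1 [Hu1 Ho1]].
    destruct (Hacc u1 (e / 4)) as [t [Ht [Hxt Hyt]]]; [lra|].
    destruct (Hout t) as [u2 [Hu2 Ho2]].
    destruct (Rtotal_order (x t) 0) as [Hs|[Hs|Hs]].
    - destruct (hit_forward x y dx dy rho e t u2) as [c [Hc [E1 E2]]]; try assumption; try lra.
      exists c. split; [lra|]. split; [assumption|lra].
    - exists t. split; [lra|]. split; [assumption|lra].
    (* A point to the right of the transversal is followed backwards. Reversing time together with
       the sign of [x] preserves the cone condition, and the excursion at [u1] is where the backward
       orbit is out of the box. *)
    - destruct (hit_forward (fun s => - x (- s)) (fun s => y (- s)) (fun s => dx (- s)) (fun s => - dy (- s))
                  rho e (- t) (- u1)) as [c [Hc [E1 E2]]]; rewrite ?Ropp_involutive, ?Rabs_Ropp; try assumption; try lra.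
      + apply (C1_ext (fun s => - x (- s)) _ (fun s => - - dx (- s))); try (intros; ring).
        apply (C1_opp (fun s => x (- s)) (fun s => - dx (- s))), C1_rev, Hx.
      + apply C1_rev, Hy.
      + intros s s' F1 F2. assert (- s = - s') by (apply Hinj; lra). lra.
      + intros s F1 F2. rewrite Rabs_Ropp in *. apply Hbox; assumption.
      + exists (- c). split; [lra|]. split; lra. }
  destruct (local_cone x y dx dy rho Hx Hy Hinj Hbox s0) as [e [He K]];
    [rewrite Hx0, Rabs_R0; lra | rewrite Hy0, Rabs_R0; lra |].
  assert (Hpos : forall s, s0 < s <= s0 + e -> 0 < x s).
  { intros s Hs. destruct (K s0 s) as [_ B]; [rewrite Rminus_diag, Rabs_R0; lra | rewrite Rabs_pos_eq; lra | lra | lra]. }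
  destruct (Hcross (s0 + e) (rho / 2)) as [t [Ht [Hxt Hyt]]]; [lra|].
  apply Rabs_le_between in Hyt.
  destruct (first_zero (fun s => seg_gap (- (rho / 2)) (rho / 2) (x s) (y s)) (s0 + e) t) as [r1 [Hr1 [E Hlt]]].
  - intros s. apply seg_gap_continuous; eapply C1_continuous; eassumption.
  - lra.
  - apply seg_gap_pos; [lra|]. intros [E _]. specialize (Hpos (s0 + e)). lra.
  - rewrite Hxt, seg_gap_zero; lra.
  - destruct (seg_gap_nonpos (- (rho / 2)) (rho / 2) (x r1) (y r1)) as [E1 E2]; [lra|lra|].
    assert (Hfirst : forall s, s0 < s < r1 -> ~ (x s = 0 /\ - (rho / 2) <= y s <= rho / 2)).
    { intros s Hs [F1 F2]. destruct (Rle_dec s (s0 + e)) as [Hl|Hl].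
      - specialize (Hpos s). lra.
      - specialize (Hlt s). rewrite F1, seg_gap_zero in Hlt; lra. }
    (* A return below the base point reduces to one above it by reflecting [y]; a return to the base
       point itself contradicts injectivity. *)
    destruct (Rtotal_order (y r1) 0) as [Hs|[Hs|Hs]].
    + apply (no_repeated_crossing x (fun s => - y s) dx (fun s => - dy s) rho s0 Hx (C1_opp _ _ Hy)) with r1;
        rewrite ?Ropp_involutive; try assumption; try lra.
      * intros s s' F1 F2. apply Hinj; lra.
      * intros s. rewrite !Rabs_Ropp. apply Hbox.
      * intros T e' He'. destruct (Hcross T e' He') as [t' [A [B C]]].
        exists t'. rewrite Rabs_Ropp. tauto.
      * intros s Hs' [F1 F2]. apply (Hfirst s Hs'). split; [assumption|lra].
    + assert (r1 = s0) by (apply Hinj; lra). lra.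
    + apply (no_repeated_crossing x y dx dy rho s0 Hx Hy) with r1; try assumption; try lra.
      intros s Hs' [F1 F2]. apply (Hfirst s Hs'). split; [assumption|lra].
Qed.

(** * Plane vector fields *)

Definition near (d : R) (p q : pt) : Prop :=
  Rabs (fst q - fst p) < d /\ Rabs (snd q - snd p) < d.

Lemma pt_eq (p q : pt) : fst p = fst q -> snd p = snd q -> p = q.
Proof. destruct p, q; simpl; intros; subst; reflexivity. Qed.

Lemma near_le d e p q : d <= e -> near d p q -> near e p q.
Proof. intros H [A B]. split; lra. Qed.

Lemma continuous_plane (g : pt -> R) p eps :
  continuous g p -> 0 < eps ->
  exists d, 0 < d /\ forall q, near d p q -> Rabs (g q - g p) < eps.
Proof.
  intros H He.
  assert (Hl : locally (g p) (fun y => Rabs (y - g p) < eps)).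
  { exists (mkposreal _ He). intros y Hy. exact Hy. }
  destruct (H _ Hl) as [d Hd]. exists d. split; [apply cond_pos|].
  intros q [H1 H2]. apply Hd. split; assumption.
Qed.

Lemma continuous_pair (phi : R -> pt) t :
  continuous (fun s => fst (phi s)) t -> continuous (fun s => snd (phi s)) t -> continuous phi t.
Proof.
  intros H1 H2.
  apply (continuous_ext (fun s => (fst (phi s), snd (phi s)))).
  { intros s. destruct (phi s); reflexivity. }
  apply (continuous_comp_2 (fun s => fst (phi s)) (fun s => snd (phi s)) (fun a b => (a, b)) t H1 H2).
  apply (continuous_ext (fun z : R * R => z)); [intros [a b]; reflexivity | apply continuous_id].
Qed.

Lemma continuous_fst_comp (phi : R -> pt) t : continuous phi t -> continuous (fun s => fst (phi s)) t.
Proof. intros H. apply (continuous_comp phi fst); [exact H|]. destruct (phi t). apply continuous_fst. Qed.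

Lemma continuous_snd_comp (phi : R -> pt) t : continuous phi t -> continuous (fun s => snd (phi s)) t.
Proof. intros H. apply (continuous_comp phi snd); [exact H|]. destruct (phi t). apply continuous_snd. Qed.

Lemma continuous_near (phi : R -> pt) t d :
  continuous phi t -> 0 < d -> exists e, 0 < e /\ forall s, Rabs (s - t) < e -> near d (phi t) (phi s).
Proof.
  intros H Hd.
  destruct (continuous_eps _ _ d (continuous_fst_comp _ _ H) Hd) as [e1 [P1 K1]].
  destruct (continuous_eps _ _ d (continuous_snd_comp _ _ H) Hd) as [e2 [P2 K2]].
  exists (Rmin e1 e2). split; [apply Rmin_pos; assumption|].
  intros s Hs. assert (M1 := Rmin_l e1 e2). assert (M2 := Rmin_r e1 e2).
  split; [apply K1 | apply K2]; lra.
Qed.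

Definition C1_plane (g : pt -> R) : Prop :=
  forall p, ex_derive (fun x => g (x, snd p)) (fst p) /\ ex_derive (fun y => g (fst p, y)) (snd p) /\
    continuous (dx g) p /\ continuous (dy g) p.

Lemma smooth_ipart_C1 w g : smooth_fun g -> C1_plane (ipart w g).
Proof.
  intros H p. destruct (H w p) as [A [B _]].
  destruct (H (cons true w) p) as [_ [_ C]]. destruct (H (cons false w) p) as [_ [_ D]].
  repeat split; assumption.
Qed.

Lemma C1_plane_chain g (q1 q2 : R -> R) r a b :
  C1_plane g -> is_derive q1 r a -> is_derive q2 r b ->
  is_derive (fun s => g (q1 s, q2 s)) r (dx g (q1 r, q2 r) * a + dy g (q1 r, q2 r) * b).
Proof.
  intros H D1 D2.
  apply is_derive_Reals in D1. apply is_derive_Reals in D2. apply is_derive_Reals.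
  apply (derivable_pt_lim_comp_2d (fun u v => g (u, v)) q1 q2); [|assumption|assumption].
  apply filterdiff_differentiable_pt_lim.
  destruct (H (q1 r, q2 r)) as [_ [B [C _]]]. simpl in B.
  apply (is_derive_filterdiff (fun u v => g (u, v)) (q1 r) (q2 r) (fun u v => dx g (u, v))).
  - apply filter_forall. intros [u v]. simpl. apply Derive_correct. apply (H (u, v)).
  - apply Derive_correct. exact B.
  - apply (continuous_ext (dx g)); [intros [u v]; reflexivity | exact C].
Qed.

Lemma C1_plane_continuous g p : C1_plane g -> continuous g p.
Proof.
  intros H. destruct p as [u v].
  destruct (H (u, v)) as [_ [B [C _]]]. simpl in B.
  assert (K := is_derive_filterdiff (fun u v => g (u, v)) u v (fun u v => dx g (u, v))
                 (Derive (fun y => g (u, y)) v)).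
  apply (continuous_ext (fun z : R * R => g (fst z, snd z))); [intros [a b]; reflexivity|].
  apply (filterdiff_continuous (K := R_AbsRing) (fun z : R * R => g (fst z, snd z))).
  eexists. apply K.
  - apply filter_forall. intros [a b]. simpl. apply Derive_correct. apply (H (a, b)).
  - apply Derive_correct. exact B.
  - apply (continuous_ext (dx g)); [intros [a b]; reflexivity | exact C].
Qed.

(** The intermediate point lies on the segment from [p] to [q], and boxes are convex. Boxes centred
    at [p] serve [fold_isolated], boxes with another centre serve [C1_plane_Lipschitz]. *)
Lemma plane_MVT g p q : C1_plane g ->
  exists xi, (forall d, near d p q -> near d p xi) /\
    (forall c d, near d c p -> near d c q -> near d c xi) /\
    g q - g p = dx g xi * (fst q - fst p) + dy g xi * (snd q - snd p).
Proof.
  intros H.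
  assert (D : forall r, is_derive (fun r => g (fst p + r * (fst q - fst p), snd p + r * (snd q - snd p))) r
     (dx g (fst p + r * (fst q - fst p), snd p + r * (snd q - snd p)) * (fst q - fst p)
      + dy g (fst p + r * (fst q - fst p), snd p + r * (snd q - snd p)) * (snd q - snd p))).
  { intros r. apply (C1_plane_chain g (fun r => fst p + r * (fst q - fst p)) (fun r => snd p + r * (snd q - snd p)));
      try assumption; auto_derive; try exact I; ring. }
  destruct (MVT_gen (fun r => g (fst p + r * (fst q - fst p), snd p + r * (snd q - snd p))) 0 1
     (fun r => dx g (fst p + r * (fst q - fst p), snd p + r * (snd q - snd p)) * (fst q - fst p)
      + dy g (fst p + r * (fst q - fst p), snd p + r * (snd q - snd p)) * (snd q - snd p))) as [c [Hc E]].
  - intros r _. apply D.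
  - intros r _. apply ex_derive_continuity_pt. eexists. apply D.
  - rewrite Rmin_left, Rmax_right in Hc by lra.
    assert (Hcone : forall a b z d, Rabs (a - z) < d -> Rabs (b - z) < d -> Rabs (a + c * (b - a) - z) < d).
    { intros a b z d Ha Hb. apply Rabs_def2 in Ha. apply Rabs_def2 in Hb.
      assert (Q : forall u v, 0 < u -> 0 < v -> 0 < (1 - c) * u + c * v).
      { intros u v Hu Hv. destruct (Rle_dec c (1 / 2)); nra. }
      assert (Q1 := Q (d - (a - z)) (d - (b - z))). assert (Q2 := Q (d + (a - z)) (d + (b - z))).
      apply Rabs_def1; lra. }
    exists (fst p + c * (fst q - fst p), snd p + c * (snd q - snd p)).
    split; [|split].
    + intros d [A B]. assert (0 < d) by (eapply Rle_lt_trans; [apply Rabs_pos | exact A]).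
      split; simpl; apply Hcone; try assumption; rewrite Rminus_diag, Rabs_R0; assumption.
    + intros z d [A B] [A' B']. split; simpl; apply Hcone; assumption.
    + simpl in E. replace (fst p + 1 * (fst q - fst p)) with (fst q) in E by ring.
      replace (snd p + 1 * (snd q - snd p)) with (snd q) in E by ring.
      replace (fst p + 0 * (fst q - fst p)) with (fst p) in E by ring.
      replace (snd p + 0 * (snd q - snd p)) with (snd p) in E by ring.
      rewrite <- !surjective_pairing in E. lra.
Qed.

Lemma C1_plane_Lipschitz g p : C1_plane g ->
  exists L d, 0 <= L /\ 0 < d /\ forall a b, near d p a -> near d p b ->
    Rabs (g b - g a) <= L * (Rabs (fst b - fst a) + Rabs (snd b - snd a)).
Proof.
  intros H. destruct (H p) as [_ [_ [C D]]].
  destruct (continuous_plane _ _ 1 C Rlt_0_1) as [d1 [P1 K1]].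
  destruct (continuous_plane _ _ 1 D Rlt_0_1) as [d2 [P2 K2]].
  assert (B0 := Rabs_pos (dx g p)). assert (B1 := Rabs_pos (dy g p)).
  exists (Rabs (dx g p) + Rabs (dy g p) + 1), (Rmin d1 d2).
  split; [lra|]. split; [apply Rmin_pos; assumption|].
  intros a b Ha Hb. destruct (plane_MVT g a b H) as [xi [_ [Hxi E]]].
  assert (Hx := Hxi p _ Ha Hb). rewrite E.
  assert (J1 := K1 xi (near_le _ _ _ _ (Rmin_l _ _) Hx)).
  assert (J2 := K2 xi (near_le _ _ _ _ (Rmin_r _ _) Hx)).
  eapply Rle_trans; [apply Rabs_triang|]. rewrite !Rabs_mult.
  assert (Rabs (dx g xi) <= Rabs (dx g p) + 1).
  { replace (dx g xi) with ((dx g xi - dx g p) + dx g p) by ring.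
    eapply Rle_trans; [apply Rabs_triang|]. lra. }
  assert (Rabs (dy g xi) <= Rabs (dy g p) + 1).
  { replace (dy g xi) with ((dy g xi - dy g p) + dy g p) by ring.
    eapply Rle_trans; [apply Rabs_triang|]. lra. }
  assert (N1 := Rabs_pos (fst b - fst a)). assert (N2 := Rabs_pos (snd b - snd a)). nra.
Qed.

(** * Integral curves, their uniqueness, and the isolation of folds *)

Definition C1_field (W : vfield) : Prop := C1_plane (fun p => fst (W p)) /\ C1_plane (fun p => snd (W p)).

(** Differential counterpart of [solves]. The equation is imposed on the open interval only, because
    at the ends a derivative would depend on the arbitrary continuation of [phi] beyond them. *)
Definition flows (W : vfield) (a b : R) (phi : R -> pt) : Prop :=
  (forall s, continuous phi s) /\
  forall s, a < s < b -> is_derive (fun t => fst (phi t)) s (fst (W (phi s))) /\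
                         is_derive (fun t => snd (phi t)) s (snd (W (phi s))).

Lemma field_along_continuous (W : vfield) (phi : R -> pt) t :
  C1_field W -> continuous phi t ->
  continuous (fun s => fst (W (phi s))) t /\ continuous (fun s => snd (W (phi s))) t.
Proof.
  intros [H1 H2] Hc. split.
  - apply (continuous_comp phi (fun p => fst (W p))); [exact Hc | apply C1_plane_continuous, H1].
  - apply (continuous_comp phi (fun p => snd (W p))); [exact Hc | apply C1_plane_continuous, H2].
Qed.

Lemma primitive_derive (f : R -> R) a s :
  (forall t, continuous f t) -> is_derive (fun t => RInt f a t) s (f s).
Proof.
  intros H. apply (is_derive_RInt (V := R_NormedModule) f (fun t => RInt f a t) a s); [|apply H].
  apply filter_forall. intros t. apply (RInt_correct (V := R_CompleteNormedModule)).
  apply (ex_RInt_continuous (V := R_CompleteNormedModule)). intros; apply H.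
Qed.

Lemma integral_eq_derive (u f : R -> R) a b :
  (forall t, continuous f t) -> (forall s, a <= s <= b -> u s = u a + RInt f a s) ->
  forall s, a < s < b -> is_derive u s (f s).
Proof.
  intros Hf H s Hs.
  apply (is_derive_ext_loc (fun t => u a + RInt f a t)).
  - assert (Hd : 0 < Rmin (s - a) (b - s)) by (apply Rmin_pos; lra).
    exists (mkposreal _ Hd). intros t Ht. symmetry. apply H.
    assert (M1 := Rmin_l (s - a) (b - s)). assert (M2 := Rmin_r (s - a) (b - s)).
    assert (Ht' : Rabs (t - s) < Rmin (s - a) (b - s)) by exact Ht.
    apply Rabs_def2 in Ht'. lra.
  - evar_last.
    + apply (is_derive_plus (V := R_NormedModule) (fun _ => u a) (fun t => RInt f a t)).
      * apply (is_derive_const (V := R_NormedModule)).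
      * apply primitive_derive, Hf.
    + unfold plus, zero; simpl. ring.
Qed.

Lemma derive_integral_eq (u f : R -> R) a b :
  (forall t, continuous f t) -> (forall t, continuous u t) ->
  (forall s, a < s < b -> is_derive u s (f s)) ->
  forall s, a <= s <= b -> u s = u a + RInt f a s.
Proof.
  intros Hf Hu H s Hs.
  destruct (MVT_gen (fun t => u t - RInt f a t) a s (fun _ => 0)) as [c [_ E]].
  - intros t Ht. rewrite Rmin_left, Rmax_right in Ht by lra.
    evar_last.
    + apply (is_derive_minus (V := R_NormedModule) u (fun t => RInt f a t)).
      * apply H. lra.
      * apply primitive_derive, Hf.
    + unfold minus, plus, opp; simpl. ring.
  - intros t _. apply continuity_pt_filterlim.
    apply (continuous_minus (V := R_NormedModule) u (fun t => RInt f a t)); [apply Hu|].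
    apply ex_derive_continuous_R. eexists. apply primitive_derive, Hf.
  - rewrite RInt_point in E. unfold zero in E; simpl in E. lra.
Qed.

Lemma solves_flows W a b phi :
  C1_field W -> (forall s, continuous phi s) -> solves W a b phi -> flows W a b phi.
Proof.
  intros HW Hc [_ H]. split; [exact Hc|]. intros s Hs. split.
  - apply (integral_eq_derive (fun t => fst (phi t)) (fun t => fst (W (phi t))) a b); [|apply H|exact Hs].
    intros t. apply (field_along_continuous W phi t HW (Hc t)).
  - apply (integral_eq_derive (fun t => snd (phi t)) (fun t => snd (W (phi t))) a b); [|apply H|exact Hs].
    intros t. apply (field_along_continuous W phi t HW (Hc t)).
Qed.

Lemma flows_solves W a b phi : C1_field W -> a <= b -> flows W a b phi -> solves W a b phi.
Proof.
  intros HW Hab [Hc H]. split; [exact Hab|]. intros s Hs. split.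
  - apply (derive_integral_eq (fun t => fst (phi t)) (fun t => fst (W (phi t))) a b); try exact Hs.
    + intros t. apply (field_along_continuous W phi t HW (Hc t)).
    + intros t. apply continuous_fst_comp, Hc.
    + apply H.
  - apply (derive_integral_eq (fun t => snd (phi t)) (fun t => snd (W (phi t))) a b); try exact Hs.
    + intros t. apply (field_along_continuous W phi t HW (Hc t)).
    + intros t. apply continuous_snd_comp, Hc.
    + apply H.
Qed.

Lemma flows_shift W a b c phi : flows W a b phi -> flows W (a - c) (b - c) (fun s => phi (s + c)).
Proof.
  intros [Hc H].
  assert (D : forall u : R -> R, forall s l, is_derive u (s + c) l -> is_derive (fun t => u (t + c)) s l).
  { intros u s l Hu. evar_last.
    - apply (is_derive_comp (V := R_NormedModule) u (fun t => t + c)); [exact Hu|].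
      auto_derive; [exact I | reflexivity].
    - unfold scal; simpl. unfold mult; simpl. ring. }
  split.
  - intros s. apply (continuous_comp (fun s => s + c) phi); [|apply Hc].
    apply ex_derive_continuous_R. auto_derive. exact I.
  - intros s Hs. destruct (H (s + c)) as [A B]; [lra|]. split.
    + apply (D (fun t => fst (phi t))), A.
    + apply (D (fun t => snd (phi t))), B.
Qed.

Lemma flows_sub W a b a' b' phi : a <= a' -> b' <= b -> flows W a b phi -> flows W a' b' phi.
Proof. intros Ha Hb [Hc H]. split; [exact Hc|]. intros s Hs. apply H. lra. Qed.

Lemma solves_concat W a b c phi :
  C1_field W -> (forall s, continuous phi s) -> solves W a b phi -> solves W b c phi -> solves W a c phi.
Proof.
  intros HW Hc [Hab H1] [Hbc H2]. split; [lra|]. intros s Hs.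
  assert (Q : forall f : R -> R, (forall t, continuous f t) -> RInt f a s = RInt f a b + RInt f b s).
  { intros f Hf. symmetry. apply (RInt_Chasles (V := R_CompleteNormedModule));
      apply (ex_RInt_continuous (V := R_CompleteNormedModule)); intros; apply Hf. }
  destruct (Rle_dec s b) as [Hsb|Hsb]; [apply H1; lra|].
  destruct (H2 s) as [A B]; [lra|]. destruct (H1 b) as [A' B']; [lra|].
  split.
  - rewrite Q; [lra|]. intros t. apply (field_along_continuous W phi t HW (Hc t)).
  - rewrite Q; [lra|]. intros t. apply (field_along_continuous W phi t HW (Hc t)).
Qed.

(* Gronwall for the squared distance, started at the last time the two solutions agree. *)
Lemma flows_unique W T phi psi :
  C1_field W -> flows W 0 T phi -> flows W 0 T psi -> phi 0 = psi 0 ->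
  forall s, 0 <= s <= T -> phi s = psi s.
Proof.
  intros HW [Hc1 H1] [Hc2 H2] E0 s1 Hs1.
  set (e1 := fun s => fst (phi s) - fst (psi s)). set (e2 := fun s => snd (phi s) - snd (psi s)).
  set (d := fun s => e1 s * e1 s + e2 s * e2 s).
  assert (Ce1 : forall s, continuous e1 s).
  { intros s. apply (continuous_minus (V := R_NormedModule) (fun s => fst (phi s)) (fun s => fst (psi s)));
      apply continuous_fst_comp; auto. }
  assert (Ce2 : forall s, continuous e2 s).
  { intros s. apply (continuous_minus (V := R_NormedModule) (fun s => snd (phi s)) (fun s => snd (psi s)));
      apply continuous_snd_comp; auto. }
  assert (Cd : forall s, continuous d s).
  { intros s. apply (continuous_plus (V := R_NormedModule) (fun s => e1 s * e1 s) (fun s => e2 s * e2 s)).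
    - apply (continuous_mult (K := R_AbsRing) e1 e1); apply Ce1.
    - apply (continuous_mult (K := R_AbsRing) e2 e2); apply Ce2. }
  destruct (Rlt_le_dec 0 (d s1)) as [Hp|Hn].
  2: { unfold d in Hn. assert (e1 s1 = 0) by nra. assert (e2 s1 = 0) by nra.
       unfold e1, e2 in *. apply pt_eq; lra. }
  exfalso.
  (* Time runs backwards from [s1], so the first zero found is the last agreement [c] before
     [s1]. *)
  destruct (first_zero (fun t => d (s1 - t)) 0 s1) as [t0 [Ht0 [Ez Hpos]]].
  { intros t. apply (continuous_comp (fun t => s1 - t) d); [|apply Cd].
    apply ex_derive_continuous_R. auto_derive. exact I. }
  { lra. }
  { rewrite Rminus_0_r. exact Hp. }
  { rewrite Rminus_diag. unfold d, e1, e2. rewrite E0. nra. }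
  set (c := s1 - t0) in *.
  assert (Hpos' : forall t, c < t <= s1 -> 0 < d t).
  { intros t Ht. specialize (Hpos (s1 - t)). replace (s1 - (s1 - t)) with t in Hpos by ring.
    apply Hpos. unfold c in Ht. lra. }
  assert (Ep : phi c = psi c).
  { unfold d in Ez. assert (e1 c = 0) by nra. assert (e2 c = 0) by nra.
    unfold e1, e2 in *. apply pt_eq; lra. }
  destruct HW as [HW1 HW2].
  destruct (C1_plane_Lipschitz _ (phi c) HW1) as [L1 [d1 [PL1 [Pd1 K1]]]].
  destruct (C1_plane_Lipschitz _ (phi c) HW2) as [L2 [d2 [PL2 [Pd2 K2]]]].
  set (dd := Rmin d1 d2). assert (Hdd : 0 < dd) by (apply Rmin_pos; assumption).
  destruct (continuous_near phi c dd (Hc1 c) Hdd) as [f1 [Pf1 N1]].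
  destruct (continuous_near psi c dd (Hc2 c) Hdd) as [f2 [Pf2 N2]].
  set (h := Rmin (Rmin f1 f2 / 2) (s1 - c)).
  assert (Hc0 : 0 <= c < s1) by (unfold c; lra).
  assert (Hh : 0 < h /\ h < f1 /\ h < f2 /\ c + h <= s1).
  { unfold h. assert (0 < Rmin f1 f2) by (apply Rmin_pos; assumption).
    assert (M1 := Rmin_l f1 f2). assert (M2 := Rmin_r f1 f2).
    assert (M3 := Rmin_l (Rmin f1 f2 / 2) (s1 - c)). assert (M4 := Rmin_r (Rmin f1 f2 / 2) (s1 - c)).
    assert (0 < Rmin (Rmin f1 f2 / 2) (s1 - c)) by (apply Rmin_pos; lra). lra. }
  set (dd' := fun s => 2 * e1 s * (fst (W (phi s)) - fst (W (psi s))) + 2 * e2 s * (snd (W (phi s)) - snd (W (psi s)))).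
  (* One factor 2 comes from differentiating squares, the other from
     [x * (x + y) <= 2 * (x * x + y * y)]. *)
  set (K := 4 * (L1 + L2)).
  assert (Dd : forall s, 0 < s < T -> is_derive d s (dd' s)).
  { intros s Hs. destruct (H1 s Hs) as [A1 A2]. destruct (H2 s Hs) as [B1 B2].
    assert (De1 := is_derive_minus (V := R_NormedModule) _ _ _ _ _ A1 B1).
    assert (De2 := is_derive_minus (V := R_NormedModule) _ _ _ _ _ A2 B2).
    change (is_derive e1 s (fst (W (phi s)) - fst (W (psi s)))) in De1.
    change (is_derive e2 s (snd (W (phi s)) - snd (W (psi s)))) in De2.
    unfold d, dd'. auto_derive.
    - repeat split; eexists; eassumption.
    - rewrite (is_derive_unique (fun x : R => e1 x) _ _ De1), (is_derive_unique (fun x : R => e2 x) _ _ De2). ring. }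
  assert (Bd : forall s, c <= s <= c + h -> dd' s <= K * d s).
  { intros s Hs.
    assert (Hab : Rabs (s - c) < f1 /\ Rabs (s - c) < f2) by (rewrite Rabs_pos_eq; lra).
    assert (M1 := N1 s (proj1 Hab)). assert (M2 := N2 s (proj2 Hab)). rewrite <- Ep in M2.
    assert (Q1 := K1 (psi s) (phi s) (near_le _ _ _ _ (Rmin_l _ _) M2) (near_le _ _ _ _ (Rmin_l _ _) M1)).
    assert (Q2 := K2 (psi s) (phi s) (near_le _ _ _ _ (Rmin_r _ _) M2) (near_le _ _ _ _ (Rmin_r _ _) M1)).
    fold (e1 s) in Q1, Q2. fold (e2 s) in Q1, Q2. unfold dd', d, K.
    set (w1 := fst (W (phi s)) - fst (W (psi s))) in *. set (w2 := snd (W (phi s)) - snd (W (psi s))) in *.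
    assert (S1 : e1 s * w1 <= Rabs (e1 s) * Rabs w1) by (rewrite <- Rabs_mult; apply Rle_abs).
    assert (S2 : e2 s * w2 <= Rabs (e2 s) * Rabs w2) by (rewrite <- Rabs_mult; apply Rle_abs).
    assert (U1 := Rabs_pos (e1 s)). assert (U2 := Rabs_pos (e2 s)).
    assert (V1 : Rabs (e1 s) * Rabs (e1 s) = e1 s * e1 s) by (rewrite <- Rabs_mult; apply Rabs_pos_eq; nra).
    assert (V2 : Rabs (e2 s) * Rabs (e2 s) = e2 s * e2 s) by (rewrite <- Rabs_mult; apply Rabs_pos_eq; nra).
    rewrite <- V1, <- V2.
    set (x := Rabs (e1 s)) in *. set (y := Rabs (e2 s)) in *.
    assert (T1 : x * Rabs w1 <= x * (L1 * (x + y))) by (apply Rmult_le_compat_l; assumption).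
    assert (T2 : y * Rabs w2 <= y * (L2 * (x + y))) by (apply Rmult_le_compat_l; assumption).
    assert (X1 : L1 * (x * (x + y)) <= L1 * (2 * (x * x + y * y))) by (apply Rmult_le_compat_l; nra).
    assert (X2 : L2 * (y * (x + y)) <= L2 * (2 * (x * x + y * y))) by (apply Rmult_le_compat_l; nra).
    lra. }
  (* This product has nonpositive derivative and vanishes at [c], yet it is positive at [c + h]. *)
  destruct (MVT_gen (fun s => d s * exp (- (K * s))) c (c + h) (fun s => (dd' s - K * d s) * exp (- (K * s)))) as [z [Hz E]].
  - intros s Hs. rewrite Rmin_left, Rmax_right in Hs by lra.
    assert (De := Dd s ltac:(lra)). auto_derive.
    + eexists; exact De.
    + rewrite (is_derive_unique (fun x : R => d x) _ _ De). ring.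
  - intros s _. apply continuity_pt_filterlim.
    apply (continuous_mult (K := R_AbsRing) d (fun s => exp (- (K * s)))); [apply Cd|].
    apply ex_derive_continuous_R. auto_derive. exact I.
  - rewrite Rmin_left, Rmax_right in Hz by lra. fold c in Ez. rewrite Ez in E.
    assert (B := Bd z Hz). assert (P := Hpos' (c + h) ltac:(lra)).
    assert (X1 := exp_pos (- (K * (c + h)))). assert (X2 := exp_pos (- (K * z))).
    assert (0 < d (c + h) * exp (- (K * (c + h)))) by (apply Rmult_lt_0_compat; assumption).
    assert (0 <= (K * d z - dd' z) * exp (- (K * z)) * h).
    { apply Rmult_le_pos; [apply Rmult_le_pos|]; lra. }
    lra.
Qed.

(** The vector [w] annihilates the nonzero gradient of [F] but not that of [G], so the two gradients
    are independent and [(F, G)] is locally injective at [p]. The injectivity is obtained directly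
    from the mean value theorem and Cramer's rule. *)
Lemma fold_isolated (F G : pt -> R) (w : pt) p :
  C1_plane F -> C1_plane G -> F p = 0 -> G p = 0 ->
  (dx F p, dy F p) <> (0, 0) ->
  dx F p * fst w + dy F p * snd w = 0 -> dx G p * fst w + dy G p * snd w <> 0 ->
  exists d, 0 < d /\ forall q, near d p q -> F q = 0 -> G q = 0 -> q = p.
Proof.
  intros HF HG EF EG Hreg Htan Hfold.
  set (a := dx F p) in *. set (b := dy F p) in *. set (c := dx G p) in *. set (e := dy G p) in *.
  set (D := a * e - b * c).
  assert (HD : D <> 0).
  { intros E. apply Hfold. unfold D in E.
    assert (Ea : a * (c * fst w + e * snd w) = 0) by (replace (a * (c * fst w + e * snd w)) with (c * (a * fst w + b * snd w) + (a * e - b * c) * snd w) by ring; rewrite Htan, E; ring).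
    assert (Eb : b * (c * fst w + e * snd w) = 0) by (replace (b * (c * fst w + e * snd w)) with (e * (a * fst w + b * snd w) - (a * e - b * c) * fst w) by ring; rewrite Htan, E; ring).
    apply Rmult_integral in Ea. apply Rmult_integral in Eb.
    destruct Ea as [Ea|Ea]; [|exact Ea]. destruct Eb as [Eb|Eb]; [|exact Eb].
    exfalso. apply Hreg. rewrite Ea, Eb. reflexivity. }
  set (M := Rabs a + Rabs b + Rabs c + Rabs e).
  assert (HM : 0 <= M) by (unfold M; assert (A1 := Rabs_pos a); assert (A2 := Rabs_pos b); assert (A3 := Rabs_pos c); assert (A4 := Rabs_pos e); lra).
  assert (HaD : 0 < Rabs D) by (apply Rabs_pos_lt; exact HD).
  (* If the partial derivatives vary by less than [h], Cramer's rule gives [Rabs D * H <= h * M * H]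
     for the displacement [H]; as [h * M < Rabs D], this forces [H = 0]. *)
  set (h := Rabs D / (M + 1)).
  assert (Hh : 0 < h) by (apply Rdiv_lt_0_compat; lra).
  assert (HhM : h * M < Rabs D).
  { replace (Rabs D) with (h * (M + 1)) by (unfold h; field; lra). nra. }
  destruct (HF p) as [_ [_ [CF1 CF2]]]. destruct (HG p) as [_ [_ [CG1 CG2]]].
  destruct (continuous_plane _ _ h CF1 Hh) as [d1 [P1 K1]].
  destruct (continuous_plane _ _ h CF2 Hh) as [d2 [P2 K2]].
  destruct (continuous_plane _ _ h CG1 Hh) as [d3 [P3 K3]].
  destruct (continuous_plane _ _ h CG2 Hh) as [d4 [P4 K4]].
  exists (Rmin (Rmin d1 d2) (Rmin d3 d4)). split; [repeat apply Rmin_pos; assumption|].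
  intros q Hq Fq Gq.
  destruct (plane_MVT F p q HF) as [x1 [N1 [_ E1]]]. destruct (plane_MVT G p q HG) as [x2 [N2 [_ E2]]].
  specialize (N1 _ Hq). specialize (N2 _ Hq).
  assert (J1 := K1 x1 (near_le _ _ _ _ (Rle_trans _ _ _ (Rmin_l _ _) (Rmin_l _ _)) N1)).
  assert (J2 := K2 x1 (near_le _ _ _ _ (Rle_trans _ _ _ (Rmin_l _ _) (Rmin_r _ _)) N1)).
  assert (J3 := K3 x2 (near_le _ _ _ _ (Rle_trans _ _ _ (Rmin_r _ _) (Rmin_l _ _)) N2)).
  assert (J4 := K4 x2 (near_le _ _ _ _ (Rle_trans _ _ _ (Rmin_r _ _) (Rmin_r _ _)) N2)).
  fold a in J1. fold b in J2. fold c in J3. fold e in J4.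
  set (u := fst q - fst p) in *. set (v := snd q - snd p) in *.
  rewrite EF, Fq in E1. rewrite EG, Gq in E2.
  set (H := Rabs u + Rabs v).
  assert (U1 := Rabs_pos u). assert (U2 := Rabs_pos v).
  assert (B1 : Rabs (a * u + b * v) <= h * H).
  { replace (a * u + b * v) with (- ((dx F x1 - a) * u + (dy F x1 - b) * v)) by lra.
    rewrite Rabs_Ropp. eapply Rle_trans; [apply Rabs_triang|]. rewrite !Rabs_mult. unfold H. nra. }
  assert (B2 : Rabs (c * u + e * v) <= h * H).
  { replace (c * u + e * v) with (- ((dx G x2 - c) * u + (dy G x2 - e) * v)) by lra.
    rewrite Rabs_Ropp. eapply Rle_trans; [apply Rabs_triang|]. rewrite !Rabs_mult. unfold H. nra. }
  assert (HH : 0 <= H) by (unfold H; lra).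
  assert (hH : 0 <= h * H) by nra.
  assert (C1 : Rabs D * Rabs u <= (Rabs e + Rabs b) * (h * H)).
  { rewrite <- Rabs_mult. replace (D * u) with (e * (a * u + b * v) + - (b * (c * u + e * v))) by (unfold D; ring).
    eapply Rle_trans; [apply Rabs_triang|]. rewrite Rabs_Ropp, !Rabs_mult.
    assert (A1 := Rabs_pos e); assert (A2 := Rabs_pos b). nra. }
  assert (C2 : Rabs D * Rabs v <= (Rabs a + Rabs c) * (h * H)).
  { rewrite <- Rabs_mult. replace (D * v) with (a * (c * u + e * v) + - (c * (a * u + b * v))) by (unfold D; ring).
    eapply Rle_trans; [apply Rabs_triang|]. rewrite Rabs_Ropp, !Rabs_mult.
    assert (A1 := Rabs_pos a); assert (A2 := Rabs_pos c). nra. }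
  assert (C3 : Rabs D * H <= h * M * H) by (unfold H, M in *; lra).
  assert (H0 : H = 0) by nra.
  unfold H in H0. assert (u = 0) by (destruct (Req_dec u 0) as [|X]; [assumption | apply Rabs_pos_lt in X; lra]).
  assert (v = 0) by (destruct (Req_dec v 0) as [|X]; [assumption | apply Rabs_pos_lt in X; lra]).
  unfold u, v in *. apply pt_eq; lra.
Qed.

(** * Orbits with continuous inverse *)

(** [along] and [across] are coordinates centred at [z] in the frame of [v] and its quarter turn.
    They are not normalised: both carry a factor [|v|]. *)
Definition along (z v p : pt) : R := (fst p - fst z) * fst v + (snd p - snd z) * snd v.
Definition across (z v p : pt) : R := (snd p - snd z) * fst v - (fst p - fst z) * snd v.

Lemma norm_sq_pos (v : pt) : v <> (0, 0) -> 0 < fst v * fst v + snd v * snd v.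
Proof.
  intros H. destruct v as [a b]; simpl.
  destruct (Req_dec a 0) as [->|Ha]; [|nra].
  destruct (Req_dec b 0) as [->|Hb]; [|nra]. exfalso. apply H. reflexivity.
Qed.

Lemma along_across_inj z v p q :
  v <> (0, 0) -> along z v p = along z v q -> across z v p = across z v q -> p = q.
Proof.
  intros Hv E1 E2. apply norm_sq_pos in Hv. unfold along, across in *.
  destruct v as [a b], p as [p1 p2], q as [q1 q2], z as [z1 z2]; simpl in *.
  assert (F1 : (p1 - q1) * (a * a + b * b) = 0) by
    (replace ((p1 - q1) * (a * a + b * b)) with
      (a * (((p1 - z1) * a + (p2 - z2) * b) - ((q1 - z1) * a + (q2 - z2) * b))
       - b * (((p2 - z2) * a - (p1 - z1) * b) - ((q2 - z2) * a - (q1 - z1) * b))) by ring; rewrite E1, E2; ring).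
  assert (F2 : (p2 - q2) * (a * a + b * b) = 0) by
    (replace ((p2 - q2) * (a * a + b * b)) with
      (b * (((p1 - z1) * a + (p2 - z2) * b) - ((q1 - z1) * a + (q2 - z2) * b))
       + a * (((p2 - z2) * a - (p1 - z1) * b) - ((q2 - z2) * a - (q1 - z1) * b))) by ring; rewrite E1, E2; ring).
  apply Rmult_integral in F1. apply Rmult_integral in F2.
  f_equal; lra.
Qed.

Lemma along_across_near z v d :
  v <> (0, 0) -> 0 < d ->
  exists e, 0 < e /\ forall p, Rabs (along z v p) < e -> Rabs (across z v p) < e -> near d z p.
Proof.
  intros Hv Hd. apply norm_sq_pos in Hv. unfold along, across, near.
  destruct v as [a b], z as [z1 z2]; simpl in *.
  set (N := a * a + b * b) in *. set (S := Rabs a + Rabs b).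
  assert (A1 := Rabs_pos a). assert (A2 := Rabs_pos b).
  exists (d * N / (S + 1)).
  assert (He : 0 < d * N / (S + 1)) by (apply Rdiv_lt_0_compat; unfold S; nra).
  split; [exact He|].
  set (e := d * N / (S + 1)) in *.
  assert (Ee : e * (S + 1) = d * N) by (unfold e; field; unfold S; lra).
  intros [p1 p2]; simpl. intros H1 H2.
  set (X := (p1 - z1) * a + (p2 - z2) * b) in *. set (Y := (p2 - z2) * a - (p1 - z1) * b) in *.
  assert (K : forall w, Rabs (w * N) <= Rabs a * e + Rabs b * e -> Rabs w < d).
  { intros w Hw. rewrite Rabs_mult, (Rabs_pos_eq N) in Hw by lra.
    apply (Rmult_lt_reg_r N); [exact Hv|]. unfold S in Ee. nra. }
  assert (B1 := Rabs_pos X). assert (B2 := Rabs_pos Y).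
  split; apply K.
  - replace ((p1 - z1) * N) with (a * X + - (b * Y)) by (unfold X, Y, N; ring).
    eapply Rle_trans; [apply Rabs_triang|]. rewrite Rabs_Ropp, !Rabs_mult. nra.
  - replace ((p2 - z2) * N) with (b * X + a * Y) by (unfold X, Y, N; ring).
    eapply Rle_trans; [apply Rabs_triang|]. rewrite !Rabs_mult. nra.
Qed.

Lemma near_along_across z v e : 0 < e ->
  exists d, 0 < d /\ forall p, near d z p -> Rabs (along z v p) < e /\ Rabs (across z v p) < e.
Proof.
  intros He. unfold along, across, near. destruct v as [a b], z as [z1 z2]; simpl in *.
  set (S := Rabs a + Rabs b).
  assert (A1 := Rabs_pos a). assert (A2 := Rabs_pos b).
  exists (e / (S + 1)).
  assert (Hd : 0 < e / (S + 1)) by (apply Rdiv_lt_0_compat; unfold S; lra).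
  split; [exact Hd|]. set (d := e / (S + 1)) in *.
  assert (Ed : d * (S + 1) = e) by (unfold d; field; unfold S; lra).
  intros [p1 p2]; simpl. intros [H1 H2]. unfold S in Ed.
  assert (B1 := Rabs_pos (p1 - z1)). assert (B2 := Rabs_pos (p2 - z2)).
  split.
  - eapply Rle_lt_trans; [apply Rabs_triang|]. rewrite !Rabs_mult. nra.
  - unfold Rminus at 1. eapply Rle_lt_trans; [apply Rabs_triang|]. rewrite Rabs_Ropp, !Rabs_mult. nra.
Qed.

Lemma field_cone W z : C1_field W -> W z <> (0, 0) ->
  exists d, 0 < d /\ forall p, near d z p ->
    0 < fst (W p) * fst (W z) + snd (W p) * snd (W z) /\
    Rabs (snd (W p) * fst (W z) - fst (W p) * snd (W z)) <= fst (W p) * fst (W z) + snd (W p) * snd (W z).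
Proof.
  intros [H1 H2] Hv. assert (HN := norm_sq_pos _ Hv).
  set (a := fst (W z)) in *. set (b := snd (W z)) in *.
  set (N := a * a + b * b) in *. set (S := Rabs a + Rabs b).
  assert (A1 := Rabs_pos a). assert (A2 := Rabs_pos b).
  (* At [z] the component along the field is [N] and the one across it is 0. Each changes by at most
     [e * S], and [2 * e * S < N] keeps the cone. *)
  set (e := N / (2 * S + 1)).
  assert (He : 0 < e) by (apply Rdiv_lt_0_compat; unfold S; lra).
  assert (Ee : e * (2 * S + 1) = N) by (unfold e; field; unfold S; lra).
  destruct (continuous_plane _ z e (C1_plane_continuous _ z H1) He) as [d1 [P1 K1]].
  destruct (continuous_plane _ z e (C1_plane_continuous _ z H2) He) as [d2 [P2 K2]].
  exists (Rmin d1 d2). split; [apply Rmin_pos; assumption|].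
  intros p Hp. specialize (K1 p (near_le _ _ _ _ (Rmin_l _ _) Hp)). specialize (K2 p (near_le _ _ _ _ (Rmin_r _ _) Hp)).
  fold a in K1. fold b in K2.
  set (u := fst (W p) - a) in *. set (w := snd (W p) - b) in *.
  replace (fst (W p)) with (u + a) by (unfold u; ring). replace (snd (W p)) with (w + b) by (unfold w; ring).
  assert (B1 := Rabs_pos u). assert (B2 := Rabs_pos w).
  assert (Q1 : Rabs (w * a + - (u * b)) <= e * S).
  { eapply Rle_trans; [apply Rabs_triang|]. rewrite Rabs_Ropp, !Rabs_mult. unfold S. nra. }
  assert (Q2 : Rabs (u * a + w * b) <= e * S).
  { eapply Rle_trans; [apply Rabs_triang|]. rewrite !Rabs_mult. unfold S. nra. }
  replace ((w + b) * a - (u + a) * b) with (w * a + - (u * b)) by ring.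
  apply Rabs_le_between in Q2. unfold N in Ee. split; nra.
Qed.

Lemma is_derive_affine_comb (p1 p2 : R -> R) u l1 l2 a b c k :
  is_derive p1 u l1 -> is_derive p2 u l2 ->
  is_derive (fun s => (p1 s - a) * b + (p2 s - c) * k) u (l1 * b + l2 * k).
Proof.
  intros D1 D2. auto_derive.
  - split; [eexists; exact D1 | split; [eexists; exact D2 | exact I]].
  - rewrite (is_derive_unique (fun x : R => p1 x) _ _ D1), (is_derive_unique (fun x : R => p2 x) _ _ D2). ring.
Qed.

Lemma ex_derive_dist_sq (p1 p2 : R -> R) u a b :
  ex_derive p1 u -> ex_derive p2 u -> ex_derive (fun s => (p1 s - a) ^ 2 + (p2 s - b) ^ 2) u.
Proof. intros D1 D2. auto_derive. tauto. Qed.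

(** [Phi] follows [W] with a speed [om] that may vanish, as it does at the joints of the arcs. *)
Definition curve_speed (W : vfield) (Phi : R -> pt) (om : R -> R) : Prop :=
  (forall u, 0 <= om u) /\
  C1 (fun u => fst (Phi u)) (fun u => om u * fst (W (Phi u))) /\
  C1 (fun u => snd (Phi u)) (fun u => om u * snd (W (Phi u))).

(** Continuity of the inverse of [Phi] on its image, without a name for the inverse. *)
Definition inverse_continuous (Phi : R -> pt) : Prop :=
  forall u e, 0 < e -> exists d, 0 < d /\ forall w, near d (Phi u) (Phi w) -> Rabs (w - u) < e.

(** * From non-recurrence to continuity of the inverse *)

Section OrbitCurve.

Variables (W : vfield) (Phi : R -> pt) (om : R -> R).
Hypotheses (HW : C1_field W) (Hsp : curve_speed W Phi om)
  (Hinj : forall u v, Phi u = Phi v -> u = v) (Hnz : forall u, W (Phi u) <> (0, 0)).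

Lemma curve_continuous u : continuous Phi u.
Proof.
  destruct Hsp as [_ [H1 H2]].
  apply continuous_pair; [apply (C1_continuous _ _ u H1) | apply (C1_continuous _ _ u H2)].
Qed.

(** Supplies the hypotheses of [no_recurrence] at [Phi u0]. The last clause converts leaving the
    [d0]-neighbourhood into leaving the box of size [rho]. *)
Lemma adapted_coordinates u0 d0 : 0 < d0 ->
  let z := Phi u0 in let v := W z in
  let x := fun u => along z v (Phi u) in let y := fun u => across z v (Phi u) in
  exists dx dy rho, C1 x dx /\ C1 y dy /\ (forall s t, x s = x t -> y s = y t -> s = t) /\
    (forall t, Rabs (x t) < rho -> Rabs (y t) < rho -> Rabs (dy t) <= dx t) /\
    0 < rho /\ x u0 = 0 /\ y u0 = 0 /\
    (forall t, Rabs (x t) < rho -> Rabs (y t) < rho -> near d0 z (Phi t)).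
Proof.
  intros Hd0 z v x y. destruct Hsp as [Hom [H1 H2]].
  destruct (field_cone W z HW (Hnz u0)) as [d1 [P1 K1]].
  destruct (along_across_near z v (Rmin d0 d1) (Hnz u0)) as [rho [Pr Kr]]; [apply Rmin_pos; assumption|].
  exists (fun u => om u * (fst (W (Phi u)) * fst v + snd (W (Phi u)) * snd v)),
         (fun u => om u * (snd (W (Phi u)) * fst v - fst (W (Phi u)) * snd v)), rho.
  assert (C : forall a b c k, C1 (fun u => (fst (Phi u) - a) * b + (snd (Phi u) - c) * k)
                (fun u => om u * (fst (W (Phi u)) * b + snd (W (Phi u)) * k))).
  { intros a b c k u. destruct (H1 u) as [D1 C1']. destruct (H2 u) as [D2 C2']. split.
    - evar_last; [apply (is_derive_affine_comb _ _ _ _ _ a b c k D1 D2) | ring].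
    - apply (continuous_ext (fun u => plus (scal b (om u * fst (W (Phi u)))) (scal k (om u * snd (W (Phi u)))))).
      + intros w. unfold plus, scal; simpl. unfold mult; simpl. ring.
      + apply (continuous_plus (V := R_NormedModule) (fun u => scal b (om u * fst (W (Phi u)))) (fun u => scal k (om u * snd (W (Phi u))))).
        * apply (continuous_scal_r (V := R_NormedModule) b (fun u => om u * fst (W (Phi u)))), C1'.
        * apply (continuous_scal_r (V := R_NormedModule) k (fun u => om u * snd (W (Phi u)))), C2'. }
  split; [|split; [|split; [|split; [|split; [|split; [|split]]]]]].
  - apply C.
  - eapply C1_ext; [| |apply (C (fst z) (- snd v) (snd z) (fst v))].
    + intros t. unfold y, across. ring.
    + intros t. cbv beta. ring.
  - intros s t E1 E2. apply Hinj. apply (along_across_inj z v); [apply Hnz | exact E1 | exact E2].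
  - intros t Hx Hy. assert (Hn := Kr _ Hx Hy).
    destruct (K1 (Phi t) (near_le _ _ _ _ (Rmin_r _ _) Hn)) as [_ Q]. fold v in Q.
    rewrite Rabs_mult, (Rabs_pos_eq (om t)) by apply Hom.
    apply Rmult_le_compat_l; [apply Hom | exact Q].
  - exact Pr.
  - unfold x, along, z. ring.
  - unfold y, across, z. ring.
  - intros t Hx Hy. apply (near_le (Rmin d0 d1)); [apply Rmin_l | apply Kr; assumption].
Qed.

(** Large parameters of either sign stay away from [Phi u0] by [no_recurrence], applied to the curve
    and to its time reversal. The remaining parameters at distance at least [e] from [u0] form a
    compact set, on which injectivity gives a positive distance. *)
Lemma curve_inverse_continuous :
  (forall u0, exists d, 0 < d /\ (forall T, exists u, T < u /\ ~ near d (Phi u0) (Phi u)) /\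
                                 (forall T, exists u, u < T /\ ~ near d (Phi u0) (Phi u))) ->
  inverse_continuous Phi.
Proof.
  intros Hexit u0 e He. destruct (Hexit u0) as [d0 [Pd0 [Ex1 Ex2]]].
  destruct (adapted_coordinates u0 d0 Pd0) as [dx [dy [rho [Cx [Cy [Ji [Jb [Pr [X0 [Y0 Kn]]]]]]]]]].
  set (z := Phi u0) in *. set (v := W z) in *.
  assert (Hout : forall u, ~ near d0 z (Phi u) -> rho <= Rabs (along z v (Phi u)) \/ rho <= Rabs (across z v (Phi u))).
  { intros u Hu. destruct (Rle_lt_dec rho (Rabs (along z v (Phi u)))); [left; assumption|].
    destruct (Rle_lt_dec rho (Rabs (across z v (Phi u)))); [right; assumption|].
    exfalso. apply Hu. apply Kn; assumption. }
  destruct (no_recurrence _ _ _ _ rho u0 Cx Cy Ji Jb Pr X0 Y0) as [T1 [e1 [P1 K1]]].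
  { intros T. destruct (Ex1 T) as [u [A B]]. exists u. split; [exact A | apply Hout, B]. }
  destruct (no_recurrence (fun t => - along z v (Phi (- t))) (fun t => across z v (Phi (- t)))
              (fun t => dx (- t)) (fun t => - dy (- t)) rho (- u0)) as [T2 [e2 [P2 K2]]].
  { apply (C1_ext (fun t => - along z v (Phi (- t))) _ (fun t => - - dx (- t))); try (intros; ring).
    apply (C1_opp (fun t => along z v (Phi (- t))) (fun t => - dx (- t))).
    apply (C1_rev (fun t => along z v (Phi t))), Cx. }
  { apply (C1_rev (fun t => across z v (Phi t))), Cy. }
  { intros s t E1 E2. assert (- s = - t) by (apply Ji; lra). lra. }
  { intros t A B. rewrite Rabs_Ropp in *. apply Jb; assumption. }
  { exact Pr. }
  { rewrite Ropp_involutive. unfold along, z. ring. }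
  { rewrite Ropp_involutive. unfold across, z. ring. }
  { intros T. destruct (Ex2 (- T)) as [u [A B]]. exists (- u). split; [lra|].
    rewrite Ropp_involutive, Rabs_Ropp. apply Hout, B. }
  destruct (near_along_across z v e1 P1) as [f1 [Q1 L1]].
  destruct (near_along_across z v e2 P2) as [f2 [Q2 L2]].
  (* Beyond [N] both non-recurrence bounds apply, and the interval from [- N] to [N] contains the
     [e]-neighbourhood of [u0]. *)
  set (N := Rabs T1 + Rabs T2 + Rabs u0 + e + 1).
  assert (HT1 : T1 <= N - e - Rabs u0) by (unfold N; assert (G := Rle_abs T1); assert (G2 := Rabs_pos T2); lra).
  assert (HT2 : T2 <= N - e - Rabs u0) by (unfold N; assert (G := Rle_abs T2); assert (G2 := Rabs_pos T1); lra).
  assert (HN : - N + e < u0 < N - e).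
  { unfold N. assert (G := Rle_abs u0). assert (G1 := Rle_abs (- u0)). rewrite Rabs_Ropp in G1.
    assert (G2 := Rabs_pos T1). assert (G3 := Rabs_pos T2). lra. }
  set (g := fun w => (fst (Phi w) - fst z) ^ 2 + (snd (Phi w) - snd z) ^ 2).
  assert (Cg : forall w, continuity_pt g w).
  { intros w. apply ex_derive_continuity_pt. destruct Hsp as [_ [D1 D2]].
    apply (ex_derive_dist_sq (fun w => fst (Phi w)) (fun w => snd (Phi w))); eexists; [apply D1 | apply D2]. }
  assert (Pg : forall w, w <> u0 -> 0 < g w).
  { intros w Hw. apply sum_sq_pos. destruct (Req_dec (fst (Phi w)) (fst z)) as [E1|]; [|left; lra].
    right. intros E2. apply Hw, Hinj, pt_eq; unfold z in *; lra. }
  destruct (continuity_ab_min g (- N) (u0 - e)) as [m1 [M1 R1]]; [lra | intros; apply Cg|].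
  destruct (continuity_ab_min g (u0 + e) N) as [m2 [M2 R2]]; [lra | intros; apply Cg|].
  assert (G1 := Pg m1 ltac:(lra)). assert (G2 := Pg m2 ltac:(lra)).
  set (mu := Rmin (g m1) (g m2)).
  assert (Hmu : 0 < mu /\ mu <= g m1 /\ mu <= g m2).
  { unfold mu. split; [apply Rmin_pos; assumption | split; [apply Rmin_l | apply Rmin_r]]. }
  (* With [d <= 1] the squared distance is below [2 * d^2 <= 2 * d <= mu]. *)
  set (d := Rmin (Rmin f1 f2) (Rmin 1 (mu / 2))).
  assert (Hd : 0 < d /\ d <= f1 /\ d <= f2 /\ d <= 1 /\ d <= mu / 2).
  { unfold d. assert (A1 := Rmin_l (Rmin f1 f2) (Rmin 1 (mu / 2))). assert (A2 := Rmin_r (Rmin f1 f2) (Rmin 1 (mu / 2))).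
    assert (A3 := Rmin_l f1 f2). assert (A4 := Rmin_r f1 f2). assert (A5 := Rmin_l 1 (mu / 2)). assert (A6 := Rmin_r 1 (mu / 2)).
    split; [repeat apply Rmin_pos; lra | lra]. }
  exists d. split; [apply Hd|]. intros w Hw.
  assert (Hgw : g w < mu).
  { destruct Hw as [A B]. apply Rabs_def2 in A. apply Rabs_def2 in B. unfold g. nra. }
  apply Rabs_def1.
  - destruct (Rlt_le_dec (w - u0) e) as [|Hn]; [assumption|]. exfalso.
    destruct (Rle_lt_dec w N) as [Hl|Hl].
    + specialize (M2 w). lra.
    + destruct (L1 (Phi w) (near_le _ _ _ _ (proj1 (proj2 Hd)) Hw)) as [A B].
      assert (0 <= Rabs u0) by apply Rabs_pos. specialize (K1 w). lra.
  - destruct (Rlt_le_dec (- e) (w - u0)) as [|Hn]; [assumption|]. exfalso.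
    destruct (Rle_lt_dec (- N) w) as [Hl|Hl].
    + specialize (M1 w). lra.
    + destruct (L2 (Phi w) (near_le _ _ _ _ (proj1 (proj2 (proj2 Hd))) Hw)) as [A B].
      assert (0 <= Rabs u0) by apply Rabs_pos. specialize (K2 (- w)).
      rewrite Ropp_involutive, Rabs_Ropp in K2. lra.
Qed.

End OrbitCurve.

(** Take the supremum [c] of the times with [m 0 <= m t]. Comparison to the left of [c] puts [c]
    into this set, and comparison to the right carries the set beyond [c] unless [c = T]. *)
Lemma locally_monotone (m : R -> R) T : 0 <= T ->
  (forall s0, 0 <= s0 <= T -> exists e, 0 < e /\ forall s, 0 <= s <= T -> Rabs (s - s0) < e ->
     (s0 <= s -> m s0 <= m s) /\ (s <= s0 -> m s <= m s0)) ->
  m 0 <= m T.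
Proof.
  intros HT H.
  destruct (completeness (fun t => 0 <= t <= T /\ m 0 <= m t)) as [c [Hc1 Hc2]].
  { exists T. intros t [Ht _]. lra. }
  { exists 0. split; lra. }
  assert (Hc : 0 <= c <= T).
  { split; [apply Hc1; split; lra | apply Hc2; intros t [Ht _]; lra]. }
  destruct (H c Hc) as [e [He K]].
  assert (Hmc : m 0 <= m c).
  { destruct (classic (exists t, (0 <= t <= T /\ m 0 <= m t) /\ c - e < t)) as [[t [[Ht1 Ht2] Ht3]]|Hn].
    - assert (t <= c) by (apply Hc1; split; assumption).
      destruct (K t) as [_ B]; [lra | rewrite Rabs_minus_sym, Rabs_pos_eq; lra |]. specialize (B H0). lra.
    - exfalso. assert (c <= c - e); [|lra]. apply Hc2. intros t Ht.
      destruct (Rle_dec t (c - e)); [assumption|]. exfalso. apply Hn. exists t. split; [exact Ht|lra]. }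
  destruct (Req_dec c T) as [->|Hn]; [exact Hmc|]. exfalso.
  set (t := Rmin T (c + e / 2)).
  assert (Ht : c < t <= T /\ t - c < e) by (unfold t, Rmin; destruct (Rle_dec _ _); lra).
  destruct (K t) as [A _]; [lra | rewrite Rabs_pos_eq; lra |].
  assert (t <= c); [|lra]. apply Hc1. split; [lra|]. specialize (A ltac:(lra)). lra.
Qed.

(* The parameter of the moving point is a locally monotone function of time. *)
Lemma orbit_order W Phi om u v :
  C1_field W -> curve_speed W Phi om -> (forall u v, Phi u = Phi v -> u = v) ->
  (forall u, W (Phi u) <> (0, 0)) -> inverse_continuous Phi ->
  orb W (fun z => exists w, z = Phi w) (Phi u) (Phi v) -> u <= v.
Proof.
  intros HW Hsp Hinj Hnz Hinv [T [phi [HT [Hc [Hs [E0 [E1 Hin]]]]]]].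
  (* [m s] is the curve parameter of [phi s], unique by injectivity; outside the time interval the
     value 0 is arbitrary. *)
  destruct (functional_choice (fun s w => 0 <= s <= T -> phi s = Phi w)) as [m Hm].
  { intros s. destruct (classic (0 <= s <= T)) as [Hs'|Hn].
    - destruct (Hin s Hs') as [w Hw]. exists w. intros _. exact Hw.
    - exists 0. intros Hs'. contradiction. }
  assert (Hu : m 0 = u) by (apply Hinj; rewrite <- Hm by lra; exact E0).
  assert (Hv : m T = v) by (apply Hinj; rewrite <- Hm by lra; exact E1).
  rewrite <- Hu, <- Hv.
  destruct (solves_flows W 0 T phi HW Hc Hs) as [_ Hd].
  apply locally_monotone; [lra|]. intros s0 Hs0.
  set (z := Phi (m s0)). set (w := W z).
  destruct (adapted_coordinates W Phi om HW Hsp Hinj Hnz (m s0) 1 Rlt_0_1)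
    as [dx [dy [rho [Cx [Cy [Ji [Jb [Pr [X0 [Y0 _]]]]]]]]]].
  fold z in Cx, Cy, Ji, Jb, X0, Y0. fold w in Cx, Cy, Ji, Jb, X0, Y0.
  destruct (local_cone _ _ dx dy rho Cx Cy Ji Jb (m s0)) as [e1 [P1 K1]];
    [fold z; rewrite X0, Rabs_R0; exact Pr | fold z; rewrite Y0, Rabs_R0; exact Pr |].
  destruct (Hinv (m s0) e1 P1) as [d1 [Q1 L1]]. fold z in L1.
  destruct (field_cone W z HW (Hnz (m s0))) as [d2 [Q2 L2]]. fold w in L2.
  destruct (continuous_near phi s0 (Rmin d1 d2) (Hc s0)) as [e [He K]]; [apply Rmin_pos; assumption|].
  assert (Ez : phi s0 = z) by (apply Hm, Hs0). rewrite Ez in K.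
  assert (Hmono : forall a b, 0 <= a <= T -> 0 <= b <= T -> Rabs (a - s0) < e -> Rabs (b - s0) < e -> a <= b ->
            along z w (phi a) <= along z w (phi b)).
  { intros a b Ha Hb Ha' Hb' Hab.
    destruct (MVT_gen (fun s => along z w (phi s)) a b (fun s => fst (W (phi s)) * fst w + snd (W (phi s)) * snd w)) as [c [Hc' E]].
    - intros s Hs'. rewrite Rmin_left, Rmax_right in Hs' by lra.
      destruct (Hd s) as [D1 D2]; [lra|].
      apply (is_derive_affine_comb _ _ _ _ _ (fst z) (fst w) (snd z) (snd w) D1 D2).
    - intros s _. apply continuity_pt_filterlim. unfold along.
      apply (continuous_plus (V := R_NormedModule) (fun s => (fst (phi s) - fst z) * fst w) (fun s => (snd (phi s) - snd z) * snd w)).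
      + apply (continuous_mult (K := R_AbsRing) (fun s => fst (phi s) - fst z) (fun _ => fst w)); [|apply continuous_const].
        apply (continuous_minus (V := R_NormedModule) (fun s => fst (phi s)) (fun _ => fst z)); [apply continuous_fst_comp, Hc | apply continuous_const].
      + apply (continuous_mult (K := R_AbsRing) (fun s => snd (phi s) - snd z) (fun _ => snd w)); [|apply continuous_const].
        apply (continuous_minus (V := R_NormedModule) (fun s => snd (phi s)) (fun _ => snd z)); [apply continuous_snd_comp, Hc | apply continuous_const].
    - rewrite Rmin_left, Rmax_right in Hc' by lra.
      apply Rabs_def2 in Ha'. apply Rabs_def2 in Hb'.
      assert (Hn := K c ltac:(apply Rabs_def1; lra)).
      destruct (L2 (phi c) (near_le _ _ _ _ (Rmin_r _ _) Hn)) as [Pc _]. nra. }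
  exists e. split; [exact He|]. intros s Hs1 Hs2.
  assert (Hs0e : Rabs (s0 - s0) < e) by (rewrite Rminus_diag, Rabs_R0; exact He).
  (* Continuity of the inverse keeps [m s] in the range where [along] strictly increases with the
     parameter. Since [along] also increases with time, the two orders agree. *)
  assert (Hclose : Rabs (m s - m s0) < e1).
  { apply L1. rewrite <- Hm by exact Hs1. apply (near_le (Rmin d1 d2)); [apply Rmin_l | apply K, Hs2]. }
  assert (Hself : Rabs (m s0 - m s0) <= e1) by (rewrite Rminus_diag, Rabs_R0; lra).
  split; intros Hle.
  - assert (A := Hmono s0 s Hs0 Hs1 Hs0e Hs2 Hle). rewrite !Hm in A by assumption.
    destruct (Rle_lt_dec (m s0) (m s)) as [|Hlt]; [assumption|]. exfalso.
    destruct (K1 (m s) (m s0)) as [_ B]; try assumption; lra.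
  - assert (A := Hmono s s0 Hs1 Hs0 Hs2 Hs0e Hle). rewrite !Hm in A by assumption.
    destruct (Rle_lt_dec (m s) (m s0)) as [|Hlt]; [assumption|]. exfalso.
    destruct (K1 (m s0) (m s)) as [_ B]; try assumption; lra.
Qed.

(** * Chains of arcs *)

Lemma is_derive_glue (f gl gr : R -> R) u l d :
  0 < d -> is_derive gl u l -> is_derive gr u l ->
  (forall s, u - d < s <= u -> f s = gl s) -> (forall s, u <= s < u + d -> f s = gr s) ->
  is_derive f u l.
Proof.
  intros Hd Dl Dr El Er.
  apply is_derive_Reals in Dl. apply is_derive_Reals in Dr. apply is_derive_Reals.
  intros eps He. destruct (Dl eps He) as [d1 K1]. destruct (Dr eps He) as [d2 K2].
  assert (P1 := cond_pos d1). assert (P2 := cond_pos d2).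
  assert (Hm : 0 < Rmin d (Rmin d1 d2)) by (repeat apply Rmin_pos; assumption).
  exists (mkposreal _ Hm). intros h Hh0 Hh. simpl in Hh.
  assert (M1 := Rmin_l d (Rmin d1 d2)). assert (M2 := Rmin_r d (Rmin d1 d2)).
  assert (M3 := Rmin_l d1 d2). assert (M4 := Rmin_r d1 d2).
  assert (Hh' := Rabs_def2 _ _ Hh).
  destruct (Rlt_le_dec h 0).
  - rewrite !El by lra. apply K1; lra.
  - rewrite !Er by lra. apply K2; lra.
Qed.

Lemma continuous_glue {U : UniformSpace} (f gl gr : R -> U) u d :
  0 < d -> continuous gl u -> continuous gr u ->
  (forall s, u - d < s <= u -> f s = gl s) -> (forall s, u <= s < u + d -> f s = gr s) ->
  continuous f u.
Proof.
  intros Hd Cl Cr El Er P HP.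
  assert (Pl : locally (gl u) P) by (rewrite <- El by lra; exact HP).
  assert (Pr : locally (gr u) P) by (rewrite <- Er by lra; exact HP).
  destruct (Cl P Pl) as [d1 K1]. destruct (Cr P Pr) as [d2 K2].
  assert (P1 := cond_pos d1). assert (P2 := cond_pos d2).
  assert (Hm : 0 < Rmin d (Rmin d1 d2)) by (repeat apply Rmin_pos; assumption).
  exists (mkposreal _ Hm). intros s Hs.
  assert (M1 := Rmin_l d (Rmin d1 d2)). assert (M2 := Rmin_r d (Rmin d1 d2)).
  assert (M3 := Rmin_l d1 d2). assert (M4 := Rmin_r d1 d2).
  assert (Hs1 : Rabs (s - u) < Rmin d (Rmin d1 d2)) by exact Hs.
  assert (Hs' := Rabs_def2 _ _ Hs1).
  destruct (Rlt_le_dec s u).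
  - rewrite El by lra. apply K1. change (Rabs (s - u) < d1). lra.
  - rewrite Er by lra. apply K2. change (Rabs (s - u) < d2). lra.
Qed.

Lemma Int_part_bounds u : IZR (Int_part u) <= u < IZR (Int_part u) + 1.
Proof. destruct (base_Int_part u). lra. Qed.

(** At an integer [k] the pieces [k - 1] and [k] meet. The hypothesis holds on closed unit
    intervals, so both have the value [f] and the derivative [df] there. *)
Lemma C1_glue (f df : R -> R) (g dg : Z -> R -> R) :
  (forall i, C1 (g i) (dg i)) ->
  (forall i u, IZR i <= u <= IZR i + 1 -> f u = g i u /\ df u = dg i u) -> C1 f df.
Proof.
  intros HC HE u.
  assert (Hside : exists i j d, 0 < d /\
    (forall s, u - d < s <= u -> IZR i <= s <= IZR i + 1) /\ (forall s, u <= s < u + d -> IZR j <= s <= IZR j + 1)).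
  { assert (B := Int_part_bounds u). set (k := Int_part u) in *.
    destruct (Req_dec u (IZR k)) as [E|E].
    - exists (k - 1)%Z, k, 1. rewrite minus_IZR. split; [lra|]. split; intros; lra.
    - exists k, k, (Rmin (u - IZR k) (IZR k + 1 - u)).
      split; [apply Rmin_pos; lra|].
      assert (M1 := Rmin_l (u - IZR k) (IZR k + 1 - u)). assert (M2 := Rmin_r (u - IZR k) (IZR k + 1 - u)).
      split; intros; lra. }
  destruct Hside as [i [j [d [Hd [Hl Hr]]]]].
  destruct (HC i u) as [Dl Cl]. destruct (HC j u) as [Dr Cr].
  assert (El := proj2 (HE i u (Hl u ltac:(lra)))). assert (Er := proj2 (HE j u (Hr u ltac:(lra)))).
  rewrite <- El in Dl. rewrite <- Er in Dr. split.
  - apply (is_derive_glue f (g i) (g j) u (df u) d Hd Dl Dr).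
    + intros s Hs. apply (HE i s), Hl, Hs.
    + intros s Hs. apply (HE j s), Hr, Hs.
  - apply (continuous_glue df (dg i) (dg j) u d Hd Cl Cr).
    + intros s Hs. apply (HE i s), Hl, Hs.
    + intros s Hs. apply (HE j s), Hr, Hs.
Qed.

(** The cubic that increases from 0 to 1 on the unit interval with derivative [6 * s - 6 * s^2],
    zero at both ends. *)
Definition ease (s : R) : R := 3 * s ^ 2 - 2 * s ^ 3.

Lemma ease_lt a b : 0 <= a -> a < b -> b <= 1 -> ease a < ease b.
Proof.
  intros Ha Hab Hb. unfold ease.
  (* This product is [ease b - ease a], its second factor written as a sum of nonnegative terms. *)
  assert (P : 0 < (b - a) * (2 * (a * (1 - a)) + 2 * (b * (1 - b)) + a * (1 - b) + b * (1 - a))).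
  { apply Rmult_lt_0_compat; [lra|].
    assert (0 <= a * (1 - a)) by (apply Rmult_le_pos; lra). assert (0 <= b * (1 - b)) by (apply Rmult_le_pos; lra).
    assert (0 <= a * (1 - b)) by (apply Rmult_le_pos; lra). assert (0 < b * (1 - a)) by (apply Rmult_lt_0_compat; lra).
    lra. }
  lra.
Qed.

Lemma ease_range s : 0 <= s <= 1 -> 0 <= ease s <= 1.
Proof.
  intros H. unfold ease.
  assert (0 <= s * s * (3 - 2 * s)) by (apply Rmult_le_pos; nra).
  assert (0 <= (1 - s) * (1 - s) * (1 + 2 * s)) by (apply Rmult_le_pos; nra). split; lra.
Qed.

Lemma orb_trans W (A : pt -> Prop) a b c : C1_field W -> orb W A a b -> orb W A b c -> orb W A a c.
Proof.
  intros HW [T1 [f1 [HT1 [C1' [S1 [A1 [B1 I1]]]]]]] [T2 [f2 [HT2 [C2' [S2 [A2 [B2 I2]]]]]]].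
  set (f := fun s => if Rle_dec s T1 then f1 s else f2 (s - T1)).
  assert (E1 : forall s, s <= T1 -> f s = f1 s).
  { intros s Hs. unfold f. destruct (Rle_dec s T1); [reflexivity|lra]. }
  assert (E2 : forall s, T1 <= s -> f s = f2 (s - T1)).
  { intros s Hs. unfold f. destruct (Rle_dec s T1); [|reflexivity].
    replace s with T1 by lra. rewrite Rminus_diag, B1, A2. reflexivity. }
  assert (Cf : forall s, continuous f s).
  { intros s.
    assert (Cs : continuous (fun s => f2 (s - T1)) s).
    { apply (continuous_comp (fun s => s - T1) f2); [|apply C2'].
      apply ex_derive_continuous_R. auto_derive. exact I. }
    destruct (Rtotal_order s T1) as [Hs|[Hs|Hs]].
    - apply (continuous_glue f f1 f1 s (T1 - s)); try lra; try apply C1'; intros; apply E1; lra.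
    - apply (continuous_glue f f1 (fun s => f2 (s - T1)) s 1); try lra; try apply C1'; try exact Cs; intros; [apply E1 | apply E2]; lra.
    - apply (continuous_glue f (fun s => f2 (s - T1)) (fun s => f2 (s - T1)) s (s - T1)); try lra; try exact Cs; intros; apply E2; lra. }
  exists (T1 + T2), f. split; [lra|]. split; [exact Cf|]. split; [|split; [|split]].
  - apply (solves_concat W 0 T1 (T1 + T2)); try assumption.
    + destruct S1 as [S1 S1']. split; [exact S1|]. intros s Hs. rewrite !E1 by lra.
      destruct (S1' s Hs) as [P Q]. rewrite P, Q. split; f_equal;
      apply RInt_ext; intros t Ht; rewrite Rmin_left, Rmax_right in Ht by lra; rewrite E1 by lra; reflexivity.
    + apply (flows_solves W); [exact HW | lra |].
      assert (F2 := flows_shift W 0 T2 (- T1) f2 (solves_flows W 0 T2 f2 HW C2' S2)).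
      destruct F2 as [_ F2]. split; [exact Cf|]. intros s Hs.
      destruct (F2 s) as [D1 D2]; [lra|].
      assert (Hd : 0 < s - T1) by lra.
      rewrite E2 by lra. unfold Rminus. split.
      * apply (is_derive_glue _ (fun t => fst (f2 (t + - T1))) (fun t => fst (f2 (t + - T1))) s _ (s - T1) Hd D1 D1);
          intros t Ht; rewrite E2 by lra; reflexivity.
      * apply (is_derive_glue _ (fun t => snd (f2 (t + - T1))) (fun t => snd (f2 (t + - T1))) s _ (s - T1) Hd D2 D2);
          intros t Ht; rewrite E2 by lra; reflexivity.
  - rewrite E1 by lra. exact A1.
  - rewrite E2 by lra. replace (T1 + T2 - T1) with T2 by ring. exact B2.
  - intros s Hs. destruct (Rle_dec s T1) as [Hl|Hl].
    + rewrite E1 by lra. apply I1. lra.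
    + rewrite E2 by lra. apply I2. lra.
Qed.

(** * The single orbit formed by a chain of arcs *)

Section Chain.

Variables (W : vfield) (F : pt -> R) (q : Z -> pt).

(** A general [F] covers both sides: [F = f] for the arcs of [X], and [F = - f] with reversed
    indices for those of [Y]. *)
Definition chain_arc (i : Z) (T : R) (phi : R -> pt) : Prop :=
  0 < T /\ flows W 0 T phi /\ phi 0 = q i /\ phi T = q (i + 1)%Z /\ forall s, 0 < s < T -> 0 < F (phi s).

Hypotheses (HW : C1_field W) (HF : forall p, continuous F p)
  (Hq : forall i j, q i = q j -> i = j) (HFq : forall i, F (q i) = 0)
  (Hiso : forall i, exists d, 0 < d /\ forall j, near d (q i) (q j) -> j = i)
  (HWq : forall i, W (q i) <> (0, 0))
  (Harc : forall i, exists T phi, chain_arc i T phi).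

Lemma chain_arc_nonneg i T phi s : chain_arc i T phi -> 0 <= s <= T -> 0 <= F (phi s).
Proof.
  intros [HT [_ [E0 [E1 HP]]]] Hs.
  destruct (Req_dec s 0) as [->|]; [rewrite E0, HFq; lra|].
  destruct (Req_dec s T) as [->|]; [rewrite E1, HFq; lra|]. left. apply HP. lra.
Qed.

(** By uniqueness the arcs coincide until the first of them ends. There [F] vanishes, which on the
    other arc happens only at its end; so both end together, at the same [q], and the indices
    agree. *)
Lemma arc_tails_agree i j T T' phi psi s s' :
  chain_arc i T phi -> chain_arc j T' psi -> 0 <= s < T -> 0 <= s' < T' -> phi s = psi s' ->
  i = j /\ T - s = T' - s' /\ forall t, 0 <= t <= T - s -> phi (s + t) = psi (s' + t).
Proof.
  assert (Main : forall i j T T' phi psi s s',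
    chain_arc i T phi -> chain_arc j T' psi -> 0 <= s < T -> 0 <= s' < T' -> phi s = psi s' ->
    T - s <= T' - s' ->
    i = j /\ T - s = T' - s' /\ forall t, 0 <= t <= T - s -> phi (s + t) = psi (s' + t)).
  { clear i j T T' phi psi s s'. intros i j T T' phi psi s s' A B Hs Hs' E Hle.
    destruct A as [HT [Fl [A0 [A1 AP]]]]. destruct B as [HT' [Fl' [B0 [B1 BP]]]].
    assert (U : forall t, 0 <= t <= T - s -> phi (s + t) = psi (s' + t)).
    { intros t Ht. rewrite (Rplus_comm s), (Rplus_comm s').
      apply (flows_unique W (T - s) (fun t => phi (t + s)) (fun t => psi (t + s')) HW).
      - apply (flows_sub W (0 - s) (T - s)); [lra | lra | apply flows_shift, Fl].
      - apply (flows_sub W (0 - s') (T' - s')); [lra | lra | apply flows_shift, Fl'].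
      - rewrite !Rplus_0_l. exact E.
      - exact Ht. }
    assert (E1 := U (T - s) ltac:(lra)). replace (s + (T - s)) with T in E1 by ring.
    assert (ET : T - s = T' - s').
    { destruct (Req_dec (s' + (T - s)) T') as [|Hn]; [lra|]. exfalso.
      assert (P := BP (s' + (T - s)) ltac:(lra)). rewrite <- E1, A1, HFq in P. lra. }
    split; [|split; [exact ET | exact U]].
    replace (s' + (T - s)) with T' in E1 by lra. rewrite A1, B1 in E1. apply Hq in E1. lia. }
  intros A B Hs Hs' E. destruct (Rle_dec (T - s) (T' - s')) as [Hle|Hle].
  - apply Main; assumption.
  - destruct (Main j i T' T psi phi s' s B A Hs' Hs (eq_sym E)) as [E1 [E2 E3]]; [lra|].
    split; [symmetry; exact E1|]. split; [symmetry; exact E2|].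
    intros t Ht. symmetry. apply E3. lra.
Qed.

(** At an equilibrium the arc would stay put by uniqueness, at a point with [F > 0], and could not
    reach [q (i + 1)], where [F] is zero. *)
Lemma arc_field_nonzero i T phi s : chain_arc i T phi -> 0 <= s < T -> W (phi s) <> (0, 0).
Proof.
  intros A Hs E. destruct (Req_dec s 0) as [->|Hn].
  { destruct A as [_ [_ [E0 _]]]. rewrite E0 in E. apply (HWq i E). }
  destruct A as [HT [Fl [A0 [A1 AP]]]].
  assert (U := flows_unique W (T - s) (fun t => phi (t + s)) (fun _ => phi s) HW).
  assert (EE : phi T = phi s).
  { rewrite <- (U) with (s := T - s).
    - f_equal. ring.
    - apply (flows_sub W (0 - s) (T - s)); [lra | lra | apply flows_shift, Fl].
    - split; [intros; apply continuous_const|]. intros t _. rewrite E. simpl.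
      split; apply (is_derive_const (V := R_NormedModule)).
    - rewrite Rplus_0_l. reflexivity.
    - lra. }
  assert (P := AP s ltac:(lra)). rewrite <- EE, A1, HFq in P. lra.
Qed.

(* Each arc is run through with speed zero at its ends, which makes the concatenation [C^1]. *)
Lemma chain_curve : exists (Phi : R -> pt) (om : R -> R),
  curve_speed W Phi om /\ (forall u v, Phi u = Phi v -> u = v) /\
  (forall u, W (Phi u) <> (0, 0)) /\ inverse_continuous Phi /\
  (forall i, Phi (IZR i) = q i) /\ (forall u, 0 <= F (Phi u)) /\
  (forall u, F (Phi u) = 0 -> exists i, u = IZR i) /\
  (forall i T phi s, chain_arc i T phi -> 0 <= s <= T -> exists u, phi s = Phi u) /\
  (forall u, exists i T phi s, chain_arc i T phi /\ 0 <= s <= T /\ Phi u = phi s) /\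
  (forall u v, u <= v -> orb W (fun z => exists w, z = Phi w) (Phi u) (Phi v)).
Proof.
  destruct (functional_choice (fun i (a : R * (R -> pt)) => chain_arc i (fst a) (snd a))) as [ch Hch].
  { intros i. destruct (Harc i) as [T [phi H]]. exists (T, phi). exact H. }
  set (T := fun i => fst (ch i)). set (ph := fun i => snd (ch i)).
  assert (HA : forall i, chain_arc i (T i) (ph i)) by (intros i; apply Hch).
  clearbody T ph. clear ch Hch.
  set (Phi := fun u => let i := Int_part u in ph i (T i * ease (u - IZR i))).
  set (om := fun u => let i := Int_part u in T i * (6 * (u - IZR i) - 6 * (u - IZR i) ^ 2)).
  (* [Int_part] selects half-open intervals. The right end is added here: both arcs pass through
     [q (i + 1)] there, and both speeds are zero. *)
  assert (EP : forall i u, IZR i <= u <= IZR i + 1 ->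
     Phi u = ph i (T i * ease (u - IZR i)) /\ om u = T i * (6 * (u - IZR i) - 6 * (u - IZR i) ^ 2)).
  { intros i u Hu. assert (B := Int_part_bounds u).
    destruct (Req_dec u (IZR i + 1)) as [E|E].
    - assert (Ek : Int_part u = (i + 1)%Z).
      { rewrite <- plus_IZR in E. rewrite E in B. destruct B as [B1 B2].
        rewrite <- plus_IZR in B2. rewrite <- E in B1, B2. rewrite E in B1, B2.
        apply le_IZR in B1. apply lt_IZR in B2. rewrite E. lia. }
      unfold Phi, om. rewrite Ek, plus_IZR, E.
      replace (IZR i + 1 - (IZR i + 1)) with 0 by ring. replace (IZR i + 1 - IZR i) with 1 by ring.
      replace (T (i + 1)%Z * ease 0) with 0 by (unfold ease; ring).
      replace (T i * ease 1) with (T i) by (unfold ease; ring).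
      destruct (HA i) as [_ [_ [_ [E1 _]]]]. destruct (HA (i + 1)%Z) as [_ [_ [E0 _]]].
      rewrite E0, E1. split; [reflexivity | ring].
    - assert (Ek : Int_part u = i).
      { assert (IZR i < IZR (Int_part u + 1)) by (rewrite plus_IZR; lra).
        assert (IZR (Int_part u) < IZR (i + 1)) by (rewrite plus_IZR; lra).
        apply lt_IZR in H. apply lt_IZR in H0. lia. }
      unfold Phi, om. rewrite Ek. split; reflexivity. }
  assert (HT : forall i, 0 < T i) by (intros i; apply (HA i)).
  assert (Hrange : forall i s, 0 <= s <= 1 -> 0 <= T i * ease s <= T i).
  { intros i s Hs. assert (R := ease_range s Hs). assert (P := HT i). split; nra. }
  assert (Hspeed : curve_speed W Phi om).
  { split.
    - intros u. assert (B := Int_part_bounds u). assert (P := HT (Int_part u)).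
      unfold om. apply Rmult_le_pos; [lra|]. nra.
    (* Each piece is a primitive of the field along [ph i] rather than [ph i] itself: this is [C1]
       on the whole line, also where [ph i] no longer solves the equation. *)
    - assert (Piece : forall pr : pt -> R,
        (forall i t, continuous (fun s => pr (W (ph i s))) t) ->
        (forall i s, 0 <= s <= T i -> pr (ph i s) = pr (q i) + RInt (fun t => pr (W (ph i t))) 0 s) ->
        C1 (fun u => pr (Phi u)) (fun u => om u * pr (W (Phi u)))).
      { intros pr Cp Ep.
        apply (C1_glue _ _
          (fun i u => pr (q i) + RInt (fun t => pr (W (ph i t))) 0 (T i * ease (u - IZR i)))
          (fun i u => T i * (6 * (u - IZR i) - 6 * (u - IZR i) ^ 2) * pr (W (ph i (T i * ease (u - IZR i)))))).
        - intros i u.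
          assert (De : is_derive (fun u => T i * ease (u - IZR i)) u (T i * (6 * (u - IZR i) - 6 * (u - IZR i) ^ 2))).
          { unfold ease. auto_derive; [exact I | ring]. }
          split.
          + evar_last.
            * apply (is_derive_plus (V := R_NormedModule) (fun _ => pr (q i))
                (fun u => RInt (fun t => pr (W (ph i t))) 0 (T i * ease (u - IZR i)))).
              -- apply (is_derive_const (V := R_NormedModule)).
              -- apply (is_derive_comp (V := R_NormedModule) (fun s => RInt (fun t => pr (W (ph i t))) 0 s) (fun u => T i * ease (u - IZR i))).
                 ++ apply (primitive_derive (fun t => pr (W (ph i t)))), Cp.
                 ++ exact De.
            * unfold plus, zero, scal; simpl. unfold mult; simpl. ring.
          + apply (continuous_mult (K := R_AbsRing) (fun u => T i * (6 * (u - IZR i) - 6 * (u - IZR i) ^ 2))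
              (fun u => pr (W (ph i (T i * ease (u - IZR i)))))).
            * apply ex_derive_continuous_R. auto_derive. exact I.
            * apply (continuous_comp (fun u => T i * ease (u - IZR i)) (fun s => pr (W (ph i s)))); [|apply Cp].
              apply ex_derive_continuous_R. eexists. exact De.
        - intros i u Hu. destruct (EP i u Hu) as [E1 E2]. rewrite E1, E2. split; [|reflexivity].
          apply Ep. apply Hrange. lra. }
      split; apply Piece.
      + intros i t. destruct (HA i) as [_ [Fl _]]. apply (field_along_continuous W (ph i) t HW (proj1 Fl t)).
      + intros i s Hs. destruct (HA i) as [P [Fl [E0 _]]].
        destruct (flows_solves W 0 (T i) (ph i) HW (Rlt_le _ _ P) Fl) as [_ K]. rewrite <- E0. apply (K s Hs).
      + intros i t. destruct (HA i) as [_ [Fl _]]. apply (field_along_continuous W (ph i) t HW (proj1 Fl t)).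
      + intros i s Hs. destruct (HA i) as [P [Fl [E0 _]]].
        destruct (flows_solves W 0 (T i) (ph i) HW (Rlt_le _ _ P) Fl) as [_ K]. rewrite <- E0. apply (K s Hs). }
  assert (Hlocal : forall u, exists i s, 0 <= s < T i /\ s = T i * ease (u - IZR i) /\ IZR i <= u < IZR i + 1 /\ Phi u = ph i s).
  { intros u. exists (Int_part u), (T (Int_part u) * ease (u - IZR (Int_part u))).
    assert (B := Int_part_bounds u). assert (P := HT (Int_part u)).
    assert (R := ease_range (u - IZR (Int_part u)) ltac:(lra)).
    assert (R' := ease_lt (u - IZR (Int_part u)) 1 ltac:(lra) ltac:(lra) ltac:(lra)).
    replace (ease 1) with 1 in R' by (unfold ease; ring).
    repeat split; try lra; try reflexivity; nra. }
  assert (Hinj : forall u v, Phi u = Phi v -> u = v).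
  { intros u v E. destruct (Hlocal u) as [i [s [Hs [Es [Hu Eu]]]]]. destruct (Hlocal v) as [j [s' [Hs' [Es' [Hv Ev]]]]].
    rewrite Eu, Ev in E.
    destruct (arc_tails_agree _ _ _ _ _ _ _ _ (HA i) (HA j) Hs Hs' E) as [<- [ET _]].
    assert (ease (u - IZR i) = ease (v - IZR i)) by (assert (P := HT i); nra).
    destruct (Rtotal_order u v) as [Hl|[Hl|Hl]]; [|exact Hl|].
    - assert (R := ease_lt (u - IZR i) (v - IZR i) ltac:(lra) ltac:(lra) ltac:(lra)). lra.
    - assert (R := ease_lt (v - IZR i) (u - IZR i) ltac:(lra) ltac:(lra) ltac:(lra)). lra. }
  assert (Hnz : forall u, W (Phi u) <> (0, 0)).
  { intros u. destruct (Hlocal u) as [i [s [Hs [_ [_ ->]]]]]. apply (arc_field_nonzero i (T i) (ph i) s (HA i) Hs). }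
  assert (Hint : forall i, Phi (IZR i) = q i).
  { intros i. destruct (EP i (IZR i)) as [-> _]; [lra|]. rewrite Rminus_diag.
    replace (T i * ease 0) with 0 by (unfold ease; ring). apply (HA i). }
  assert (Hnn : forall u, 0 <= F (Phi u)).
  { intros u. destruct (Hlocal u) as [i [s [Hs [_ [_ ->]]]]]. apply (chain_arc_nonneg i (T i) (ph i) s (HA i)). lra. }
  assert (Hzero : forall u, F (Phi u) = 0 -> exists i, u = IZR i).
  { intros u E. destruct (Hlocal u) as [i [s [Hs [_ [_ Eu]]]]]. exists i. apply Hinj. rewrite Hint, Eu.
    destruct (HA i) as [_ [_ [E0 [_ P]]]].
    destruct (Req_dec s 0) as [->|Hn]; [exact E0|]. exfalso. rewrite Eu in E. specialize (P s ltac:(lra)). lra. }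
  assert (Hon : forall i s, 0 <= s <= T i -> exists u, IZR i <= u <= IZR i + 1 /\ ph i s = Phi u).
  { intros i s Hs.
    destruct (IVT_gen (fun x => T i * ease x) 0 1 s) as [x [Hx Ex]].
    - intros x. apply ex_derive_continuity_pt. unfold ease. auto_derive. exact I.
    - replace (T i * ease 0) with 0 by (unfold ease; ring). replace (T i * ease 1) with (T i) by (unfold ease; ring).
      rewrite Rmin_left, Rmax_right by (assert (P := HT i); lra). exact Hs.
    - rewrite Rmin_left, Rmax_right in Hx by lra. exists (IZR i + x). split; [lra|].
      destruct (EP i (IZR i + x)) as [-> _]; [lra|]. rewrite <- Ex. do 2 f_equal. f_equal. ring. }
  exists Phi, om.
  split; [exact Hspeed|]. split; [exact Hinj|]. split; [exact Hnz|].
  split; [|split; [exact Hint|]; split; [exact Hnn|]; split; [exact Hzero|]; split; [|split]].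
  - apply (curve_inverse_continuous W Phi om HW Hspeed Hinj Hnz).
    intros u0.
    (* A small neighbourhood of [Phi u0] contains at most one [q k]: none if [F] is positive at
       [Phi u0], where [k = 0] is a dummy, and one by isolation otherwise. So of two consecutive
       integers at least one is a parameter outside it, which gives exits in both directions. *)
    assert (Hk : exists d k, 0 < d /\ forall j, near d (Phi u0) (q j) -> j = k).
    { destruct (Rle_lt_or_eq_dec 0 (F (Phi u0)) (Hnn u0)) as [Hp|Hz].
      - destruct (continuous_plane F (Phi u0) (F (Phi u0)) (HF _) Hp) as [d [Hd K]].
        exists d, 0%Z. split; [exact Hd|]. intros j Hj. specialize (K _ Hj). rewrite HFq in K.
        apply Rabs_def2 in K. lra.
      - destruct (Hzero u0 (eq_sym Hz)) as [i ->]. destruct (Hiso i) as [d [Hd K]].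
        exists d, i. split; [exact Hd|]. rewrite Hint. exact K. }
    destruct Hk as [d [k [Hd K]]]. exists d. split; [exact Hd|].
    assert (Hsel : forall j, exists j', (j <= j' <= j + 1)%Z /\ ~ near d (Phi u0) (Phi (IZR j'))).
    { intros j. destruct (Z.eq_dec j k) as [->|Hn].
      - exists (k + 1)%Z. split; [lia|]. rewrite Hint. intros Hc. apply K in Hc. lia.
      - exists j. split; [lia|]. rewrite Hint. intros Hc. apply K in Hc. contradiction. }
    split; intros T0; assert (B := Int_part_bounds T0).
    + destruct (Hsel (Int_part T0 + 1)%Z) as [j [Hj Hn]]. exists (IZR j). split; [|exact Hn].
      assert (IZR (Int_part T0 + 1) <= IZR j) by (apply IZR_le; lia). rewrite plus_IZR in H. lra.
    + destruct (Hsel (Int_part T0 - 2)%Z) as [j [Hj Hn]]. exists (IZR j). split; [|exact Hn].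
      assert (IZR j <= IZR (Int_part T0 - 1)) by (apply IZR_le; lia). rewrite minus_IZR in H. lra.
  - intros i T0 phi s A Hs.
    destruct (Req_dec s T0) as [->|Hn].
    { exists (IZR (i + 1)). rewrite Hint. apply A. }
    destruct (arc_tails_agree i i T0 (T i) phi (ph i) 0 0 A (HA i)) as [_ [ET U]].
    + assert (P := proj1 A). lra.
    + assert (P := HT i). lra.
    + destruct A as [_ [_ [-> _]]]. destruct (HA i) as [_ [_ [-> _]]]. reflexivity.
    + specialize (U s ltac:(lra)). rewrite !Rplus_0_l in U. rewrite U.
      destruct (Hon i s) as [u [_ Eu]]; [lra|]. exists u. exact Eu.
  - intros u. destruct (Hlocal u) as [i [s [Hs [_ [_ Eu]]]]].
    exists i, (T i), (ph i), s. split; [apply HA|]. split; [lra | exact Eu].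
  - assert (Step : forall i u v, IZR i <= u -> u <= v -> v <= IZR i + 1 ->
      orb W (fun z => exists w, z = Phi w) (Phi u) (Phi v)).
    { intros i u v Hu Huv Hv.
      destruct (EP i u) as [-> _]; [lra|]. destruct (EP i v) as [-> _]; [lra|].
      assert (Hle : ease (u - IZR i) <= ease (v - IZR i)).
      { destruct (Req_dec u v) as [->|]; [lra|]. left. apply ease_lt; lra. }
      assert (R1 := Hrange i (u - IZR i) ltac:(lra)). assert (R2 := Hrange i (v - IZR i) ltac:(lra)).
      assert (P := HT i).
      set (a := T i * ease (u - IZR i)) in *. set (b := T i * ease (v - IZR i)) in *.
      assert (Hab : a <= b) by (unfold a, b; nra).
      destruct (HA i) as [_ [Fl _]]. assert (Fl' := flows_shift W 0 (T i) a (ph i) Fl).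
      exists (b - a), (fun s => ph i (s + a)). split; [lra|]. split; [apply Fl'|].
      split; [|split; [|split]].
      - apply flows_solves; [exact HW | lra |]. apply (flows_sub W (0 - a) (T i - a)); [lra | lra | exact Fl'].
      - rewrite Rplus_0_l. reflexivity.
      - f_equal. ring.
      - intros s Hs. destruct (Hon i (s + a)) as [w [_ Ew]]; [lra|]. exists w. exact Ew. }
    (* Induction on a bound for the number of arcs passed, starting at a joint; the initial part of
       an arc is prepended afterwards. *)
    assert (Many : forall n i v, IZR i <= v <= IZR i + INR n ->
      orb W (fun z => exists w, z = Phi w) (Phi (IZR i)) (Phi v)).
    { induction n as [|n IH]; intros i v Hv.
      - simpl in Hv. apply (Step i); lra.
      - destruct (Rle_dec v (IZR i + 1)) as [Hl|Hl]; [apply (Step i); lra|].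
        apply (orb_trans W _ _ (Phi (IZR (i + 1))) _ HW).
        + apply (Step i); rewrite ?plus_IZR; lra.
        + apply IH. rewrite plus_IZR. rewrite S_INR in Hv. lra. }
    intros u v Huv. assert (B := Int_part_bounds u). set (i := Int_part u) in *.
    destruct (Rle_dec v (IZR i + 1)) as [Hl|Hl]; [apply (Step i); lra|].
    apply (orb_trans W _ _ (Phi (IZR (i + 1))) _ HW).
    + apply (Step i); rewrite ?plus_IZR; lra.
    + destruct (INR_unbounded (v - IZR (i + 1))) as [n Hn]. apply (Many n).
      rewrite plus_IZR in *. lra.
Qed.

End Chain.

(** * Sigma-equivalence *)

Definition orbit_line (W : vfield) (Phi : R -> pt) : Prop :=
  (exists om, curve_speed W Phi om) /\ (forall u v, Phi u = Phi v -> u = v) /\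
  (forall u, W (Phi u) <> (0, 0)) /\ inverse_continuous Phi /\
  (forall u v, u <= v -> orb W (fun z => exists w, z = Phi w) (Phi u) (Phi v)).

(* [Y] runs through the common points of the two orbits in the opposite order, hence
   [Psi (- i)]. *)
Definition two_orbit_chain (Z : PSVF) (L : pt -> Prop) (Phi Psi : R -> pt) : Prop :=
  (C1_field (psX Z) /\ C1_field (psY Z) /\ (forall p, continuous (psf Z) p)) /\
  orbit_line (psX Z) Phi /\ orbit_line (psY Z) Psi /\
  (forall z, L z <-> (exists u, z = Phi u) \/ (exists u, z = Psi u)) /\
  (forall u, 0 <= psf Z (Phi u)) /\ (forall u, psf Z (Psi u) <= 0) /\
  (forall u, psf Z (Phi u) = 0 -> exists i, u = IZR i) /\
  (forall u, psf Z (Psi u) = 0 -> exists i, u = IZR i) /\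
  (forall i, psf Z (Phi (IZR i)) = 0 /\ Xf Z (Phi (IZR i)) = 0 /\ Phi (IZR i) = Psi (IZR (- i))).

Lemma orb_ext W (A B : pt -> Prop) a b : (forall z, A z -> B z) -> orb W A a b -> orb W B a b.
Proof.
  intros H [T [phi [HT [Hc [Hs [E0 [E1 Hin]]]]]]].
  exists T, phi. do 5 (split; [assumption|]). intros s Hs'. apply H, Hin, Hs'.
Qed.

Lemma orb_endpoints W A a b : orb W A a b -> A a /\ A b.
Proof.
  intros [T [phi [HT [_ [_ [<- [<- H]]]]]]]. split; apply H; lra.
Qed.

Lemma orbit_line_orb W Phi a b : C1_field W -> orbit_line W Phi ->
  orb W (fun z => exists w, z = Phi w) a b <-> exists u v, u <= v /\ a = Phi u /\ b = Phi v.
Proof.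
  intros HW [[om Hsp] [Hinj [Hnz [Hinv Hfwd]]]]. split.
  - intros H. destruct (orb_endpoints _ _ _ _ H) as [[u ->] [v ->]]. exists u, v.
    split; [|split; reflexivity]. apply (orbit_order W Phi om u v); assumption.
  - intros [u [v [Huv [-> ->]]]]. apply Hfwd, Huv.
Qed.

(** * The homeomorphism that matches parameters *)

Definition inv_curve (Phi : R -> pt) (z : pt) : R := epsilon (inhabits 0) (fun u => z = Phi u).

(** Points of [Sigma] lie on both orbits and are sent by the [X]-branch; [transfer_lower] shows that
    the [Y]-branch gives the same image. *)
Definition transfer (Z : PSVF) (Phi Psi Phi' Psi' : R -> pt) (z : pt) : pt :=
  if Rle_dec 0 (psf Z z) then Phi' (inv_curve Phi z) else Psi' (inv_curve Psi z).

Lemma inv_curve_eq (Phi : R -> pt) u : (forall u v, Phi u = Phi v -> u = v) -> inv_curve Phi (Phi u) = u.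
Proof.
  intros Hinj. symmetry. apply Hinj. unfold inv_curve.
  apply (epsilon_spec (inhabits 0) (fun w => Phi u = Phi w)). exists u. reflexivity.
Qed.

Lemma dist_near z w d : Defs.dist w z < d -> near d z w.
Proof.
  unfold Defs.dist, near. intros H. set (a := fst w - fst z) in *. set (b := snd w - snd z) in *.
  assert (S1 : Rabs a <= sqrt (a ^ 2 + b ^ 2)).
  { rewrite <- sqrt_Rsqr_abs. apply sqrt_le_1_alt. unfold Rsqr. nra. }
  assert (S2 : Rabs b <= sqrt (a ^ 2 + b ^ 2)).
  { rewrite <- sqrt_Rsqr_abs. apply sqrt_le_1_alt. unfold Rsqr. nra. }
  lra.
Qed.

Lemma near_dist z w d : near (d / 2) z w -> Defs.dist w z < d.
Proof.
  unfold Defs.dist, near. intros [H1 H2]. set (a := fst w - fst z) in *. set (b := snd w - snd z) in *.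
  apply Rabs_def2 in H1. apply Rabs_def2 in H2.
  assert (Hd : 0 < d) by lra.
  rewrite <- (sqrt_pow2 d) by lra. apply sqrt_lt_1_alt. nra.
Qed.

Section Transfer.

Variables (Z Z' : PSVF) (L L' : pt -> Prop) (Phi Psi Phi' Psi' : R -> pt).
Hypotheses (HC : two_orbit_chain Z L Phi Psi) (HC' : two_orbit_chain Z' L' Phi' Psi').

Let h := transfer Z Phi Psi Phi' Psi'.

Lemma transfer_upper u : h (Phi u) = Phi' u.
Proof.
  destruct HC as [_ [[_ [Hinj _]] [_ [_ [Hp _]]]]].
  unfold h, transfer. destruct (Rle_dec 0 (psf Z (Phi u))) as [_|Hn]; [|exfalso; apply Hn, Hp].
  rewrite inv_curve_eq by exact Hinj. reflexivity.
Qed.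

Lemma lower_zero u : psf Z (Psi u) = 0 -> exists i, Psi u = Phi (IZR i) /\ u = IZR (- i).
Proof.
  intros E. destruct HC as [_ [_ [_ [_ [_ [_ [_ [Hz Hi]]]]]]]].
  destruct (Hz u E) as [i ->]. exists (- i)%Z. destruct (Hi (- i)%Z) as [_ [_ ->]].
  rewrite Z.opp_involutive. split; reflexivity.
Qed.

(** On [Sigma] the map uses the other branch. The results agree because both chains identify
    parameter [i] of the first orbit with [- i] of the second. *)
Lemma transfer_lower u : h (Psi u) = Psi' u.
Proof.
  destruct HC as [_ [_ [[_ [Hinj _]] [_ [_ [Hn _]]]]]].
  destruct (Req_dec (psf Z (Psi u)) 0) as [E|E].
  - destruct (lower_zero u E) as [i [-> ->]]. rewrite transfer_upper.
    apply HC'.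
  - unfold h, transfer. destruct (Rle_dec 0 (psf Z (Psi u))) as [Hp|_]; [specialize (Hn u); lra|].
    rewrite inv_curve_eq by exact Hinj. reflexivity.
Qed.

Lemma chain_plus z : L z -> in_Sigma_plus Z z <-> exists u, z = Phi u.
Proof.
  intros Hz. destruct HC as [_ [_ [_ [HL [Hp [Hn _]]]]]]. unfold in_Sigma_plus. split.
  - intros Hf. apply HL in Hz. destruct Hz as [Hz|[u ->]]; [exact Hz|].
    destruct (lower_zero u) as [i [E _]]; [specialize (Hn u); lra|]. exists (IZR i). exact E.
  - intros [u ->]. apply Rle_ge, Hp.
Qed.

Lemma chain_minus z : L z -> in_Sigma_minus Z z <-> exists u, z = Psi u.
Proof.
  intros Hz. destruct HC as [_ [_ [_ [HL [Hp [Hn [Hz0 [_ Hi]]]]]]]]. unfold in_Sigma_minus. split.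
  - intros Hf. apply HL in Hz. destruct Hz as [[u ->]|Hz]; [|exact Hz].
    destruct (Hz0 u) as [i ->]; [specialize (Hp u); lra|]. exists (IZR (- i)). apply Hi.
  - intros [u ->]. apply Hn.
Qed.

Lemma chain_Sigma z : L z -> in_Sigma Z z <-> exists i, z = Phi (IZR i).
Proof.
  intros Hz. destruct HC as [_ [_ [_ [HL [Hp [Hn [Hz0 [_ Hi]]]]]]]]. unfold in_Sigma. split.
  - intros Hf. apply HL in Hz. destruct Hz as [[u ->]|[u ->]].
    + destruct (Hz0 u Hf) as [i ->]. exists i. reflexivity.
    + destruct (lower_zero u Hf) as [i [E _]]. exists i. exact E.
  - intros [i ->]. apply Hi.
Qed.

Lemma transfer_in z : L z -> L' (h z).
Proof.
  destruct HC as [_ [_ [_ [HL _]]]]. destruct HC' as [_ [_ [_ [HL' _]]]]. intros Hz.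
  apply HL in Hz. apply HL'. destruct Hz as [[u ->]|[u ->]].
  - left. exists u. apply transfer_upper.
  - right. exists u. apply transfer_lower.
Qed.

Lemma curve_transfer_near W W' (A A' : R -> pt) u e :
  orbit_line W A -> orbit_line W' A' -> 0 < e ->
  exists d, 0 < d /\ forall w, near d (A u) (A w) -> near e (A' u) (A' w).
Proof.
  intros [_ [_ [_ [Hinv _]]]] [[om Hsp] _] He.
  destruct (continuous_near A' u e (curve_continuous W' A' om Hsp u) He) as [d1 [P1 K1]].
  destruct (Hinv u d1 P1) as [d [P K]]. exists d. split; [exact P|]. intros w Hw. apply K1, K, Hw.
Qed.

(** Points of [L] near [z] are treated separately on the two orbits. If [z] is on the orbit in
    question, the continuity of its inverse applies; if not, [f] has a strict sign at [z] and the
    orbit stays away. At a fold both estimates are used. *)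
Lemma transfer_continuous : cont_on L h.
Proof.
  destruct HC as [[_ [_ Hf]] [OX [OY [HL [Hp [Hn [Hz0 [_ Hi]]]]]]]].
  destruct HC' as [_ [OX' [OY' _]]].
  intros z Hz eps He.
  assert (Up : exists d, 0 < d /\ forall w, near d z (Phi w) -> near (eps / 2) (h z) (Phi' w)).
  { destruct (Rle_lt_dec 0 (psf Z z)) as [Hs|Hs].
    - destruct (proj1 (chain_plus z Hz)) as [u ->]; [apply Rle_ge, Hs|]. rewrite transfer_upper.
      apply (curve_transfer_near _ _ Phi Phi' u (eps / 2) OX OX'). lra.
    - destruct (continuous_plane _ z (- psf Z z) (Hf z)) as [d [Pd K]]; [lra|].
      exists d. split; [exact Pd|]. intros w Hw. specialize (K _ Hw). apply Rabs_def2 in K. specialize (Hp w). lra. }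
  assert (Down : exists d, 0 < d /\ forall w, near d z (Psi w) -> near (eps / 2) (h z) (Psi' w)).
  { destruct (Rle_lt_dec (psf Z z) 0) as [Hs|Hs].
    - destruct (proj1 (chain_minus z Hz)) as [u ->]; [exact Hs|]. rewrite transfer_lower.
      apply (curve_transfer_near _ _ Psi Psi' u (eps / 2) OY OY'). lra.
    - destruct (continuous_plane _ z (psf Z z) (Hf z)) as [d [Pd K]]; [lra|].
      exists d. split; [exact Pd|]. intros w Hw. specialize (K _ Hw). apply Rabs_def2 in K. specialize (Hn w). lra. }
  destruct Up as [d1 [P1 K1]]. destruct Down as [d2 [P2 K2]].
  exists (Rmin d1 d2). split; [apply Rmin_pos; assumption|].
  intros w Hw Hd. apply dist_near in Hd. apply near_dist.
  apply HL in Hw. destruct Hw as [[u ->]|[u ->]].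
  - rewrite transfer_upper. apply K1. apply (near_le (Rmin d1 d2)); [apply Rmin_l | exact Hd].
  - rewrite transfer_lower. apply K2. apply (near_le (Rmin d1 d2)); [apply Rmin_r | exact Hd].
Qed.

(** Within [L] the part in [Sigma_plus] is exactly the orbit [Phi], so the orbit relation is the
    order of parameters, which [transfer] preserves. *)
Lemma chain_orb_X a b :
  orb (psX Z) (fun z => L z /\ in_Sigma_plus Z z) a b <-> exists u v, u <= v /\ a = Phi u /\ b = Phi v.
Proof.
  destruct HC as [[HX _] [OX [_ [HL _]]]].
  rewrite <- (orbit_line_orb _ _ a b HX OX). split; apply orb_ext.
  - intros z [Hz Hs]. apply chain_plus; assumption.
  - intros z Hz. assert (L z) by (apply HL; left; exact Hz). split; [assumption|].
    apply chain_plus; assumption.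
Qed.

Lemma chain_orb_Y a b :
  orb (psY Z) (fun z => L z /\ in_Sigma_minus Z z) a b <-> exists u v, u <= v /\ a = Psi u /\ b = Psi v.
Proof.
  destruct HC as [[_ [HY _]] [_ [OY [HL _]]]].
  rewrite <- (orbit_line_orb _ _ a b HY OY). split; apply orb_ext.
  - intros z [Hz Hs]. apply chain_minus; assumption.
  - intros z Hz. assert (L z) by (apply HL; right; exact Hz). split; [assumption|].
    apply chain_minus; assumption.
Qed.

Lemma chain_orb_slide a b :
  ~ orb (slide_field Z) (fun z => L z /\ (sliding Z z \/ escaping Z z)) a b.
Proof.
  intros H. destruct (orb_endpoints _ _ _ _ H) as [[Ha Hs] _].
  assert (E : in_Sigma Z a) by (destruct Hs as [[E _]|[E _]]; exact E).
  destruct (proj1 (chain_Sigma a Ha) E) as [i ->].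
  destruct HC as [_ [_ [_ [_ [_ [_ [_ [_ Hi]]]]]]]]. destruct (Hi i) as [_ [E0 _]].
  destruct Hs as [[_ Hs]|[_ Hs]]; rewrite E0 in Hs; lra.
Qed.

End Transfer.

Lemma transfer_cancel Z Z' L L' Phi Psi Phi' Psi' z :
  two_orbit_chain Z L Phi Psi -> two_orbit_chain Z' L' Phi' Psi' -> L z ->
  transfer Z' Phi' Psi' Phi Psi (transfer Z Phi Psi Phi' Psi' z) = z.
Proof.
  intros HC HC' Hz. assert (HL := proj1 (proj2 (proj2 (proj2 HC)))). apply HL in Hz.
  destruct Hz as [[u ->]|[u ->]].
  - rewrite (transfer_upper Z L Phi Psi Phi' Psi' HC), (transfer_upper Z' L' Phi' Psi' Phi Psi HC'). reflexivity.
  - rewrite (transfer_lower Z Z' L L' Phi Psi Phi' Psi' HC HC'), (transfer_lower Z' Z L' L Phi' Psi' Phi Psi HC' HC). reflexivity.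
Qed.

Lemma two_orbit_chains_equiv Z Z' L L' Phi Psi Phi' Psi' :
  two_orbit_chain Z L Phi Psi -> two_orbit_chain Z' L' Phi' Psi' -> sigma_equiv Z L Z' L'.
Proof.
  intros HC HC'.
  assert (U := transfer_upper Z L Phi Psi Phi' Psi' HC).
  assert (D := transfer_lower Z Z' L L' Phi Psi Phi' Psi' HC HC').
  assert (U' := transfer_upper Z' L' Phi' Psi' Phi Psi HC').
  assert (D' := transfer_lower Z' Z L' L Phi' Psi' Phi Psi HC' HC).
  assert (I := transfer_in Z Z' L L' Phi Psi Phi' Psi' HC HC').
  assert (K := fun z => transfer_cancel Z Z' L L' Phi Psi Phi' Psi' z HC HC').
  exists (transfer Z Phi Psi Phi' Psi'), (transfer Z' Phi' Psi' Phi Psi).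
  split; [exact I|]. split; [exact (transfer_in Z' Z L' L Phi' Psi' Phi Psi HC' HC)|].
  split; [exact K|].
  split; [intros z Hz; apply (transfer_cancel Z' Z L' L Phi' Psi' Phi Psi z HC' HC Hz)|].
  split; [apply (transfer_continuous Z Z' L L'); assumption|].
  split; [apply (transfer_continuous Z' Z L' L); assumption|].
  split; [|split; [|split]].
  - intros z Hz. rewrite (chain_Sigma Z L Phi Psi HC z Hz), (chain_Sigma Z' L' Phi' Psi' HC' _ (I z Hz)).
    split; intros [i E]; exists i.
    + rewrite E. apply U.
    + rewrite <- (K z Hz), E. apply U'.
  - intros a b Ha Hb. rewrite (chain_orb_X Z L Phi Psi HC), (chain_orb_X Z' L' Phi' Psi' HC').
    split; intros [u [v [Huv [Ea Eb]]]]; exists u, v; split; try exact Huv.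
    + rewrite Ea, Eb. split; apply U.
    + rewrite <- (K a Ha), <- (K b Hb), Ea, Eb. split; apply U'.
  - intros a b Ha Hb. rewrite (chain_orb_Y Z L Phi Psi HC), (chain_orb_Y Z' L' Phi' Psi' HC').
    split; intros [u [v [Huv [Ea Eb]]]]; exists u, v; split; try exact Huv.
    + rewrite Ea, Eb. split; apply D.
    + rewrite <- (K a Ha), <- (K b Hb), Ea, Eb. split; apply D'.
  - intros a b _ _. split; intros H; exfalso.
    + apply (chain_orb_slide Z L Phi Psi HC a b H).
    + apply (chain_orb_slide Z' L' Phi' Psi' HC' _ _ H).
Qed.

(** * The loop and the model *)

Lemma C1_plane_mult g k : C1_plane g -> C1_plane k -> C1_plane (fun p => g p * k p).
Proof.
  intros Hg Hk p. destruct (Hg p) as [A1 [A2 [A3 A4]]]. destruct (Hk p) as [B1 [B2 [B3 B4]]].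
  assert (Cg := C1_plane_continuous g p Hg). assert (Ck := C1_plane_continuous k p Hk).
  split; [|split; [|split]].
  - apply (ex_derive_mult (fun x => g (x, snd p)) (fun x => k (x, snd p))); assumption.
  - apply (ex_derive_mult (fun y => g (fst p, y)) (fun y => k (fst p, y))); assumption.
  - apply (continuous_ext (fun q => dx g q * k q + g q * dx k q)).
    + intros q. symmetry. destruct q as [u v]. unfold dx; simpl.
      rewrite (Derive_mult (fun x => g (x, v)) (fun x => k (x, v))); [reflexivity | apply (Hg (u, v)) | apply (Hk (u, v))].
    + apply (continuous_plus (V := R_NormedModule) (fun q => dx g q * k q) (fun q => g q * dx k q)).
      * apply (continuous_mult (K := R_AbsRing) (dx g) k); assumption.
      * apply (continuous_mult (K := R_AbsRing) g (dx k)); assumption.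
  - apply (continuous_ext (fun q => dy g q * k q + g q * dy k q)).
    + intros q. symmetry. destruct q as [u v]. unfold dy; simpl.
      rewrite (Derive_mult (fun y => g (u, y)) (fun y => k (u, y))); [reflexivity | apply (Hg (u, v)) | apply (Hk (u, v))].
    + apply (continuous_plus (V := R_NormedModule) (fun q => dy g q * k q) (fun q => g q * dy k q)).
      * apply (continuous_mult (K := R_AbsRing) (dy g) k); assumption.
      * apply (continuous_mult (K := R_AbsRing) g (dy k)); assumption.
Qed.

Lemma C1_plane_plus g k : C1_plane g -> C1_plane k -> C1_plane (fun p => g p + k p).
Proof.
  intros Hg Hk p. destruct (Hg p) as [A1 [A2 [A3 A4]]]. destruct (Hk p) as [B1 [B2 [B3 B4]]].
  split; [|split; [|split]].
  - apply (ex_derive_plus (V := R_NormedModule) (fun x => g (x, snd p)) (fun x => k (x, snd p))); assumption.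
  - apply (ex_derive_plus (V := R_NormedModule) (fun y => g (fst p, y)) (fun y => k (fst p, y))); assumption.
  - apply (continuous_ext (fun q => dx g q + dx k q)).
    + intros q. symmetry. destruct q as [u v]. unfold dx; simpl.
      apply (Derive_plus (fun x => g (x, v)) (fun x => k (x, v))); [apply (Hg (u, v)) | apply (Hk (u, v))].
    + apply (continuous_plus (V := R_NormedModule) (dx g) (dx k)); assumption.
  - apply (continuous_ext (fun q => dy g q + dy k q)).
    + intros q. symmetry. destruct q as [u v]. unfold dy; simpl.
      apply (Derive_plus (fun y => g (u, y)) (fun y => k (u, y))); [apply (Hg (u, v)) | apply (Hk (u, v))].
    + apply (continuous_plus (V := R_NormedModule) (dy g) (dy k)); assumption.
Qed.

Lemma smooth_vf_C1 W : smooth_vf W -> C1_field W.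
Proof.
  intros [H1 H2]. split; [apply (smooth_ipart_C1 nil _ H1) | apply (smooth_ipart_C1 nil _ H2)].
Qed.

Lemma lie_C1 W f : smooth_vf W -> smooth_fun f -> C1_plane (lie W f).
Proof.
  intros HW Hf. destruct (smooth_vf_C1 W HW) as [H1 H2].
  apply (C1_plane_plus (fun p => dx f p * fst (W p)) (fun p => dy f p * snd (W p))).
  - apply C1_plane_mult; [apply (smooth_ipart_C1 (cons true nil) f Hf) | exact H1].
  - apply C1_plane_mult; [apply (smooth_ipart_C1 (cons false nil) f Hf) | exact H2].
Qed.

(** The derivative of [lie W f] along [W] is [lie2 W f], so [fold_isolated] applies with the field
    vector at the fold as tangent direction. *)
Lemma loop_folds_isolated W f (q : Z -> pt) :
  smooth_vf W -> smooth_fun f -> (forall i j, q i = q j -> i = j) ->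
  (forall p, f p = 0 -> (dx f p, dy f p) <> (0, 0)) ->
  (forall i, f (q i) = 0 /\ lie W f (q i) = 0 /\ lie2 W f (q i) <> 0) ->
  forall i, exists d, 0 < d /\ forall j, near d (q i) (q j) -> j = i.
Proof.
  intros HW Hf Hq Hreg Hfold i. destruct (Hfold i) as [E1 [E2 E3]].
  destruct (fold_isolated f (lie W f) (W (q i)) (q i)) as [d [Hd K]]; try assumption.
  - apply (smooth_ipart_C1 nil f Hf).
  - apply lie_C1; assumption.
  - apply Hreg, E1.
  - exists d. split; [exact Hd|]. intros j Hj. apply Hq, K; [exact Hj | apply Hfold | apply Hfold].
Qed.

Lemma lie2_nonzero_field W f p : lie2 W f p <> 0 -> W p <> (0, 0).
Proof. intros H E. apply H. unfold lie2, lie at 1. rewrite E. simpl. ring. Qed.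

Lemma loop_two_orbit_chain Z g p :
  wf_psvf Z -> infty_homoclinic_loop Z g p ->
  exists Phi Psi, two_orbit_chain Z (loop_set Z p) Phi Psi.
Proof.
  intros [HX [HY [Hf Hreg]]] [_ [Hp [Hvv [_ [_ [HXarc HYarc]]]]]].
  assert (HX1 := smooth_vf_C1 _ HX). assert (HY1 := smooth_vf_C1 _ HY).
  assert (Hfc : forall z, continuous (psf Z) z) by (intros z; apply C1_plane_continuous, (smooth_ipart_C1 nil _ Hf)).
  assert (XA : forall i T phi, chain_arc (psX Z) (psf Z) p i T phi <-> Xarc Z (p i) (p (i + 1)%Z) T phi).
  { intros i T phi. split.
    - intros [A [B [C [D E]]]]. repeat split; try assumption; try (apply B); try lra;
        destruct (flows_solves _ _ _ _ HX1 (Rlt_le _ _ A) B) as [_ K]; apply K; assumption.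
    - intros [A [B [C [D [E G]]]]]. split; [exact A|]. split; [apply solves_flows; assumption|].
      split; [exact D|]. split; [exact E|]. intros s Hs. apply G, Hs. }
  (* Reversing the index turns the arcs of [Y], which lower the index of [p] by one, into arcs that
     raise it; negating [f] makes their side the positive one. *)
  assert (YA : forall i T phi, chain_arc (psY Z) (fun z => - psf Z z) (fun j => p (- j)%Z) i T phi
                 <-> Yarc Z (p (- i)%Z) (p (- i - 1)%Z) T phi).
  { intros i T phi. unfold chain_arc. replace (- (i + 1))%Z with (- i - 1)%Z by lia. split.
    - intros [A [B [C [D E]]]]. repeat split; try assumption; try (apply B); try lra;
        try (destruct (flows_solves _ _ _ _ HY1 (Rlt_le _ _ A) B) as [_ K]; apply K; assumption).
      intros s Hs. specialize (E s Hs). lra.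
    - intros [A [B [C [D [E G]]]]]. split; [exact A|]. split; [apply solves_flows; assumption|].
      split; [exact D|]. split; [exact E|]. intros s Hs. specialize (G s Hs). simpl in G. lra. }
  destruct (chain_curve (psX Z) (psf Z) p HX1 Hfc Hp) as
    [Phi [om [S1 [S2 [S3 [S4 [S5 [S6 [S7 [S8 [S9 S10]]]]]]]]]]].
  { intros i. apply Hvv. }
  { apply (loop_folds_isolated (psX Z) (psf Z)); try assumption.
    intros i. destruct (Hvv i) as [A [B [C _]]]. repeat split; try assumption. lra. }
  { intros i. destruct (Hvv i) as [_ [_ [C _]]]. apply (lie2_nonzero_field _ (psf Z)). lra. }
  { intros i. destruct (HXarc i) as [T [phi H]]. exists T, phi. apply XA, H. }
  destruct (chain_curve (psY Z) (fun z => - psf Z z) (fun j => p (- j)%Z) HY1) as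
    [Psi [om' [Q1 [Q2 [Q3 [Q4 [Q5 [Q6 [Q7 [Q8 [Q9 Q10]]]]]]]]]]].
  { intros z. apply (continuous_opp (V := R_NormedModule) (psf Z)), Hfc. }
  { intros i j E. apply Hp in E. lia. }
  { intros i. destruct (Hvv (- i)%Z) as [A _]. unfold in_Sigma in A. lra. }
  { apply (loop_folds_isolated (psY Z) (psf Z)); try assumption.
    - intros i j E. apply Hp in E. lia.
    - intros i. destruct (Hvv (- i)%Z) as [A [_ [_ [B C]]]]. repeat split; try assumption. lra. }
  { intros i. destruct (Hvv (- i)%Z) as [_ [_ [_ [_ C]]]]. apply (lie2_nonzero_field _ (psf Z)). lra. }
  { intros i. destruct (HYarc (- i)%Z) as [T [phi H]]. exists T, phi. apply YA, H. }
  exists Phi, Psi.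
  split; [exact (conj HX1 (conj HY1 Hfc))|].
  split; [exact (conj (ex_intro _ om S1) (conj S2 (conj S3 (conj S4 S10))))|].
  split; [exact (conj (ex_intro _ om' Q1) (conj Q2 (conj Q3 (conj Q4 Q10))))|].
  split; [|split; [exact S6|split; [|split; [exact S7|split]]]].
  - intros z. split.
    + intros [i [T [phi [s [Hs [-> [A|A]]]]]]].
      * left. apply (S8 i T phi s); [apply XA, A | exact Hs].
      * right. apply (Q8 (- i)%Z T phi s); [|exact Hs]. apply YA. rewrite Z.opp_involutive. exact A.
    + intros [[u ->]|[u ->]].
      * destruct (S9 u) as [i [T [phi [s [A [Hs E]]]]]]. exists i, T, phi, s.
        split; [exact Hs|]. split; [exact E|]. left. apply XA, A.
      * destruct (Q9 u) as [i [T [phi [s [A [Hs E]]]]]]. exists (- i)%Z, T, phi, s.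
        split; [exact Hs|]. split; [exact E|]. right. apply YA, A.
  - intros u. specialize (Q6 u). simpl in Q6. lra.
  - intros u E. apply Q7. simpl. lra.
  - intros i. rewrite S5, Q5, Z.opp_involutive. split; [apply Hvv|]. split; [apply Hvv | reflexivity].
Qed.

(** * The two orbits of the model *)

Lemma P_inf_derive x : is_derive P_inf x (2 * sin (2 * PI * x)).
Proof. unfold P_inf. assert (H := PI_neq0). auto_derive; [exact I | field; exact H]. Qed.

(** The half-angle form shows both the sign of [P_inf] and its zeros, the integers. *)
Lemma P_inf_sin x : P_inf x = 2 * (sin (PI * x) * sin (PI * x)) / PI.
Proof. unfold P_inf. replace (2 * PI * x) with (2 * (PI * x)) by ring. rewrite cos_2a_sin. f_equal. ring. Qed.

Lemma sin_PI_IZR i : sin (PI * IZR i) = 0.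
Proof. apply sin_eq_0_1. exists i. ring. Qed.

Lemma P_inf_nonneg x : 0 <= P_inf x.
Proof.
  rewrite P_inf_sin. assert (H := PI_RGT_0). apply Rdiv_le_0_compat; [|exact H].
  assert (K := Rle_0_sqr (sin (PI * x))). unfold Rsqr in K. lra.
Qed.

Lemma P_inf_zero x : P_inf x = 0 -> exists i, x = IZR i.
Proof.
  rewrite P_inf_sin. intros E. assert (H := PI_RGT_0).
  assert (E' : sin (PI * x) = 0).
  { apply Rmult_integral in E. destruct E as [E|E].
    - nra.
    - exfalso. apply (Rinv_neq_0_compat PI); lra. }
  destruct (sin_eq_0_0 _ E') as [i Hi]. exists i. apply (Rmult_eq_reg_l PI); lra.
Qed.

Lemma P_inf_IZR i : P_inf (IZR i) = 0.
Proof. rewrite P_inf_sin, sin_PI_IZR. unfold Rdiv. ring. Qed.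

Lemma sine_field_C1 c : C1_field (fun p => (c, 2 * sin (2 * PI * fst p))).
Proof.
  split; intros p; (split; [|split; [|split]]); simpl.
  - apply ex_derive_const.
  - apply ex_derive_const.
  - apply (continuous_ext (fun _ => 0)); [|apply continuous_const].
    intros q. unfold dx. simpl. rewrite Derive_const. reflexivity.
  - apply (continuous_ext (fun _ => 0)); [|apply continuous_const].
    intros q. unfold dy. simpl. rewrite Derive_const. reflexivity.
  - auto_derive. exact I.
  - apply ex_derive_const.
  - apply (continuous_ext (fun q : pt => 2 * (2 * PI * cos (2 * PI * fst q)))).
    + intros q. symmetry. unfold dx. simpl. apply is_derive_unique. auto_derive; [exact I | ring].
    + apply (continuous_comp fst (fun x => 2 * (2 * PI * cos (2 * PI * x)))).
      * destruct p. apply continuous_fst.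
      * apply ex_derive_continuous_R. auto_derive. exact I.
  - apply (continuous_ext (fun _ => 0)); [|apply continuous_const].
    intros q. unfold dy. simpl. rewrite Derive_const. reflexivity.
Qed.

(** The parameter is plus or minus the first coordinate, so injectivity and continuity of the
    inverse are immediate, the latter with the same [e]. *)
Lemma graph_orbit_line W (s : R) (P : R -> R) :
  C1_field W -> (s = 1 \/ s = -1) ->
  (forall u, fst (W (s * u, P u)) = s) -> (forall u, is_derive P u (snd (W (s * u, P u)))) ->
  orbit_line W (fun u => (s * u, P u)).
Proof.
  intros HW Hs HW1 HP.
  assert (Hs0 : s <> 0) by (destruct Hs; lra).
  assert (D : forall u, is_derive (fun u => s * u) u s) by (intros u; auto_derive; [exact I | ring]).
  assert (Cc : forall u, continuous (fun u => (s * u, P u) : pt) u).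
  { intros u. apply continuous_pair; simpl; apply ex_derive_continuous_R; eexists; [apply D | apply HP]. }
  assert (Cs : forall u, continuous (fun u => snd (W (s * u, P u))) u).
  { intros u. apply (field_along_continuous W (fun u => (s * u, P u)) u HW (Cc u)). }
  split; [|split; [|split; [|split]]].
  - exists (fun _ => 1). split; [intros; lra|]. split; intros u; simpl; split.
    + rewrite HW1, Rmult_1_l. apply D.
    + apply (continuous_ext (fun _ => s)); [|apply continuous_const]. intros w. rewrite HW1. symmetry. apply Rmult_1_l.
    + rewrite Rmult_1_l. apply HP.
    + apply (continuous_ext (fun u => snd (W (s * u, P u)))); [intros w; symmetry; apply Rmult_1_l | apply Cs].
  - intros u v E. injection E as E _. apply (Rmult_eq_reg_l s); assumption.
  - intros u E. specialize (HW1 u). rewrite E in HW1. simpl in HW1. lra.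
  - intros u e He. exists e. split; [exact He|]. intros w [H _]. simpl in H.
    replace (s * w - s * u) with (s * (w - u)) in H by ring. rewrite Rabs_mult in H.
    destruct Hs as [-> | ->]; [rewrite Rabs_R1 in H | rewrite (Rabs_left (-1)) in H by lra]; lra.
  - intros u v Huv.
    assert (Fl : flows W u v (fun u => (s * u, P u))).
    { split; [exact Cc|]. intros w _. simpl. rewrite HW1. split; [apply D | apply HP]. }
    assert (Fl' := flows_shift W u v u _ Fl).
    exists (v - u), (fun t => (s * (t + u), P (t + u))).
    split; [lra|]. split; [apply Fl'|]. split; [|split; [|split]].
    + apply flows_solves; [exact HW | lra |]. apply (flows_sub W (u - u) (v - u)); [lra | lra | exact Fl'].
    + rewrite Rplus_0_l. reflexivity.
    + replace (v - u + u) with v by ring. reflexivity.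
    + intros t _. exists (t + u). reflexivity.
Qed.

(** The lower orbit runs to the left, hence its parameter is [- x]; this realises the identification
    of [i] with [- i] at the folds. *)
Lemma Z_inf_two_orbit_chain :
  two_orbit_chain Z_inf Lambda_inf (fun u => (1 * u, P_inf u)) (fun u => (-1 * u, - P_inf (-1 * u))).
Proof.
  split; [|split; [|split; [|split; [|split; [|split; [|split; [|split]]]]]]].
  - split; [apply sine_field_C1|]. split; [apply sine_field_C1|].
    intros [u v]. apply continuous_snd.
  - apply graph_orbit_line; [apply sine_field_C1 | left; reflexivity | reflexivity |].
    intros u. simpl. rewrite Rmult_1_l. apply P_inf_derive.
  - apply graph_orbit_line; [apply sine_field_C1 | right; reflexivity | reflexivity |].
    intros u. simpl. evar_last.
    + apply (is_derive_opp (V := R_NormedModule) (fun u => P_inf (-1 * u))).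
      apply (is_derive_comp (V := R_NormedModule) P_inf (fun u => -1 * u)); [apply P_inf_derive|].
      auto_derive; [exact I | reflexivity].
    + unfold opp, scal; simpl. unfold mult; simpl. ring.
  - intros z. split.
    + intros [x [-> | ->]].
      * left. exists x. rewrite Rmult_1_l. reflexivity.
      * right. exists (- x). replace (-1 * - x) with x by ring. reflexivity.
    + intros [[u ->]|[u ->]].
      * exists u. left. rewrite Rmult_1_l. reflexivity.
      * exists (-1 * u). right. reflexivity.
  - intros u. apply P_inf_nonneg.
  - intros u. simpl. assert (H := P_inf_nonneg (-1 * u)). lra.
  - intros u. apply P_inf_zero.
  - intros u E. simpl in E. destruct (P_inf_zero (-1 * u)) as [i Hi]; [lra|].
    exists (- i)%Z. rewrite opp_IZR. lra.
  - intros i. simpl. rewrite opp_IZR. replace (-1 * - IZR i) with (IZR i) by ring.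
    rewrite Rmult_1_l, P_inf_IZR. split; [reflexivity|]. split.
    + unfold Xf, lie, dx, dy. simpl. rewrite Derive_const, Derive_id.
      replace (2 * PI * IZR i) with (2 * (PI * IZR i)) by ring. rewrite sin_2a, sin_PI_IZR. ring.
    + f_equal. ring.
Qed.

Theorem theoremB (Zt : PSVF) (g : R -> pt) (p : Z -> pt) :
  wf_psvf Zt ->
  infty_homoclinic_loop Zt g p ->
  sigma_equiv Z_inf Lambda_inf Zt (loop_set Zt p).
Proof.
  intros Hwf Hloop. destruct (loop_two_orbit_chain Zt g p Hwf Hloop) as [Phi [Psi HC]].
  exact (two_orbit_chains_equiv _ _ _ _ _ _ _ _ Z_inf_two_orbit_chain HC).
Qed.
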